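(* There exists an absolute constant $C$ for which the following holds. Let $E$ be a Banach space with modulus of convexity of power type $2$ with constant $\lambda$, with unit ball $B_E$. Let $X$ be a random vector in the dual space $E^*$ and let $X_1,\ldots,X_m$ be independent copies of $X$. If $$ A=C\,\lambda^4\,T_2(E^* )\,\sqrt{\frac{\log m}{m}}\left(\mathbb{E}\max_{1\le j\le m}\|X_j\|_*^2\right)^{1/2} \quad\text{and}\quad \sigma^2=\sup_{y\in B_E}\mathbb{E}|\langle X,y\rangle|^2, $$ then $$ \mathbb{E}\sup_{y\in B_E}\left|\frac1m\sum_{j=1}^m|\langle X_j,y\rangle|^2-\mathbb{E}|\langle X,y\rangle|^2\right|\le A^2+\sigma A . $$
   Context: A Banach space $E$ has modulus of convexity of power type $2$ with constant $\lambda>0$ if for all $x,y\in E$, $$\left\|\frac{x+y}{2}\right\|^2+\lambda^{-2}\left\|\frac{x-y}{2}\right\|^2\le\frac12\left(\|x\|^2+\|y\|^2\right).$$ $E^*$ is the dual of $E$, $\|\cdot\|_*$ is the dual norm, and $\langle X,y\rangle$ denotes the duality pairing of $X\in E^*$ with $y\in E$. A Banach space $F$ has type $2$ if there is a constant $C'$ such that for every $N$ and all $x_1,\ldots,x_N\in F$, $\mathbb{E}\|\sum_{i=1}^N g_i x_i\|\le C'\left(\sum_{i=1}^N\|x_i\|^2\right)^{1/2}$, where $g_1,\ldots,g_N$ are independent standard Gaussian variables; the smallest such $C'$ is the type $2$ constant $T_2(F)$. If $E$ has modulus of convexity of power type $2$, then $E^*$ has type $2$, so $T_2(E^* )<\i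nfty$.
   Formalization: The claim is proved for m ≥ 2, since for m = 1 one has log m = 0, so A = 0 and the inequality fails (e.g. X uniform on {0,1} in ℝ); Banach spaces are real and a random vector is norm-Borel and almost surely separably valued. *)

(* Defs.v *)
(* MathComp-Analysis *)
From HB Require Import structures.
From mathcomp Require Import all_boot all_order all_algebra.
From mathcomp Require Import all_classical all_reals all_analysis.

Set Implicit Arguments.
Unset Strict Implicit.
Unset Printing Implicit Defensive.

Import Order.TTheory GRing.Theory Num.Theory.
Import numFieldNormedType.Exports.

Local Open Scope classical_set_scope.
Local Open Scope ring_scope.

Definition unit_ball (R : realType) (E : normedModType R) : set E :=
  [set y | `|y| <= 1].
Arguments unit_ball {R} E.

Definition modulus_convexity_power2 (R : realType) (E : normedModType R)
    (lambda : R) : Prop :=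
  0 < lambda /\
  forall x y : E,
    `|2^-1 *: (x + y)| ^+ 2 + lambda ^- 2 * `|2^-1 *: (x - y)| ^+ 2
    <= 2^-1 * (`|x| ^+ 2 + `|y| ^+ 2).

(* The dual of E: continuous linear forms with pointwise operations, normed by
   the supremum over the unit ball and measured by its norm-Borel sets. *)
Section dual_space.
Context (R : realType) (E : normedModType R).

Definition continuous_linear : {pred E -> R^o} :=
  fun f => `[< linear f /\ continuous f >].

Lemma continuous_linear_submod : submod_closed continuous_linear.
Proof.
split=> [|a f g /asboolP[lf cf] /asboolP[lg cg]]; apply/asboolP; split.
- by move=> a x y; rewrite scaler0 addr0.
- exact: (@cst_continuous E R^o (0 : R^o)).
- move=> b x y; rewrite (_ : (a *: f + g) (b *: x + y) =
    a *: f (b *: x + y) + g (b *: x + y))//.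
  rewrite lf lg !scalerDr !scalerA (mulrC b a) -!addrA; congr (_ + _).
  by rewrite addrCA.
- move=> x; apply: (@continuousD _ _ _ (fun t => a *: f t) g); last exact: cg.
  by apply: cvgZl_tmp; exact: cf.
Qed.

HB.instance Definition _ := GRing.isSubmodClosed.Build R (E -> R^o)
  continuous_linear continuous_linear_submod.

Record dual := Dual { dual_fun :> E -> R^o ; _ : dual_fun \in continuous_linear }.

HB.instance Definition _ := [isSub for dual_fun].
HB.instance Definition _ := [Choice of dual by <:].
HB.instance Definition _ := [SubChoice_isSubLmodule of dual by <:].

Definition dual_norm (f : dual) : R := sup [set `|f y| | y in unit_ball E].

Lemma dual_linear (f : dual) : linear f.
Proof. by case: f => f /= /asboolP[]. Qed.

Lemma dual_continuous (f : dual) : continuous f.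
Proof. by case: f => f /= /asboolP[]. Qed.

Lemma dual0E (f : dual) : f 0 = 0.
Proof.
have := dual_linear f (-1) 0 0.
by rewrite scaler0 addr0 scaleN1r addNr.
Qed.

Lemma dualZ (f : dual) a x : f (a *: x) = a * f x.
Proof. by have := dual_linear f a x 0; rewrite addr0 dual0E addr0. Qed.

Lemma dual_norm_has_sup (f : dual) :
  has_sup [set `|f y| | y in unit_ball E].
Proof.
split; first by exists `|f 0|; exists 0 => //=; rewrite /unit_ball /= normr0.
have /cvgrPdist_lt/(_ 1 ltr01) := @dual_continuous f (0 : E).
move=> /nbhs_norm0P[e /= e0 he].
exists (2 / e) => _ [y /= y1 <-].
have he2 : 0 < e / 2 by rewrite divr_gt0.
have /he : `|e / 2 *: y| < e.
  rewrite normrZ gtr0_norm// (@le_lt_trans _ _ (e / 2))//.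
    by rewrite ler_piMr// ltW.
  by rewrite ltr_pdivrMr// ltr_pMr// ltr1n.
rewrite /= dual0E sub0r normrN dualZ normrM gtr0_norm// => /ltW.
by rewrite -ler_pdivlMl// mulr1 invf_div.
Qed.

Lemma dual_norm_ub (f : dual) y : unit_ball E y -> `|f y| <= dual_norm f.
Proof.
by move=> y1; apply: sup_ubound; [case: (dual_norm_has_sup f)|exists y].
Qed.

Lemma dual_norm_le (f : dual) (M : R) :
  (forall y, unit_ball E y -> `|f y| <= M) -> dual_norm f <= M.
Proof.
move=> fM; apply: ge_sup; first by case: (dual_norm_has_sup f).
by move=> _ [y y1 <-]; exact: fM.
Qed.

Lemma dual_norm_ge0 (f : dual) : 0 <= dual_norm f.
Proof.
have b0 : unit_ball E 0 by rewrite /unit_ball /= normr0.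
exact: le_trans (normr_ge0 _) (dual_norm_ub f b0).
Qed.

Lemma ler_dual_normD (f g : dual) :
  dual_norm (f + g) <= dual_norm f + dual_norm g.
Proof.
apply: dual_norm_le => y y1.
by apply: le_trans (ler_normD _ _) _; apply: lerD; exact: dual_norm_ub.
Qed.

Lemma dual_normZ (a : R) (f : dual) :
  dual_norm (a *: f) = `|a| * dual_norm f.
Proof.
have le b h : dual_norm (b *: h) <= `|b| * dual_norm h.
  apply: dual_norm_le => y y1; rewrite [X in `|X|](_ : _ = b * h y)// normrM.
  by rewrite ler_wpM2l// dual_norm_ub.
apply/eqP; rewrite eq_le le/=.
have [->|a0] := eqVneq a 0; first by rewrite normr0 mul0r dual_norm_ge0.
rewrite -ler_pdivlMl ?normr_gt0//.
by have := le a^-1 (a *: f); rewrite scalerA mulVf// scale1r normfV.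
Qed.

Lemma dual_norm_eq0 (f : dual) : dual_norm f = 0 -> f = 0.
Proof.
move=> f0; apply: val_inj; apply/funext => x /=.
have [->|x0] := eqVneq x 0; first by rewrite dual0E.
have : `|f (`|x|^-1 *: x)| <= 0.
  rewrite -f0; apply: dual_norm_ub.
  by rewrite /unit_ball /= normrZ normfV normr_id mulVf// normr_eq0.
rewrite normr_le0 dualZ mulf_eq0 invr_eq0 normr_eq0 (negbTE x0) /=.
by move=> /eqP.
Qed.

HB.instance Definition _ := Lmodule_isNormed.Build R dual
  ler_dual_normD dual_normZ dual_norm_eq0.

HB.instance Definition _ := @isMeasurable.Build
  (sigma_display (@open dual)) dual <<s (@open dual) >>
  (@sigma_algebra0 _ setT _) (@sigma_algebraC dual (@open dual))
  (@sigma_algebra_bigcup _ setT _).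

End dual_space.

Definition mutually_independent d d' (T : measurableType d)
    (T' : measurableType d') (R : realType) (P : probability T R) (n : nat)
    (X : 'I_n -> {RV P >-> T'}) : Prop :=
  forall (J : {set 'I_n}) (B : 'I_n -> set T'), (forall i, measurable (B i)) ->
    P (\bigcap_(i in [set` J]) X i @^-1` B i) =
    (\prod_(i in J) P (X i @^-1` B i))%E.

(* Equality is only required on measurable sets: off the sigma-algebra the
   value of a measure carries no meaning. *)
Definition same_law d (T : measurableType d) (R : realType)
    (mu nu : set T -> \bar R) : Prop :=
  forall B, measurable B -> mu B = nu B.

(* normal_prob takes the mean and the standard deviation. *)
Definition iid_std_gaussian d (T : measurableType d) (R : realType)
    (P : probability T R) (n : nat) (g : 'I_n -> {RV P >-> R}) : Prop :=
  mutually_independent g /\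
  forall i, same_law (distribution P (g i)) (normal_prob 0 1).

Definition type2_with (R : realType) (F : normedModType R) (c : R) : Prop :=
  forall (d : measure_display) (T : measurableType d) (P : probability T R)
    (n : nat) (g : 'I_n -> {RV P >-> R}) (x : 'I_n -> F),
    iid_std_gaussian g ->
    ('E_P[fun w => `|\sum_(i < n) g i w *: x i|%R]
     <= (c * Num.sqrt (\sum_(i < n) `|x i| ^+ 2))%:E)%E.

(* The type 2 constant; it is +oo when F does not have type 2. *)
Definition type2_constant (R : realType) (F : normedModType R) : \bar R :=
  ereal_inf [set c%:E | c in [set c : R | 0 <= c /\ type2_with F c]].

(* A random vector is a Borel map that almost surely takes its values in a
   separable set, as usual for possibly non-separable Banach spaces. *)
Definition as_separably_valued d (T : measurableType d)
    (R : realType) (P : probability T R) (F : topologicalType)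
    (X : T -> F) : Prop :=
  exists2 D : set F, countable D & {ae P, forall w, closure D (X w)}.

(* Main.v *)
(* By 2-convexity the dual of E has Rademacher type 2 with constant lambda, and
   the near-minimal-norm points of a decreasing sequence of convex subsets of E
   move away from each other, which bounds packing numbers. Applied to the
   functionals x_j and to random signed combinations of them, this covers the
   unit ball of E by exp(O(4^n)) pieces, both for max_j |<x_j, y>| and for the
   weighted norms (sum_j <x_j, u>^2 <x_j, y>^2)^(1/2). Let d be the euclidean
   distance between the vectors of signed squares (<x_j, y> |<x_j, y>|)_j.
   Approximating y by almost minimizers w of |w|^2 + s d(y, w) for s = 2^n / B
   and covering around them refines the ball into partitions whose weighted
   diameters 2^n D_n have sum O(B), where B is of order lambda^3 max_j |x_j|
   sup_y (sum_j <x_j, y>^2)^(1/2) sqrt(log m). Chaining bounds the Rademacher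
   average of sup_y |sum_j eps_j <x_j, y>^2| by O(B), and symmetrization gives
   v <= a sqrt(v + sigma^2), hence v <= a^2 + a sigma, for the mean deviation v
   of a finitely supported law. A general X is approximated in L^2 by a
   finitely valued function of X. Finally lambda >= 1 and T_2(E') >= E|g| > 0,
   with E' the dual of E and g a standard Gaussian variable, so that lambda^3
   is absorbed by lambda^4 T_2(E'). *)
Require Import Defs.
From HB Require Import structures.
From mathcomp Require Import all_boot all_order all_algebra.
From mathcomp Require Import all_classical all_reals all_analysis.
From mathcomp Require Import measurable_realfun.
From mathcomp Require Import ring lra zify.

Set Implicit Arguments.
Unset Strict Implicit.
Unset Printing Implicit Defensive.

Import Order.TTheory GRing.Theory Num.Theory.
Import numFieldNormedType.Exports.

Local Open Scope classical_set_scope.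
Local Open Scope ring_scope.

(** * Rademacher averages *)

(** Squares alone would not do: [y] and [- y] have equal squares, while their midpoint 0 can be far
    from both. The map a |a| is increasing, so the distance from a point to a midpoint is controlled
    by the distances to its two ends, and this is what lets 2-convexity act on near minimizers. An
    increment around a center u then splits into a part with factor |x(u)|, measured by a weighted
    euclidean norm, and a part quadratic in the radius, measured by a maximum; hence two kinds of
    covering. Each refinement loses a term of order B / L. Only L levels are built, with L of order
    log m, so these losses sum to O(B); past level L, Cauchy-Schwarz over at most 2 ^ L coordinates
    is enough. Until the final approximation all randomness is finite: signs and samples are
    averaged by recursion, and one near maximizer per possible sample replaces the unit ball by a
    finite family. *)

Section rademacher_average.
Variables (R : realType) (V : lmodType R).
Implicit Types (s : seq V) (F G : V -> R) (L : V -> R).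

(** The mean over independent fair signs, as a recursion that conditions on the first sign; no
    probability space is involved. *)
Fixpoint rademacher s F : R :=
  if s is v :: s' then
    2^-1 * (rademacher s' (fun w => F (v + w)) + rademacher s' (fun w => F (- v + w)))
  else F 0.

Lemma le_rad s F G : (forall w, F w <= G w) -> rademacher s F <= rademacher s G.
Proof.
elim: s F G => [|v s IH] F G FG //=.
by rewrite ler_pM2l ?invr_gt0// lerD// IH.
Qed.

(* The average only involves the signed sums [w] of [s]; being dominated by
   additive functionals is all that is needed about them. *)
Lemma le_rad_bound s F G :
  (forall w, (forall L : V -> R, (forall v u, L (v + u) = L v + L u) ->
     `|L w| <= \sum_(v <- s) `|L v|) -> F w <= G w) ->
  rademacher s F <= rademacher s G.
Proof.
elim: s F G => [|v s IH] F G FG /=.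
  by apply: FG => L LD; have /eqP := LD 0 0;
    rewrite addr0 -subr_eq0 opprD addNKr oppr_eq0 => /eqP ->; rewrite normr0 big_nil.
rewrite ler_pM2l ?invr_gt0// lerD//; apply: IH => w hw; apply: FG => L LD.
  by rewrite LD big_cons (le_trans (ler_normD _ _))// lerD2l hw.
have L0 : L 0 = 0.
  by have /eqP := LD 0 0; rewrite addr0 -subr_eq0 opprD addNKr oppr_eq0 => /eqP.
have LN : L (- v) = - L v by apply/eqP; rewrite -addr_eq0 -LD addNr L0.
by rewrite LD big_cons (le_trans (ler_normD _ _))// LN normrN lerD2l hw.
Qed.

Lemma eq_rad s F G : (forall w, F w = G w) -> rademacher s F = rademacher s G.
Proof. by move=> FG; apply/eqP; rewrite eq_le !le_rad// => w; rewrite FG. Qed.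

Lemma rad_cst s c : rademacher s (fun=> c) = c.
Proof. by elim: s => //= v s ->; field. Qed.

Lemma radD s F G : rademacher s (fun w => F w + G w) = rademacher s F + rademacher s G.
Proof. by elim: s F G => //= v s IH F G; rewrite !IH; ring. Qed.

Lemma radZ s a F : rademacher s (fun w => a * F w) = a * rademacher s F.
Proof. by elim: s F => //= v s IH F; rewrite !IH; ring. Qed.

Lemma radZr s a F : rademacher s (fun w => F w * a) = rademacher s F * a.
Proof. by rewrite mulrC -radZ; apply: eq_rad => w; rewrite mulrC. Qed.

Lemma rad_sum (I : Type) (r : seq I) (P : pred I) s (F : I -> V -> R) :
  rademacher s (fun w => \sum_(i <- r | P i) F i w) = \sum_(i <- r | P i) rademacher s (F i).
Proof.
elim: r => [|i r IH].
  by rewrite big_nil -[RHS](rad_cst s); apply: eq_rad => w; rewrite big_nil.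
rewrite big_cons -IH; case: ifP => Pi.
  by rewrite -radD; apply: eq_rad => w; rewrite big_cons Pi.
by apply: eq_rad => w; rewrite big_cons Pi.
Qed.

Lemma rad_ge0 s F : (forall w, 0 <= F w) -> 0 <= rademacher s F.
Proof. by move=> F0; rewrite -(rad_cst s 0) le_rad. Qed.

(** The probabilistic method: an estimate in the mean yields one good vector. *)
Lemma rad_gt0_ex s F : 0 < rademacher s F -> exists w, 0 < F w.
Proof.
move=> F0; apply: contrapT => /forallNP nF; move: F0; apply/negP; rewrite -leNgt.
by rewrite -(rad_cst s 0); apply: le_rad => w; rewrite leNgt; apply/negP.
Qed.

Section additive.
Variables (L : V -> R).
Hypotheses (LD : forall v w, L (v + w) = L v + L w).

Let L0 : L 0 = 0.
Proof. by have /eqP := LD 0 0; rewrite addr0 -subr_eq0 opprD addNKr oppr_eq0 => /eqP. Qed.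

Let LN v : L (- v) = - L v.
Proof. by apply/eqP; rewrite -addr_eq0 -LD addNr L0. Qed.

Lemma rad_sqr s : rademacher s (fun w => L w ^+ 2) = \sum_(v <- s) L v ^+ 2.
Proof.
elim: s => [|v s IH]; first by rewrite /= big_nil L0 expr0n.
rewrite big_cons -IH /= -radD -radZ -[X in X + _](rad_cst s) -radD.
by apply: eq_rad => w; rewrite !LD LN; field.
Qed.

(** Khintchine's inequality for fourth moments. The odd cross terms cancel between the two signs,
    and the induction closes because a^4 + 6 a^2 q + 3 q^2 <= 3 (a^2 + q)^2. *)
Lemma rad_pow4 s :
  rademacher s (fun w => L w ^+ 4) <= 3 * (\sum_(v <- s) L v ^+ 2) ^+ 2.
Proof.
elim: s => [|v s IH]; first by rewrite /= big_nil L0 !expr0n mulr0.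
rewrite big_cons /= -radD -radZ.
rewrite (eq_rad _ (_ : _ =1 (fun w => L v ^+ 4 + (6 * L v ^+ 2 * L w ^+ 2 + L w ^+ 4)))).
  rewrite !radD rad_cst radZ rad_sqr.
  have := sqr_ge0 (L v ^+ 2); rewrite -exprM => /= v4.
  by move: IH; set q := \sum_(_ <- _) _ => IH; nra.
by move=> w; rewrite !LD LN; field.
Qed.

End additive.

End rademacher_average.

(** * Exponential moments of Rademacher sums *)

Section cosh.
Variable R : realType.

Lemma expRN2_le (t : R) : 0 <= t -> t <= 2^-1 -> expR (- (2 * t)) <= 1 - t.
Proof.
move=> t0 t1; rewrite expRN -[leRHS]invrK lef_pV2 ?posrE ?expR_gt0//; last first.
  by rewrite invr_gt0; lra.
apply: le_trans (expR_ge1Dx _).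
by rewrite -[leLHS]mul1r ler_pdivrMr; [nra|lra].
Qed.

(** For small x the two exponentials are at most 1 / (1 - x) and 1 / (1 + x), whose mean 1 / (1 -
    x^2) is controlled by [expRN2_le]. For x^2 > 1/2 already x <= 2 x^2. *)
Lemma cosh_le (x : R) : 2^-1 * (expR x + expR (- x)) <= expR (2 * x ^+ 2).
Proof.
wlog x0 : x / 0 <= x => [hw|].
  have [/hw//|/ltW x0] := leP 0 x.
  by have := hw (- x); rewrite opprK sqrrN addrC; apply; rewrite oppr_ge0.
have [x1|x1] := leP (x ^+ 2) 2^-1; last first.
  have : expR (- x) <= expR x by rewrite ler_expR; lra.
  have : expR x <= expR (2 * x ^+ 2).
    by rewrite ler_expR; nra.
  by lra.
have x1' : x < 1 by rewrite ltNge; apply/negP => ?; nra.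
have := expRN2_le (sqr_ge0 x) x1.
have h1 : expR x <= (1 - x)^-1.
  rewrite -[expR x]invrK lef_pV2 ?posrE ?invr_gt0 ?expR_gt0//; last by lra.
  by rewrite -expRN; exact: expR_ge1Dx.
have h2 : expR (- x) <= (1 + x)^-1.
  rewrite expRN lef_pV2 ?posrE ?expR_gt0//; last by lra.
  exact: expR_ge1Dx.
move=> h3; have h4 : (1 - x ^+ 2)^-1 <= expR (2 * x ^+ 2).
  rewrite -[leRHS]invrK lef_pV2 ?posrE ?invr_gt0 ?expR_gt0//; last by nra.
  by rewrite -expRN.
apply: le_trans h4; rewrite [leRHS](_ : _ = 2^-1 * ((1 - x)^-1 + (1 + x)^-1)).
  by rewrite ler_pM2l// lerD.
by field; do ?[apply/andP; split]; apply: lt0r_neq0; nra.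
Qed.

Lemma rad_expR (V : lmodType R) (L : V -> R) (s : seq V) (t : R) :
  (forall v w, L (v + w) = L v + L w) ->
  rademacher s (fun w => expR (t * L w)) <=
  expR (2 * t ^+ 2 * \sum_(v <- s) L v ^+ 2).
Proof.
move=> LD.
have L0 : L 0 = 0.
  by have /eqP := LD 0 0; rewrite addr0 -subr_eq0 opprD addNKr oppr_eq0 => /eqP.
have LN v : L (- v) = - L v by apply/eqP; rewrite -addr_eq0 -LD addNr L0.
elim: s => [|v s IH]; first by rewrite /= L0 mulr0 big_nil mulr0.
rewrite big_cons mulrDr expRD /= -radD -radZ.
rewrite (eq_rad _ (_ : _ =1 (fun w =>
  2^-1 * (expR (t * L v) + expR (- (t * L v))) * expR (t * L w)))); last first.
  by move=> w; rewrite !LD LN !mulrDr mulrN !expRD; ring.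
rewrite radZ; apply: ler_pM => //.
- by apply: rad_ge0 => w; exact: expR_ge0.
- by apply: le_trans (cosh_le _) _; rewrite exprMn mulrA.
Qed.

End cosh.

(** * Euclidean norms of sequences *)

Section l2.
Variables (R : realType) (T : eqType) (xs : seq T).
Implicit Types f g : T -> R.

Definition l2 f : R := Num.sqrt (\sum_(x <- xs) f x ^+ 2).

Lemma l2_ge0 f : 0 <= l2 f. Proof. exact: sqrtr_ge0. Qed.

Lemma sumsq_ge0 f : 0 <= \sum_(x <- xs) f x ^+ 2.
Proof. by apply: sumr_ge0 => x _; exact: sqr_ge0. Qed.

Lemma sqr_l2 f : l2 f ^+ 2 = \sum_(x <- xs) f x ^+ 2.
Proof. by rewrite sqr_sqrtr// sumsq_ge0. Qed.

Lemma le_l2 f g : {in xs, forall x, `|f x| <= `|g x|} -> l2 f <= l2 g.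
Proof.
move=> fg; rewrite ler_sqrt ?sumsq_ge0// big_seq [leRHS]big_seq.
apply: ler_sum => x xxs.
by rewrite -[f x ^+ 2]real_normK ?num_real// -[g x ^+ 2]real_normK ?num_real// lerXn2r
  ?nnegrE ?fg.
Qed.

Lemma eq_l2 f g : f =1 g -> l2 f = l2 g.
Proof. by move=> fg; congr Num.sqrt; apply: eq_bigr => x _; rewrite fg. Qed.

Lemma l2Z a f : l2 (fun x => a * f x) = `|a| * l2 f.
Proof.
rewrite /l2 (eq_bigr (fun x => a ^+ 2 * f x ^+ 2)) => [|x _]; last by rewrite exprMn.
by rewrite -mulr_sumr sqrtrM ?sqr_ge0// sqrtr_sqr.
Qed.

Lemma l2_le f c : 0 <= c -> \sum_(x <- xs) f x ^+ 2 <= c ^+ 2 -> l2 f <= c.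
Proof. by move=> c0 fc; rewrite -[leRHS]ger0_norm// -sqrtr_sqr ler_sqrt// sqr_ge0. Qed.

Lemma l2_eq0 f : l2 f = 0 -> {in xs, forall x, f x = 0}.
Proof.
move=> f0 x xxs; have : \sum_(x <- xs) f x ^+ 2 = 0 by rewrite -sqr_l2 f0 expr0n.
move/eqP; rewrite psumr_eq0 => [|y _]; last exact: sqr_ge0.
by move=> /allP/(_ _ xxs)/=; rewrite sqrf_eq0 => /eqP.
Qed.

Lemma cauchy_schwarz f g : \sum_(x <- xs) f x * g x <= l2 f * l2 g.
Proof.
have [f0|f0] := eqVneq (l2 f) 0.
  rewrite f0 mul0r big_seq big1// => x xxs.
  by rewrite (l2_eq0 f0)// mul0r.
have [g0|g0] := eqVneq (l2 g) 0.
  rewrite g0 mulr0 big_seq big1// => x xxs.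
  by rewrite (l2_eq0 g0)// mulr0.
have fg0 : 0 < l2 f * l2 g by rewrite mulr_gt0// lt_neqAle eq_sym l2_ge0 ?f0 ?g0.
have : 0 <= \sum_(x <- xs) (l2 g * f x - l2 f * g x) ^+ 2 by apply: sumsq_ge0.
rewrite (eq_bigr (fun x => (l2 g ^+ 2 * f x ^+ 2 + l2 f ^+ 2 * g x ^+ 2) +
  (- (2 * (l2 f * l2 g))) * (f x * g x))) => [|x _]; last by ring.
rewrite !big_split /= -!mulr_sumr -!sqr_l2 => h.
by rewrite -(ler_pM2l fg0); nra.
Qed.

Lemma l2D f g : l2 (fun x => f x + g x) <= l2 f + l2 g.
Proof.
apply: l2_le; first by rewrite addr_ge0 ?l2_ge0.
rewrite (eq_bigr (fun x => (f x ^+ 2 + g x ^+ 2) + 2 * (f x * g x))) => [|x _]; last by ring.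
rewrite !big_split /= -mulr_sumr -!sqr_l2.
by have := cauchy_schwarz f g; lra.
Qed.

Lemma l2D_le f g h : {in xs, forall x, `|h x| <= `|f x| + `|g x|} -> l2 h <= l2 f + l2 g.
Proof.
move=> hfg; have -> : l2 f = l2 (fun x => `|f x|).
  by congr Num.sqrt; apply: eq_bigr => x _; rewrite real_normK ?num_real.
have -> : l2 g = l2 (fun x => `|g x|).
  by congr Num.sqrt; apply: eq_bigr => x _; rewrite real_normK ?num_real.
apply: le_trans (l2D _ _); apply: le_l2 => x xxs.
by rewrite [leRHS]ger0_norm ?hfg// addr_ge0.
Qed.

Lemma l2C f g : l2 (fun x => f x - g x) = l2 (fun x => g x - f x).
Proof. by congr Num.sqrt; apply: eq_bigr => x _; rewrite -sqrrN opprB. Qed.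

End l2.

(** * The dual of a 2-convex space *)

Section dual_facts.
Variables (R : realType) (E : normedModType R).
Implicit Types (x : dual E) (y z : E).

Lemma dualD x y z : x (y + z) = x y + x z.
Proof. by have := dual_linear x 1 y z; rewrite !scale1r. Qed.

Lemma dualN x y : x (- y) = - x y.
Proof. by rewrite -scaleN1r dualZ mulN1r. Qed.

Lemma dualB x y z : x (y - z) = x y - x z.
Proof. by rewrite dualD dualN. Qed.

Lemma dual_oppE x y : (- x : dual E) y = - x y.
Proof. by []. Qed.

Lemma dual_le x y : `|x y| <= `|x| * `|y|.
Proof.
have [->|y0] := eqVneq y 0; first by rewrite dual0E !normr0 mulr0.
have y1 : 0 < `|y| by rewrite normr_gt0.
rewrite -ler_pdivrMr//; have := @dual_norm_ub _ _ x (`|y|^-1 *: y).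
rewrite dualZ normrM ger0_norm ?invr_ge0// mulrC; apply.
by rewrite /unit_ball /= normrZ normfV normr_id mulVf// normr_eq0.
Qed.

(** Takes the supremum over the unit ball in an inequality where the evaluation carries a factor [p]
    that may vanish. *)
Lemma ler_pMdual_norm x (p c : R) : 0 <= p ->
  (forall y, `|y| <= 1 -> p * `|x y| <= c) -> p * `|x| <= c.
Proof.
rewrite le_eqVlt => /predU1P[<- /(_ 0)|p0 xc].
  by rewrite normr0 !mul0r => /(_ ler01).
rewrite mulrC -ler_pdivlMr//; apply: dual_norm_le => y y1.
by rewrite ler_pdivlMr// mulrC xc.
Qed.

Variable (lambda : R).
Hypothesis cvxE : modulus_convexity_power2 E lambda.

Let lambda_gt0 : 0 < lambda. Proof. by case: cvxE. Qed.

Lemma convex_midpoint y z :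
  `|2^-1 *: (y + z)| ^+ 2 <=
  2^-1 * (`|y| ^+ 2 + `|z| ^+ 2) - `|y - z| ^+ 2 / (4 * lambda ^+ 2).
Proof.
have := cvxE.2 y z; rewrite [`|_ *: (y - z)|]normrZ exprMn ger0_norm ?invr_ge0//.
rewrite (_ : _ * (_ * _) = `|y - z| ^+ 2 / (4 * lambda ^+ 2)); first by lra.
by field; rewrite gt_eqF.
Qed.

(** 2-convexity of E dualizes to 2-smoothness of the dual with the same constant, because half the
    squared norm and half the squared dual norm are Fenchel conjugate. *)
Lemma dual_smooth (f g : dual E) :
  `|f + g| ^+ 2 + `|f - g| ^+ 2 <= 2 * (`|f| ^+ 2 + lambda ^+ 2 * `|g| ^+ 2).
Proof.
set c := `|f| ^+ 2 + _.
(* In terms of the midpoint and the difference of [y] and [z], Young's inequality for [f] and for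
   [g] leaves exactly the left side of the convexity inequality. *)
have key y z : (f + g) y + (f - g) z - 2^-1 * (`|y| ^+ 2 + `|z| ^+ 2) <= c.
  have -> : (f + g) y + (f - g) z = 2 * f (2^-1 *: (y + z)) + g (y - z).
    rewrite (_ : (f + g) y = f y + g y)// (_ : (f - g) z = f z - g z)//.
    by rewrite dualZ dualD dualB; field.
  have := convex_midpoint y z.
  have := le_trans (ler_norm _) (dual_le f (2^-1 *: (y + z))).
  have := le_trans (ler_norm _) (dual_le g (y - z)).
  set a := `|2^-1 *: _|; set b := `|y - z| => h1 h2 h3.
  have h4 : 2 * (`|f| * a) <= `|f| ^+ 2 + a ^+ 2 by have := sqr_ge0 (`|f| - a); nra.
  have h5 : `|g| * b <= lambda ^+ 2 * `|g| ^+ 2 + b ^+ 2 / (4 * lambda ^+ 2).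
    have := sqr_ge0 (lambda * `|g| - b / (2 * lambda)).
    rewrite sqrrB !exprMn exprVn (_ : _ * _ *+ 2 = `|g| * b); last first.
      by rewrite mulr2n; field; rewrite gt_eqF.
    rewrite (_ : (2 * lambda) ^+ 2 = 4 * lambda ^+ 2); last by ring.
    by lra.
  by rewrite /c; lra.
set p := `|f + g|; set q := `|f - g|.
have key2 y z : `|y| <= 1 -> `|z| <= 1 ->
    p * `|(f + g) y| + q * `|(f - g) z| <= c + 2^-1 * (p ^+ 2 + q ^+ 2).
  move=> y1 z1.
  have sgE (h : dual E) (u : E) : `|u| <= 1 -> exists2 v : E, `|v| <= 1 & `|h u| = h v.
    move=> u1; have [hu|hu] := leP 0 (h u); first by exists u; rewrite ?ger0_norm.
    by exists (- u); rewrite ?normrN// dualN ltr0_norm.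
  have [{}y {}y1 ->] := sgE (f + g) _ y1.
  have [{}z {}z1 ->] := sgE (f - g) _ z1.
  (* Scaling by the norms p and q makes the test vectors extremal: the supremum over [y] and [z]
     will give p^2 + q^2 on the left against half of it on the right. *)
  have := key (p *: y) (q *: z); rewrite !dualZ !normrZ !exprMn.
  have -> : `|p| = p by rewrite ger0_norm// /p.
  have -> : `|q| = q by rewrite ger0_norm// /q.
  have : p ^+ 2 * `|y| ^+ 2 <= p ^+ 2 by rewrite ler_piMr ?sqr_ge0// exprn_ile1.
  have : q ^+ 2 * `|z| ^+ 2 <= q ^+ 2 by rewrite ler_piMr ?sqr_ge0// exprn_ile1.
  by lra.
have key3 z : `|z| <= 1 -> q * `|(f - g) z| <= c + 2^-1 * (p ^+ 2 + q ^+ 2) - p * p.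
  move=> z1; rewrite lerBrDr -lerBrDl; apply: ler_pMdual_norm => [|y y1]; first exact: normr_ge0.
  by have := key2 _ _ y1 z1; lra.
by have := ler_pMdual_norm (normr_ge0 _) key3; rewrite -/q; lra.
Qed.

(** Rademacher type 2 of the dual: average [dual_smooth] over one sign at a time, with [f] the sum
    of the later terms and [g] the current one. *)
Lemma rad_normsq (s : seq (dual E)) :
  rademacher s (fun w => `|w| ^+ 2) <= lambda ^+ 2 * \sum_(v <- s) `|v| ^+ 2.
Proof.
elim: s => [|v s IH]; first by rewrite /= normr0 big_nil expr0n mulr0.
rewrite big_cons /= -radD mulrDr addrC.
apply: le_trans (_ : rademacher s (fun w => `|w| ^+ 2) + lambda ^+ 2 * `|v| ^+ 2 <= _).
  rewrite ler_pdivrMl// -[X in _ * (_ + X)](rad_cst s) -radD -radZ.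
  apply: le_rad => w; have := dual_smooth w v.
  by rewrite (addrC v) (addrC (- v)).
by rewrite lerD2r.
Qed.

End dual_facts.

(** * Packing in 2-convex spaces *)

Section packing.
Variables (R : realType) (E : normedModType R) (lambda : R).
Hypothesis cvxE : modulus_convexity_power2 E lambda.

Let lambda_gt0 : 0 < lambda. Proof. by case: cvxE. Qed.

Section recursion.
Variables (I : finType) (V : I -> E) (close : E -> pred I).
Variables (K : nat) (Q tau : R).
Hypotheses (Q_gt0 : 0 < Q) (tau_gt0 : 0 < tau).
Hypothesis separation : forall (z : E) (A : {set I}),
  (forall i, i \in A -> ~~ close z i) ->
  exists W : dual E, `|W| <= Q /\
    (#|A| <= K * #|[set i in A | (tau <= W (V i - z))%R]%SET|)%N.

Let delta := tau ^+ 2 / (4 * lambda ^+ 2 * Q ^+ 2).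

Let delta_gt0 : 0 < delta.
Proof. by rewrite divr_gt0 ?mulr_gt0 ?exprn_gt0. Qed.

(* The near-minimal points of the nested convex sets [C] cut out by the
   functionals [W] move by at least [tau / Q] at each step, so by 2-convexity
   their squared norm grows by [delta] and at most [1 / delta] cuts are
   possible. *)
Lemma packing_recursion (k : nat) (C : set E) (A : {set I}) (t : R) :
  (forall z, {in A &, forall i j, close z i -> close z j -> i = j}) ->
  (forall y z, C y -> C z -> C (2^-1 *: (y + z))) ->
  (forall i, i \in A -> C (V i) /\ `|V i| <= 1) ->
  (forall y, C y -> t <= `|y| ^+ 2) -> 1 < t + k%:R * delta ->
  (#|A| <= if k is k'.+1 then K.+1 ^ k' else 0)%N.
Proof.
elim: k C A t => [|k IH] C A t closeA cvxC AC Ct tk.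
  rewrite leqn0 cards_eq0 -finset.subset0; apply/fintype.subsetP => i iA; exfalso.
  have [/Ct h1 h2] := AC _ iA.
  have : `|V i| ^+ 2 <= 1 by rewrite exprn_ile1.
  by move: tk; rewrite mul0r; lra.
have [->|[i0 i0A]] := set_0Vmem A; first by rewrite cards0.
pose N := [set `|y| ^+ 2 | y in C].
have N_inf : has_inf N.
  split; first by exists (`|V i0| ^+ 2), (V i0) => //; have [] := AC _ i0A.
  by exists 0 => _ [y _ <-]; exact: sqr_ge0.
have leN y : C y -> inf N <= `|y| ^+ 2.
  by move=> Cy; apply: ge_inf; [case: N_inf|exists y].
have tN : t <= inf N by apply: lb_le_inf; [case: N_inf|move=> _ [y /Ct ? <-]].
(* At most one index is close to this near-minimal [z]. Dropping it and applying [separation] gives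
   #|A| <= 1 + K * #|A''|, the recursion behind the powers of [K.+1]. *)
have [_ [z Cz <-] zN] := inf_adherent delta_gt0 N_inf.
pose A' := [set i in A | ~~ close z i]%SET.
have cardA : (#|A| <= 1 + #|A'|)%N.
  rewrite -(cardsID [set i | close z i]%SET A) leq_add//.
    apply/card_le1P => i; rewrite !inE => /andP[iA zi] j.
    rewrite !inE; apply/idP/idP => [/andP[jA zj]|/eqP->]; last by rewrite iA.
    by apply/eqP; apply: closeA zj zi.
  by apply: subset_leq_card; apply/fintype.subsetP => i; rewrite !inE andbC.
have [|W [WQ cardA']] := separation (z := z) (A := A').
  by move=> i; rewrite inE => /andP[].
set A'' := [set i in A' | _]%SET in cardA'.
have : (#|A''| <= if k is k'.+1 then K.+1 ^ k' else 0)%N.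
  apply: (IH (C `&` [set y | tau <= W (y - z)]) A'' (t + delta)).
  - move=> u i j; rewrite !inE => /andP[/andP[iA _] _] /andP[/andP[jA _] _].
    exact: closeA.
  - move=> y y' [Cy /= Wy] [Cy' /= Wy']; split; first exact: cvxC.
    by rewrite /= !dualB dualZ dualD in Wy Wy' *; lra.
  - move=> i; rewrite !inE => /andP[/andP[iA _] Wi].
    by have [? ?] := AC _ iA.
  (* The midpoint of [z] and [y] lies in [C], so its squared norm is at least the infimum, while
     that of [z] exceeds it by less than [delta]. Since |z - y| >= tau / Q, the convexity defect is
     worth 2 delta in |y|^2; one [delta] pays for [z] and one is gained. *)
  - move=> y [Cy /= Wy].
    have := leN _ (cvxC _ _ Cz Cy); have := convex_midpoint cvxE z y.
    suff : 2 * delta <= 2 * (`|z - y| ^+ 2 / (4 * lambda ^+ 2)) by lra.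
    rewrite ler_pM2l// /delta.
    rewrite [leLHS](_ : _ = (tau / Q) ^+ 2 / (4 * lambda ^+ 2)); last first.
      by field; rewrite !gt_eqF.
    rewrite ler_pM2r ?invr_gt0 ?mulr_gt0 ?exprn_gt0//.
    rewrite lerXn2r ?nnegrE ?divr_ge0 ?(ltW tau_gt0) ?(ltW Q_gt0)//.
    rewrite ler_pdivrMr// mulrC distrC.
    apply: le_trans Wy _; apply: le_trans (ler_norm _) _.
    by apply: le_trans (dual_le _ _) _; rewrite ler_wpM2r.
  - by move: tk; rewrite mulrSr; lra.
move=> hA''; case: k hA'' {IH tk} => [|k] hA''.
  by rewrite expn0; move: hA'' cardA' cardA; rewrite leqn0 => /eqP->; lia.
have : (0 < K.+1 ^ k)%N by rewrite expn_gt0.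
by rewrite expnS; nia.
Qed.

End recursion.

(** A maximal 2 eps-separated subfamily is also a 2 eps-net, and no point is within [eps] of two of
    its members, so [packing_recursion] counts it. The label of an index is a net point near it,
    whence the diameter 4 eps. *)
Lemma covering (I : finType) (V : I -> E) (rho : E -> R) (K : nat)
    (Q tau eps : R) :
  0 < Q -> 0 < tau -> 0 <= eps -> (forall i, `|V i| <= 1) ->
  rho 0 = 0 -> (forall y z, rho (y - z) <= rho y + rho z) ->
  (forall (z : E) (A : {set I}),
    (forall i, i \in A -> eps < rho (V i - z)) ->
    exists W : dual E, `|W| <= Q /\
      (#|A| <= K * #|[set i in A | (tau <= W (V i - z))%R]%SET|)%N) ->
  exists q : I -> nat,
    (forall i, q i < K.+1 ^ Num.trunc (4 * lambda ^+ 2 * Q ^+ 2 / tau ^+ 2))%N /\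
    (forall i j, q i = q j -> rho (V i - V j) <= 4 * eps).
Proof.
move=> Q0 tau0 eps0 V1 rho0 rhoB sep.
set N := Num.trunc _.
have rhoC y z : rho (y - z) = rho (z - y).
  have le u : rho (- u) <= rho u by have := rhoB 0 u; rewrite sub0r rho0 add0r.
  have h u v : rho (u - v) <= rho (v - u) by rewrite -opprB le.
  by apply/eqP; rewrite eq_le !h.
have rhoT y z w : rho (y - z) <= rho (y - w) + rho (z - w).
  by have := rhoB (y - w) (z - w); rewrite opprB addrA subrK.
pose sepd (A : {set I}) := [forall i in A, [forall j in A,
   (i != j) ==> (2 * eps < rho (V i - V j))]].
have [A maxA] : {A : {set I} | maxset sepd A}.
  by apply: ex_maxset; exists (finset.set0); apply/forall_inP => i; rewrite inE.
have sepA : {in A &, forall i j, i != j -> 2 * eps < rho (V i - V j)}.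
  by move=> i j iA jA; have /forall_inP/(_ _ iA)/forall_inP/(_ _ jA)/implyP := maxsetp maxA.
have cardA : (#|A| <= K.+1 ^ N)%N.
  (* The cuts start from the whole space with lower bound 0; [N.+1] increments already exceed 1, the
     largest squared norm in the family. *)
  have := @packing_recursion I V (fun z i => rho (V i - z) <= eps) K Q tau Q0 tau0 _
    N.+1 setT A 0; apply => //.
  - move=> z B hB; apply: sep => i iB; rewrite ltNge.
    exact: hB.
  - move=> z i j iA jA zi zj; apply/eqP; apply: contrapT => /negP ij.
    by have := sepA _ _ iA jA ij; have := rhoT (V i) (V j) z; lra.
  - rewrite add0r -ltr_pdivrMr ?div1r ?divr_gt0 ?mulr_gt0 ?exprn_gt0//.
    rewrite invf_div; have /truncn_itv/andP[_ //] : 0 <= 4 * lambda ^+ 2 * Q ^+ 2 / tau ^+ 2.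
    by rewrite ltW// divr_gt0 ?mulr_gt0 ?exprn_gt0.
have near i : exists a, (a \in A) && (rho (V i - V a) <= 2 * eps).
  apply: contrapT => /forallNP na.
  have nai a : a \in A -> 2 * eps < rho (V i - V a).
    by move=> aA; rewrite ltNge; apply/negP => h; apply: (na a); rewrite aA.
  have iA : i \notin A by apply/negP => /nai; rewrite subrr rho0; lra.
  have /maxsetP[_ /(_ (i |: A)%SET)] := maxA.
  suff h : sepd (i |: A)%SET.
    by move=> /(_ h (finset.subsetUr _ _)) iAA; move: iA; rewrite -iAA !inE eqxx.
  apply/forall_inP => a; rewrite !inE => aA; apply/forall_inP => b; rewrite !inE => bA.
  apply/implyP; move: aA bA => /orP[/eqP->|aA] /orP[/eqP->|bA]; rewrite ?eqxx//.
  - by move=> _; exact: nai.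
  - by move=> _; rewrite rhoC; exact: nai.
  - exact: sepA.
pose a i := xchoose (near i).
have aP i : a i \in A /\ rho (V i - V (a i)) <= 2 * eps.
  by have /andP[] := xchooseP (near i).
exists (fun i => index (a i) (enum A)); split=> [i|i j ij].
  by apply: leq_trans cardA; rewrite cardE index_mem mem_enum; have [] := aP i.
have aij : a i = a j.
  have := nth_index (a i) (_ : a i \in enum A); rewrite ij => <-; last first.
    by rewrite mem_enum; have [] := aP i.
  by rewrite nth_index// mem_enum; have [] := aP j.
have [_ hi] := aP i; have [_ hj] := aP j; rewrite aij in hi.
by have := rhoT (V i) (V j) (V (a j)); lra.
Qed.

End packing.

(** Supplies the factor [K] of the separation hypothesis: among finitely many candidate functionals,
    one serves a fixed fraction of the indices. *)
Lemma card_pigeonhole (I : finType) (T : eqType) (ws : seq T) (p : T -> pred I)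
    (A : {set I}) :
  (forall i, i \in A -> has (fun w => p w i) ws) -> (0 < #|A|)%N ->
  exists2 w, w \in ws & (#|A| <= size ws * #|[set i in A | p w i]%SET|)%N.
Proof.
move=> Aws A0; pose c w := #|[set i in A | p w i]%SET|.
have cardA : (#|A| <= \sum_(w <- ws) c w)%N.
  rewrite /c; elim: ws A {A0 c} Aws => [|w ws IH] A Aws.
    rewrite big_nil leqn0 cards_eq0 -finset.subset0.
    by apply/fintype.subsetP => i /Aws.
  rewrite big_cons -(cardsID [set i | p w i]%SET A) leq_add//.
    by apply: subset_leq_card; apply/fintype.subsetP => i; rewrite !inE.
  apply: leq_trans (IH _ _) _ => [i|].
    by rewrite !inE => /andP[npi /Aws/=]; rewrite (negbTE npi).
  apply: leq_sum => v _; apply: subset_leq_card; apply/fintype.subsetP => i.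
  by rewrite !inE => /andP[/andP[_ ->] ->].
apply: contrapT => nex.
have lt w : w \in ws -> (size ws * c w <= #|A|.-1)%N.
  move=> wws; rewrite -ltnS prednK// ltnNge; apply/negP => h.
  by apply: nex; exists w.
have : (size ws * \sum_(w <- ws) c w <= size ws * #|A|.-1)%N.
  rewrite big_distrr /= big_seq (leq_trans (leq_sum _ lt))//.
  by rewrite -big_seq big_const_seq count_predT iter_addn addn0 mulnC.
have : (0 < size ws)%N.
  by case: ws Aws {cardA nex lt} => // h; have /card_gt0P[i /h] := A0.
by move: cardA; nia.
Qed.

Section coverings.
Variables (R : realType) (E : normedModType R) (lambda : R).
Hypothesis cvxE : modulus_convexity_power2 E lambda.
Variables (xs : seq (dual E)) (M S : R) (L : nat).
Hypotheses (M_gt0 : 0 < M) (S_gt0 : 0 < S) (L_gt0 : (0 < L)%N).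
Hypothesis xsL : (size xs <= 2 ^ L)%N.
Hypothesis xsM : {in xs, forall x : dual E, `|x| <= M}.
Hypothesis xsS : forall y : E, `|y| <= 1 -> \sum_(x <- xs) x y ^+ 2 <= S ^+ 2.

Let lambda_gt0 : 0 < lambda. Proof. by case: cvxE. Qed.

Lemma l2_le_norm (y : E) : l2 xs (fun x => x y) <= S * `|y|.
Proof.
have [->|y0] := eqVneq y 0.
  rewrite normr0 mulr0; apply: l2_le => //.
  by rewrite big1 ?expr0n// => x _; rewrite dual0E expr0n.
have y1 : 0 < `|y| by rewrite normr_gt0.
have : l2 xs (fun x => x (`|y|^-1 *: y)) <= S.
  apply: l2_le; first exact: ltW.
  by apply: xsS; rewrite normrZ normfV normr_id mulVf ?gt_eqF.
rewrite (_ : l2 _ _ = l2 xs (fun x : dual E => `|y|^-1 * x y)); last first.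
  by apply: eq_l2 => x; rewrite dualZ.
by rewrite l2Z ger0_norm ?invr_ge0// mulrC ler_pdivrMr.
Qed.

(** The separating functionals are the entries of [xs] and their negatives, all of norm at most [M].
    There are at most 2 ^ (L + 1) of them, so each cut costs O(L) bits; this is where the square
    root of [L] enters. *)
Lemma covering_sup (I : finType) (V : I -> E) (n : nat) :
  (forall i, `|V i| <= 1) ->
  exists q : I -> nat, (forall i, q i < 2 ^ (3 * 4 ^ n))%N /\
    (forall i j, q i = q j ->
      {in xs, forall x : dual E, `|x (V i - V j)| <= 8 * lambda * M * Num.sqrt L%:R / 2 ^+ n}).
Proof.
move=> V1; pose rho (v : E) := \big[Num.max/0]_(x <- xs) `|x v|.
have rho_le v c : 0 <= c -> {in xs, forall x : dual E, `|x v| <= c} -> rho v <= c.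
  move=> c0 h; rewrite /rho big_seq; elim/big_ind : _ => // a b ac bc.
  by rewrite ge_max ac.
have le_rho v : {in xs, forall x : dual E, `|x v| <= rho v}.
  move=> x xxs; rewrite /rho.
  by apply: (@le_bigmax_seq _ R (dual E) xs 0 x xpredT (fun x : dual E => `|x v|)).
have rho_ge0 v : 0 <= rho v by rewrite /rho; elim/big_ind : _ => // a b a0 b0; rewrite le_max a0.
have sL : 0 < Num.sqrt L%:R :> R by rewrite sqrtr_gt0 ltr0n.
(* Chosen so that the number of cuts 4 lambda^2 M^2 / eps^2 equals 4^n / L, leaving a total of 3 *
   4^n bits. *)
pose eps := 2 * lambda * M * Num.sqrt L%:R / 2 ^+ n.
have eps_gt0 : 0 < eps by rewrite !(mulr_gt0, invr_gt0, exprn_gt0).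
have [|||||||q [qlt qrho]] := @covering _ _ _ cvxE I V rho (size xs).*2 M eps eps => //.
- exact: ltW.
- by apply/eqP; rewrite eq_le rho_ge0 andbT; apply: rho_le => // x _; rewrite dual0E normr0.
- move=> y z; apply: rho_le => [|x xxs]; first by rewrite addr_ge0.
  by rewrite dualB; apply: le_trans (ler_normB _ _) _; rewrite lerD// le_rho.
- move=> z A epsA; have [->|A0] := posnP #|A|.
    by exists 0; rewrite normr0 ltW.
  have [i iA|//|W] := @card_pigeonhole I (dual E) (xs ++ map -%R xs)
    (fun w i => eps <= w (V i - z)) A.
    apply: contrapT => /negP; rewrite -all_predC => /allP h.
    have := epsA _ iA; apply/negP; rewrite -leNgt; apply: rho_le => [|x xxs].
      exact: ltW.
    rewrite ler_norml; apply/andP; split.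
      have : (- x : dual E) \in xs ++ map -%R xs by rewrite mem_cat map_f ?orbT.
      by move=> /h /=; rewrite [X in eps <= X]dual_oppE; lra.
    have : x \in xs ++ map -%R xs by rewrite mem_cat xxs.
    by move=> /h /=; lra.
  rewrite size_cat size_map addnn => Wxs hW; exists W; split=> //.
  move: Wxs; rewrite mem_cat => /orP[/xsM//|/mapP[x /xsM ? ->]].
  by rewrite normrN.
exists q; split=> [i|i j /qrho h x xxs]; last first.
  by apply: le_trans (le_rho _ _ xxs) _; apply: le_trans h _; rewrite /eps; lra.
apply: leq_trans (qlt i) _.
set N := Num.trunc _.
have NL : (N * L <= 4 ^ n)%N.
  rewrite -(ler_nat R) natrM natrX.
  rewrite -ler_pdivlMr ?ltr0n//; set r := 4 * _ * _ / _ in N *.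
  have -> : 4%:R ^+ n / L%:R = r.
    have -> : 4%:R ^+ n = (2 ^+ n) ^+ 2 :> R by rewrite -exprM mulnC exprM; congr (_ ^+ _); rewrite -natrX.
    rewrite [X in _ / X](_ : L%:R = Num.sqrt L%:R ^+ 2); last by rewrite sqr_sqrtr.
    by rewrite /r /eps; field; rewrite !gt_eqF ?exprn_gt0.
  by have /truncn_itv/andP[] : 0 <= r by rewrite ltW// divr_gt0 ?mulr_gt0 ?exprn_gt0.
have [->|N0] := posnP N; first by rewrite expn0 expn_gt0.
apply: leq_trans (_ : (2 ^ (3 * L)) ^ N <= _)%N.
  rewrite leq_exp2r//; apply: leq_trans (_ : 2 ^ (L + 2) <= _)%N.
    by rewrite expnD; have : (0 < 2 ^ L)%N by [rewrite expn_gt0]; lia.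
  by rewrite leq_exp2l//; lia.
by rewrite -expnM leq_exp2l// -mulnA leq_mul2l mulnC NL.
Qed.

End coverings.

Lemma sum_card (I : finType) (R : realType) (A : {set I}) (p : pred I) :
  \sum_(i in A) (p i)%:R = #|[set i in A | p i]%SET|%:R :> R.
Proof.
rewrite -sum1_card natr_sum (bigID p) /= [X in _ + X]big1 ?addr0.
  by apply: eq_big => [i|i /andP[_ ->]//]; rewrite inE.
by move=> i /andP[_ /negbTE->].
Qed.

(** * Coverings for the weighted euclidean norms *)

Section covering_weighted.
Variables (R : realType) (E : normedModType R) (lambda : R).
Hypothesis cvxE : modulus_convexity_power2 E lambda.
Variables (xs : seq (dual E)) (M S : R).
Hypotheses (M_gt0 : 0 < M) (S_gt0 : 0 < S).
Hypothesis xsM : {in xs, forall x : dual E, `|x| <= M}.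
Hypothesis xsS : forall y : E, `|y| <= 1 -> \sum_(x <- xs) x y ^+ 2 <= S ^+ 2.

Let lambda_gt0 : 0 < lambda. Proof. by case: cvxE. Qed.

(* Paley-Zygmund for the random functional [sum_x eps_x x(u) x], written as a
   polynomial lower bound on the indicator of [N / 2 <= |a|]. *)
Lemma indicator_ge (a N : R) : 0 < N ->
  2^-1 * (a ^+ 2 / N ^+ 2) - 16^-1 * (a ^+ 4 / N ^+ 4) - 8^-1 <= ((N / 2 <= `|a|)%R)%:R.
Proof.
move=> N0; set t := a ^+ 2 / N ^+ 2.
have -> : a ^+ 4 / N ^+ 4 = t ^+ 2 by rewrite /t; field; rewrite gt_eqF.
have t0 : 0 <= t by rewrite divr_ge0 ?sqr_ge0.
(* t / 2 - t^2 / 16 is at most 1, its value at t = 4, and is at most 1/8 when t <= 1/4; the constant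
   term removes that 1/8. *)
case: (leP (N / 2)) => aN /=; first by have := sqr_ge0 (t - 4); lra.
have : t <= 4^-1.
  rewrite ler_pdivrMr ?exprn_gt0//.
  have : `|a| ^+ 2 <= (N / 2) ^+ 2.
    by apply: lerXn2r; rewrite ?nnegrE//; lra.
  by rewrite real_normK ?num_real//; lra.
by have := sqr_ge0 t; lra.
Qed.

(** The separating functional is a random signed sum of the x(u) x. Its value at [V i - z] has
    second moment rho(V i - z)^2, so it is often large, while type 2 keeps its norm of order lambda
    M S. The cost per cut is thus an absolute constant, without the factor [L] of [covering_sup]. *)
Lemma covering_weighted (I : finType) (V : I -> E) (u : E) (n : nat) :
  (forall i, `|V i| <= 1) -> `|u| ^+ 2 <= 2 ->
  exists q : I -> nat, (forall i, q i < 2 ^ (5 * 4 ^ n))%N /\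
    (forall i j, q i = q j ->
      l2 xs (fun x => x u * x (V i - V j)) <= 96 * lambda ^+ 2 * M * S / 2 ^+ n).
Proof.
move=> V1 u2; pose rho (v : E) := l2 xs (fun x : dual E => x u * x v).
(* With [Q] below and tau = eps / 2, the number of cuts is exactly 4^n; with K = 16, each cut costs
   [K.+1] = 17 <= 2^5. *)
pose eps := 24 * lambda ^+ 2 * M * S / 2 ^+ n.
have eps_gt0 : 0 < eps by rewrite !(mulr_gt0, invr_gt0, exprn_gt0).
pose Q := 6 * lambda * M * S.
have Q_gt0 : 0 < Q by rewrite !mulr_gt0.
have [|||||||q [qlt qrho]] := @covering _ _ _ cvxE I V rho 16 Q (eps / 2) eps => //.
- by rewrite divr_gt0.
- exact: ltW.
- by apply/eqP; rewrite eq_le l2_ge0 andbT; apply: l2_le => //; rewrite big1 ?expr0n// =>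
    x _; rewrite dual0E mulr0 expr0n.
- move=> y z; apply: l2D_le => x _; rewrite dualB mulrBr; exact: ler_normB.
- move=> z A epsA; have [->|A0] := posnP #|A|.
    by exists 0; rewrite normr0 ltW.
  pose N i := rho (V i - z).
  have N_gt0 i : i \in A -> 0 < N i by move=> /epsA; exact: lt_trans.
  pose s : seq (dual E) := [seq x u *: x | x : dual E <- xs].
  (* The sum bounds from below the number of indices where [w] is large, and the last term penalizes
     a large norm. In the mean each index contributes at least 1/2 - 3/16 - 1/8 = 3/16 and the
     penalty is at most 1/18 per index, which leaves more than 1/8. *)
  pose F (w : dual E) := \sum_(i in A) (2^-1 * (w (V i - z) ^+ 2 / N i ^+ 2)
     - 16^-1 * (w (V i - z) ^+ 4 / N i ^+ 4) - 8^-1) - #|A|%:R * (`|w| ^+ 2 / Q ^+ 2).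
  have A0' : 0 < #|A|%:R :> R by rewrite ltr0n.
  have sumN v : \sum_(w <- s) w v ^+ 2 = rho v ^+ 2.
    by rewrite sqr_l2 big_map; apply: eq_bigr.
  have radF : #|A|%:R * (7 / 54) <= rademacher s F.
    have -> : rademacher s F = \sum_(i in A) (2^-1 * (rademacher s (fun w => w (V i - z) ^+ 2) / N i ^+ 2)
     - 16^-1 * (rademacher s (fun w => w (V i - z) ^+ 4) / N i ^+ 4) - 8^-1) -
       #|A|%:R * (rademacher s (fun w => `|w| ^+ 2) / Q ^+ 2).
      pose G i (w : dual E) := (2^-1 / N i ^+ 2) * w (V i - z) ^+ 2
        + ((- 16^-1 / N i ^+ 4) * w (V i - z) ^+ 4 + (- 8^-1)).
      rewrite (eq_rad _ (_ : _ =1 (fun w => \sum_(i in A) G i w +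
         (- #|A|%:R / Q ^+ 2) * `|w| ^+ 2))).
        rewrite radD radZ rad_sum; congr (_ + _); last by ring.
        by apply: eq_bigr => i _; rewrite !radD !radZ rad_cst; ring.
      move=> w; rewrite /F; congr (_ + _); last by ring.
      by apply: eq_bigr => i _; rewrite /G; ring.
    have h1 : rademacher s (fun w => `|w| ^+ 2) / Q ^+ 2 <= 18^-1.
      rewrite ler_pdivrMr ?exprn_gt0//; apply: le_trans (rad_normsq cvxE _) _.
      rewrite [leRHS](_ : _ = lambda ^+ 2 * (M ^+ 2 * (S ^+ 2 * 2))); last by rewrite /Q; field.
      rewrite ler_wpM2l ?sqr_ge0// big_map.
      apply: le_trans (_ : \sum_(x <- xs) M ^+ 2 * x u ^+ 2 <= _).
        rewrite big_seq [leRHS]big_seq; apply: ler_sum => x /xsM xM.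
        rewrite normrZ exprMn mulrC real_normK ?num_real// ler_wpM2r ?sqr_ge0//.
        by rewrite lerXn2r ?nnegrE// ltW.
      rewrite -mulr_sumr ler_wpM2l ?sqr_ge0// -sqr_l2.
      apply: le_trans (_ : (S * `|u|) ^+ 2 <= _).
        rewrite lerXn2r ?nnegrE ?l2_ge0 ?mulr_ge0 ?(ltW S_gt0)//.
        exact: (@l2_le_norm R E xs S S_gt0 xsS).
      by rewrite exprMn ler_wpM2l ?sqr_ge0.
    have h2 i : i \in A -> 3 / 16 <= 2^-1 * (rademacher s (fun w => w (V i - z) ^+ 2) / N i ^+ 2)
     - 16^-1 * (rademacher s (fun w => w (V i - z) ^+ 4) / N i ^+ 4) - 8^-1.
      move=> iA; have Ni := N_gt0 _ iA.
      rewrite (@rad_sqr R _ (fun w : dual E => w (V i - z)))// sumN divff ?gt_eqF ?exprn_gt0//.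
      have := @rad_pow4 R _ (fun w : dual E => w (V i - z)) (fun _ _ => erefl) s.
      rewrite sumN -exprM -ler_pdivrMr ?exprn_gt0//.
      by lra.
    set a := \sum_(i in A) _.
    have h3 : #|A|%:R * (3 / 16) <= a by rewrite mulrC mulr_natr -sumr_const ler_sum.
    have : #|A|%:R * (rademacher s (fun w => `|w| ^+ 2) / Q ^+ 2) <= #|A|%:R * 18^-1.
      by rewrite ler_pM2l.
    by set b := _ * (rademacher _ _ / _); lra.
  (* This single positivity gives both conclusions: the norm of [w] is at most [Q], as otherwise the
     penalty cancels the whole count, and at least one index in eight is hit. The choice between [w]
     and [- w] turns 8 into 16. *)
  have [w] : exists w, 0 < F w + - (#|A|%:R / 8).
    by apply: (@rad_gt0_ex _ _ s); rewrite radD rad_cst; lra.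
  rewrite /F => Fw.
  have h1 : \sum_(i in A) (2^-1 * (w (V i - z) ^+ 2 / N i ^+ 2)
     - 16^-1 * (w (V i - z) ^+ 4 / N i ^+ 4) - 8^-1) <=
     #|[set i in A | (eps / 2 <= `|w (V i - z)|)%R]%SET|%:R.
    rewrite -sum_card; apply: ler_sum => i iA.
    apply: le_trans (indicator_ge _ (N_gt0 _ iA)) _.
    rewrite ler_nat; case: (leP (N i / 2)) => //= h; rewrite lt0b.
    by rewrite (le_trans _ h)// ler_pM2r// ltW// epsA.
  have h2 : #|[set i in A | (eps / 2 <= `|w (V i - z)|)%R]%SET|%:R <= #|A|%:R :> R.
    rewrite ler_nat; apply: subset_leq_card; apply/fintype.subsetP => i.
    by rewrite inE => /andP[].
  have wQ : `|w| <= Q.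
    rewrite leNgt; apply/negP => Qw.
    have : 1 <= `|w| ^+ 2 / Q ^+ 2.
      by rewrite ler_pdivlMr ?exprn_gt0// mul1r lerXn2r ?nnegrE ?(ltW Q_gt0) ?(ltW Qw).
    by rewrite -(ler_pM2l A0'); lra.
  have h3 : 0 <= #|A|%:R * (`|w| ^+ 2 / Q ^+ 2).
    by rewrite mulr_ge0 ?divr_ge0 ?exprn_ge0 ?(ltW Q_gt0).
  have h4 : (#|A| <= 8 * #|[set i in A | (eps / 2 <= `|w (V i - z)|)%R]%SET|)%N.
    by rewrite -(ler_nat R) natrM; lra.
  set B := [set i in A | _]%SET in h4.
  have [B0|B0] := posnP #|B|; first by move: h4; rewrite B0 muln0 leqNgt A0.
  have [i|W] := @card_pigeonhole I (dual E) ([:: w; (- w : dual E)] : seq (dual E))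
    (fun w i => eps / 2 <= w (V i - z)) B _ B0.
    rewrite inE ler_normr => /andP[_]; rewrite /= orbF.
    by rewrite -(dual_oppE w).
  move=> Ww hW; exists W; split.
    by move: Ww; rewrite !inE => /orP[]/eqP->//; rewrite normrN.
  have : (#|[set i in B | (eps / 2 <= W (V i - z))%R]%SET| <=
     #|[set i in A | (eps / 2 <= W (V i - z))%R]%SET|)%N.
    by apply: subset_leq_card; apply/fintype.subsetP => i; rewrite !inE => /andP[/andP[-> _] ->].
  move=> hB; apply: leq_trans h4 _; rewrite (_ : 16 = 8 * 2)%N// -mulnA leq_mul2l /=.
  by apply: leq_trans hW _; rewrite leq_mul2l.
exists q; split=> [i|i j /qrho h]; last first.
  by apply: le_trans h _; rewrite /eps; lra.
apply: leq_trans (qlt i) _.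
have -> : 4 * lambda ^+ 2 * Q ^+ 2 / (eps / 2) ^+ 2 = (4 ^ n)%:R.
  have -> : (4 ^ n)%:R = (2 ^+ n) ^+ 2 :> R by rewrite -exprM mulnC exprM natrX; congr (_ ^+ _); rewrite -natrX.
  by rewrite /Q /eps; field; rewrite !gt_eqF ?exprn_gt0.
by rewrite natrK expnM leq_exp2r ?expn_gt0.
Qed.

End covering_weighted.

(** * Signed squares and interpolation *)

Section signed_square.
Variable R : realType.
Implicit Types a b c : R.

Definition ssqr a : R := a * `|a|.

Lemma ssqr_ge0 a : 0 <= a -> ssqr a = a ^+ 2.
Proof. by move=> a0; rewrite /ssqr ger0_norm. Qed.

Lemma ssqr_le0 a : a <= 0 -> ssqr a = - a ^+ 2.
Proof. by move=> a0; rewrite /ssqr ler0_norm// mulrN. Qed.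

(** Increments of the true squares are dominated by those of the signed ones, so partitions built
    for the signed distance serve the original process. *)
Lemma ssqr_sqr_le a b : `|a ^+ 2 - b ^+ 2| <= `|ssqr a - ssqr b|.
Proof.
have [a0|/ltW a0] := leP 0 a; have [b0|/ltW b0] := leP 0 b.
- by rewrite !ssqr_ge0.
- rewrite ssqr_ge0// ssqr_le0// opprK [leRHS]ger0_norm ?addr_ge0 ?sqr_ge0//.
  by rewrite ler_norml; have := sqr_ge0 a; have := sqr_ge0 b; lra.
- rewrite ssqr_le0// ssqr_ge0// -opprD normrN [leRHS]ger0_norm ?addr_ge0 ?sqr_ge0//.
  by rewrite ler_norml; have := sqr_ge0 a; have := sqr_ge0 b; lra.
- by rewrite !ssqr_le0// -opprD normrN.
Qed.

Lemma ssqr_lip a b : `|ssqr a - ssqr b| <= `|a - b| * (`|a| + `|b|).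
Proof.
have sqr_lip c d : `|c ^+ 2 - d ^+ 2| <= `|c - d| * (`|c| + `|d|).
  by rewrite subr_sqr normrM ler_wpM2l// ler_normD.
have [a0|/ltW a0] := leP 0 a; have [b0|/ltW b0] := leP 0 b.
- by rewrite !ssqr_ge0.
- rewrite ssqr_ge0// ssqr_le0// opprK (ger0_norm a0) (ler0_norm b0).
  by rewrite !ger0_norm ?addr_ge0 ?sqr_ge0//; [nra|lra].
- rewrite ssqr_le0// ssqr_ge0// -opprD normrN (ler0_norm a0) (ger0_norm b0).
  by rewrite ger0_norm ?addr_ge0 ?sqr_ge0// ler0_norm; [nra|lra].
- by rewrite !ssqr_le0// -opprD normrN.
Qed.

Lemma le_ssqr a b : a <= b -> ssqr a <= ssqr b.
Proof.
move=> ab; have [a0|/ltW a0] := leP 0 a; have [b0|/ltW b0] := leP 0 b.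
- by rewrite !ssqr_ge0//; nra.
- by rewrite ssqr_ge0// ssqr_le0//; nra.
- by rewrite ssqr_le0// ssqr_ge0//; have := sqr_ge0 a; have := sqr_ge0 b; lra.
- by rewrite !ssqr_le0//; nra.
Qed.

(** By monotonicity the signed square of the midpoint lies between those of [b] and [c]. This would
    fail for plain squares. *)
Lemma ssqr_mid a b c :
  `|ssqr a - ssqr (2^-1 * (b + c))| <= `|ssqr a - ssqr b| + `|ssqr a - ssqr c|.
Proof.
wlog bc : b c / b <= c => [hw|].
  have [/hw//|/ltW cb] := leP b c.
  by rewrite (addrC b) [leRHS]addrC; exact: hw.
set d := 2^-1 * _.
have : ssqr b <= ssqr d by apply: le_ssqr; rewrite /d; lra.
have : ssqr d <= ssqr c by apply: le_ssqr; rewrite /d; lra.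
move: (ssqr a) (ssqr b) (ssqr c) (ssqr d) => {bc d} {}a {}b {}c e ec be.
have := normr_ge0 (a - b); have := normr_ge0 (a - c).
have := ler_norm (a - b); have := ler_norm (- (a - b)); rewrite normrN.
have := ler_norm (a - c); have := ler_norm (- (a - c)); rewrite normrN.
by rewrite ler_norml => *; apply/andP; split; lra.
Qed.

Lemma ssqr_norm a : `|ssqr a| = a ^+ 2.
Proof. by rewrite normrM normr_id -expr2 real_normK ?num_real. Qed.

End signed_square.

(** * The signed-square distance and its near minimizers *)

Section metric.
Variables (R : realType) (E : normedModType R).
Variables (xs : seq (dual E)) (M S : R).
Hypotheses (M_gt0 : 0 < M) (S_gt0 : 0 < S).
Hypothesis xsM : {in xs, forall x : dual E, `|x| <= M}.
Hypothesis xsS : forall y : E, `|y| <= 1 -> \sum_(x <- xs) x y ^+ 2 <= S ^+ 2.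
Implicit Types y z u v w : E.

Definition sqdist y z : R := l2 xs (fun x : dual E => ssqr (x y) - ssqr (x z)).

Lemma sqdist_ge0 y z : 0 <= sqdist y z. Proof. exact: l2_ge0. Qed.

Lemma sqdistC y z : sqdist y z = sqdist z y. Proof. exact: l2C. Qed.

Lemma sqdistxx y : sqdist y y = 0.
Proof. by rewrite /sqdist /l2 big1 ?sqrtr0// => x _; rewrite subrr expr0n. Qed.

Lemma sqdist_triangle y z w : sqdist y w <= sqdist y z + sqdist z w.
Proof.
apply: l2D_le => x _; apply: le_trans (ler_normD _ _).
by rewrite addrA subrK.
Qed.

Lemma sqdist_mid y z w : sqdist y (2^-1 *: (z + w)) <= sqdist y z + sqdist y w.
Proof. by apply: l2D_le => x _; rewrite dualZ dualD ssqr_mid. Qed.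

Lemma l2_ssqr_le y : `|y| <= 1 -> l2 xs (fun x : dual E => ssqr (x y)) <= M * S.
Proof.
move=> y1; apply: le_trans (_ : l2 xs (fun x : dual E => M * x y) <= _).
  apply: le_l2 => x /xsM xM; rewrite !normrM normr_id ler_wpM2r//.
  rewrite (ger0_norm (ltW M_gt0)); apply: le_trans (dual_le _ _) _.
  by apply: le_trans xM; rewrite ler_piMr.
rewrite l2Z ger0_norm ?(ltW M_gt0)// ler_pM2l//.
by apply: l2_le; [exact: ltW|exact: xsS].
Qed.

Lemma sqdist_le y z : `|y| <= 1 -> `|z| <= 1 -> sqdist y z <= 2 * (M * S).
Proof.
move=> /l2_ssqr_le y1 /l2_ssqr_le z1; apply: (@le_trans _ _ (M * S + M * S)); last by lra.
apply: le_trans (lerD y1 z1).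
by apply: l2D_le => x _; exact: ler_normB.
Qed.

(** By [ssqr_lip] the increment is at most r |x(v - w)| (2 |x u| + r (|x v| + |x w|)). The first
    product is a weighted norm of [v - w], bounded by [e1]; in the second the factor |x(v - w)| is
    bounded uniformly by [e2]. *)
Lemma sqdist_local u v w (r e1 e2 : R) : 0 < r -> 0 <= e2 ->
  `|v| <= 1 -> `|w| <= 1 ->
  l2 xs (fun x : dual E => x u * x (v - w)) <= e1 ->
  {in xs, forall x : dual E, `|x (v - w)| <= e2} ->
  sqdist (u + r *: v) (u + r *: w) <= 2 * r * e1 + 2 * r ^+ 2 * S * e2.
Proof.
move=> r0 e20 v1 w1 h1 h2.
pose f (x : dual E) := 2 * r * (x u * x (v - w)).
pose g (x : dual E) := r ^+ 2 * e2 * (`|x v| + `|x w|).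
apply: le_trans (_ : l2 xs f + l2 xs g <= _).
  apply: l2D_le => x xxs; apply: le_trans (ssqr_lip _ _) _.
  rewrite !dualD !dualZ [X in `|X|](_ : _ = r * x (v - w)); last by rewrite dualB; ring.
  have hv := ler_normD (x u) (r * x v); have hw := ler_normD (x u) (r * x w).
  have rE : `|r| = r by rewrite ger0_norm// ltW.
  rewrite [X in _ <= _ + X](_ : _ = r ^+ 2 * e2 * (`|x v| + `|x w|)); last first.
    by rewrite /g ger0_norm ?mulr_ge0 ?addr_ge0 ?(ltW r0).
  rewrite !normrM !rE in hv hw; rewrite /f !normrM !rE normr_nat.
  apply: le_trans (_ : r * `|x (v - w)| * (2 * `|x u| + r * (`|x v| + `|x w|)) <= _).
    by rewrite ler_wpM2l ?mulr_ge0 ?(ltW r0)//; lra.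
  rewrite mulrDr lerD//; first by rewrite le_eqVlt; apply/orP; left; apply/eqP; ring.
  rewrite [leLHS](_ : _ = r ^+ 2 * (`|x v| + `|x w|) * `|x (v - w)|); last by ring.
  rewrite [leRHS](_ : _ = r ^+ 2 * (`|x v| + `|x w|) * e2); last by ring.
  by rewrite ler_wpM2l ?mulr_ge0 ?addr_ge0 ?(ltW r0)// h2.
rewrite lerD// l2Z ger0_norm ?mulr_ge0 ?sqr_ge0 ?(ltW r0)//.
  by rewrite ler_wpM2l ?mulr_ge0 ?(ltW r0).
have le1 y : `|y| <= 1 -> l2 xs (fun x : dual E => x y) <= S.
  by move=> y1; apply: l2_le; [exact: ltW|exact: xsS].
rewrite [leRHS](_ : _ = r ^+ 2 * e2 * (S + S)); last by ring.
rewrite ler_wpM2l ?mulr_ge0 ?(ltW r0)//.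
apply: le_trans (lerD (le1 _ v1) (le1 _ w1)).
by apply: l2D_le => x _; rewrite ger0_norm// addr_ge0.
Qed.

(* Telescoping the infima of [|w|^2 + s d(y, w)] over [s = 2 ^ n / B], which
   increase in [s] and stay below [|y|^2]. *)
Lemma interpolation y (B eta : R) : 0 < B -> 0 < eta -> `|y| <= 1 ->
  exists z : nat -> E,
    (forall n w, `|z n| ^+ 2 + 2 ^+ n / B * sqdist y (z n) <=
                 `|w| ^+ 2 + 2 ^+ n / B * sqdist y w + eta) /\
    (forall N, \sum_(n < N) 2 ^+ n * sqdist y (z n) <= 2 * B * (1 + N%:R * eta)).
Proof.
move=> B0 eta0 y1.
pose h (s : R) := [set `|w| ^+ 2 + s * sqdist y w | w in [set: E]].
have h_inf s : 0 <= s -> has_inf (h s).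
  move=> s0; split; first by exists (`|y| ^+ 2 + s * sqdist y y), y.
  by exists 0 => _ [w _ <-]; rewrite addr_ge0 ?mulr_ge0 ?sqdist_ge0 ?sqr_ge0.
have h_le s w : 0 <= s -> inf (h s) <= `|w| ^+ 2 + s * sqdist y w.
  by move=> s0; apply: ge_inf; [case: (h_inf s s0)|exists w].
have s_ge0 n : 0 <= 2 ^+ n / B by rewrite divr_ge0 ?exprn_ge0// ltW.
have ex n : exists z, `|z| ^+ 2 + 2 ^+ n / B * sqdist y z < inf (h (2 ^+ n / B)) + eta.
  have [_ [z _ <-] zh] := inf_adherent eta0 (h_inf _ (s_ge0 n)).
  by exists z.
have [z hz] := choice ex; exists z; split=> [n w|N].
  by apply/ltW/(lt_le_trans (hz n)); rewrite lerD2r h_le.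
have s2_ge0 n : 0 <= 2 ^+ n / B / 2 by rewrite divr_ge0.
pose H n := inf (h (2 ^+ n / B / 2)).
have H_ge0 n : 0 <= H n.
  apply: lb_le_inf; first by case: (h_inf _ (s2_ge0 n)).
  by move=> _ [w _ <-]; rewrite addr_ge0 ?sqr_ge0// mulr_ge0 ?sqdist_ge0.
(* The near minimizer for s = 2 ^ n / B is tested in the infimum at s / 2; the missing half of its
   distance term is the gain between the two infima. *)
have step n : 2 ^+ n / B / 2 * sqdist y (z n) <= H n.+1 - H n + eta.
  have -> : H n.+1 = inf (h (2 ^+ n / B)).
    by congr (inf (h _)); rewrite exprS; field; rewrite gt_eqF.
  by have := hz n; have := h_le _ (z n) (s2_ge0 n); rewrite -/(H n); lra.
have : \sum_(n < N) 2 ^+ n / B / 2 * sqdist y (z n) <= H N - H 0%N + N%:R * eta.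
  elim: N => [|N IH]; first by rewrite big_ord0 subrr mul0r addr0.
  rewrite big_ord_recr /= -(natr1 N) mulrDl mul1r.
  by have := step N; lra.
have H1 : H N <= 1.
  apply: le_trans (h_le _ y (s2_ge0 N)) _.
  by rewrite sqdistxx mulr0 addr0 exprn_ile1.
have := H_ge0 0%N => H0 hs.
rewrite (eq_bigr (fun n : 'I_N => 2 * B * (2 ^+ n / B / 2 * sqdist y (z n)))); last first.
  by move=> n _; field; rewrite gt_eqF.
by rewrite -mulr_sumr ler_wpM2l ?mulr_ge0 ?(ltW B0)//; lra.
Qed.

End metric.

(** * Refinement of partitions *)

(** Mixed-radix coding merges the labels of several partitions into one label of their common
    refinement. *)
Lemma pair_code_lt (a b A B : nat) : (a < A -> b < B -> a * B + b < A * B)%N.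
Proof.
move=> aA bB; apply: leq_trans (_ : a.+1 * B <= _)%N; first by rewrite mulSn addnC ltn_add2r.
by rewrite leq_mul2r aA orbT.
Qed.

Lemma pair_code_inj (B a b a' b' : nat) : (b < B)%N -> (b' < B)%N ->
  (a * B + b = a' * B + b')%N -> a = a' /\ b = b'.
Proof.
move=> bB bB' e; have B0 : (0 < B)%N by apply: leq_ltn_trans bB.
have aa : a = a' by move/(congr1 (fun x => x %/ B)%N): e; rewrite !divnMDl// !divn_small// !addn0.
by split=> //; move: e; rewrite aa => /addnI.
Qed.

Section refine.
Variables (R : realType) (E : normedModType R) (lambda : R).
Hypothesis cvxE : modulus_convexity_power2 E lambda.
Variables (xs : seq (dual E)) (M S : R) (L : nat).
Hypotheses (M_gt0 : 0 < M) (S_gt0 : 0 < S) (L_gt0 : (0 < L)%N).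
Hypothesis xsL : (size xs <= 2 ^ L)%N.
Hypothesis xsM : {in xs, forall x : dual E, `|x| <= M}.
Hypothesis xsS : forall y : E, `|y| <= 1 -> \sum_(x <- xs) x y ^+ 2 <= S ^+ 2.
Variables (I : finType) (Y : I -> E).
Hypothesis Y1 : forall i, `|Y i| <= 1.

Let lambda_gt0 : 0 < lambda. Proof. by case: cvxE. Qed.

(** The constant makes each of the two covering errors in [refine] at most G / 16, up to scale / (L
    2^n). Of the three factors [lambda], the radius and the coverings share in supplying them. *)
Definition scale : R := 2 ^+ 10 * lambda ^+ 3 * M * S * Num.sqrt L%:R.

Let sL : 0 < Num.sqrt L%:R :> R. Proof. by rewrite sqrtr_gt0 ltr0n. Qed.

Lemma scale_gt0 : 0 < scale.
Proof. by rewrite !mulr_gt0 ?exprn_gt0. Qed.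

(* [c] labels the pieces of a partition of the family [Y] and [D] bounds their
   diameters. *)
Definition partition_at (n : nat) (c : I -> nat) (D : I -> R) : Prop :=
  [/\ forall i, (c i < 2 ^ (4 * 4 ^ n))%N, forall i, 0 <= D i &
      forall i j, c i = c j -> D i = D j /\ sqdist xs (Y i) (Y j) <= D i].

(** Within a piece, 2-convexity puts the near minimizers [z i] in a ball of squared radius
    proportional to the diameter of the piece plus errors. Covering that ball splits the piece, and
    [Y i] follows [z i] up to their distance. The factor 1/4 on the old term makes the recursion
    summable. *)
Lemma refine (n : nat) (eta : R) (z : I -> E) (c : I -> nat) (D : I -> R) :
  0 < eta -> eta <= 1 ->
  (forall i w, `|z i| ^+ 2 + 2 ^+ n / scale * sqdist xs (Y i) (z i) <=
               `|w| ^+ 2 + 2 ^+ n / scale * sqdist xs (Y i) w + eta) ->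
  partition_at n c D ->
  exists c' D', [/\ partition_at n.+1 c' D', forall i j, c' i = c' j -> c i = c j &
    forall i, 2 ^+ n.+1 * D' i <= 4^-1 * (2 ^+ n * D i) +
      9 / 2 * (2 ^+ n * sqdist xs (Y i) (z i)) +
      scale * (9 / 2 / 2 ^+ n + eta / 4 + 2 / L%:R)].
Proof.
have [B BE] : exists B, B = scale by exists scale.
have B_gt0 : 0 < B by rewrite BE scale_gt0.
rewrite -BE => eta0 eta1 hz [cn D0 cD].
pose a := 2 ^+ n / B; have a0 : 0 < a by rewrite divr_gt0 ?exprn_gt0.
pose b i := sqdist xs (Y i) (z i).
have b0 i : 0 <= b i by exact: sqdist_ge0.
have hzY i : `|z i| ^+ 2 + a * b i <= 2.
  have := hz i (Y i); rewrite sqdistxx mulr0 addr0 -/a -/(b i).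
  have : `|Y i| ^+ 2 <= 1 by rewrite exprn_ile1.
  by lra.
have z2 i : `|z i| ^+ 2 <= 2 by apply: le_trans (hzY i); rewrite lerDl mulr_ge0// ltW.
have ab i : a * b i <= 2 by apply: le_trans (hzY i); rewrite lerDr sqr_ge0.
(* The distances from [Y i] to [z i] vary within a piece, so they are rounded and the rounded value
   joins the label. The rounded bound [sg] below is constant on the new cells and exceeds the
   distance by at most B / 4^n. *)
pose k i := Num.trunc (a * b i * 2 ^+ n).
have p2 : 0 < 2 ^+ n :> R by rewrite exprn_gt0.
have kP i : (k i)%:R <= a * b i * 2 ^+ n < (k i).+1%:R.
  exact: truncn_itv (mulr_ge0 (mulr_ge0 (ltW a0) (b0 i)) (ltW p2)).
have kn i : (k i < 2 ^ (2 * 4 ^ n))%N.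
  have h : (k i <= 2 * 2 ^ n)%N.
    rewrite -(ler_nat R) natrM natrX.
    have /andP[h _] := kP i; apply: le_trans h _.
    by rewrite ler_pM2r.
  apply: leq_ltn_trans h _; apply: leq_trans (ltn_expl _ (isT : 1 < 2)%N) _.
  by rewrite leq_exp2l// leq_mul2l /= (_ : 4 = 2 ^ 2)%N// -expnM leq_exp2l// leq_pmull.
pose sg i := (k i).+1%:R * B / (2 ^+ n) ^+ 2.
have bsg i : b i <= sg i.
  have /andP[_ /ltW] := kP i; rewrite /sg ler_pdivlMr ?exprn_gt0// mulrC -ler_pdivrMr//.
  by apply: le_trans; rewrite /a le_eqVlt; apply/orP; left; apply/eqP; field; rewrite gt_eqF.
have sgb i : 2 ^+ n * sg i <= 2 ^+ n * b i + B / 2 ^+ n.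
  have /andP[+ _] := kP i; rewrite /sg -natr1 /a => h.
  rewrite (_ : _ * (_ / _) = ((k i)%:R + 1) * (B / 2 ^+ n)); last first.
    by field; rewrite gt_eqF.
  rewrite mulrDl mul1r lerD2r mulrA ler_pdivrMr// -ler_pdivlMr//.
  by apply: le_trans h _; rewrite le_eqVlt; apply/orP; left; apply/eqP; field; rewrite gt_eqF.
pose key i := (c i, k i).
pose rep i := odflt i [pick j | key j == key i].
have keyrep i : key (rep i) = key i.
  by rewrite /rep; case: pickP => [j /eqP//|/(_ i)]; rewrite eqxx.
have repE i j : key i = key j -> rep i = rep j.
  move=> e; rewrite /rep -(@eq_pick _ (fun l => key l == key i)); last by move=> l; rewrite e.
  by case: pickP => // /(_ i); rewrite eqxx.
(* a * G i bounds how far the squared norms of two near minimizers of one cell can exceed that of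
   their midpoint. *)
pose G i := D i + 2 * sg i + eta * B / 2 ^+ n.
have sg0 i : 0 <= sg i by exact: le_trans (bsg i).
have G0 i : 0 < G i.
  have := D0 i; have := sg0 i; have : 0 < eta * B / 2 ^+ n by rewrite divr_gt0 ?mulr_gt0.
  by rewrite /G; lra.
pose r i := 2 * lambda * Num.sqrt (a * G i).
have r0 i : 0 < r i by rewrite /r mulr_gt0 ?mulr_gt0// sqrtr_gt0 (mulr_gt0 a0 (G0 i)).
have r2 i : r i ^+ 2 = 4 * lambda ^+ 2 * (a * G i).
  by rewrite /r !exprMn sqr_sqrtr ?(ltW (mulr_gt0 a0 (G0 i)))//; ring.
have keyD i j : key i = key j -> [/\ D i = D j, sqdist xs (Y i) (Y j) <= D i & sg i = sg j].
  by move=> [/cD[Dij Yij] kij]; split=> //; rewrite /sg kij.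
have zz i j : key i = key j -> `|z i - z j| <= r i.
  move=> kij; have [Dij Yij sij] := keyD _ _ kij.
  rewrite -(@ler_pXn2r _ 2)// ?nnegrE// ?(ltW (r0 i))// r2.
  set w := 2^-1 *: (z i + z j).
  (* The midpoint [w] competes against [z l] in the minimization for [Y l]; [sqdist_mid] bounds its
     distance to [Y l]. *)
  have half l l' : D l = D i -> sg l = sg i -> sg l' = sg i ->
      sqdist xs (Y l) (Y l') <= D i -> 2^-1 *: (z l + z l') = w ->
      `|z l| ^+ 2 <= `|w| ^+ 2 + a * (D i + 2 * sg i) + eta.
    move=> Dl sl sl' dl wE; have := hz l w; rewrite -/a -/(b l).
    have : 0 <= a * b l by rewrite mulr_ge0// ltW.
    have : a * sqdist xs (Y l) w <= a * (D i + 2 * sg i).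
      rewrite ler_pM2l// -wE; apply: le_trans (sqdist_mid _ _ _ _) _.
      have := sqdist_triangle xs (Y l) (Y l') (z l').
      by have := bsg l; have := bsg l'; rewrite sl sl' /b; lra.
    by lra.
  have hi := half i j erefl erefl (esym sij) Yij erefl.
  have hj : `|z j| ^+ 2 <= `|w| ^+ 2 + a * (D i + 2 * sg i) + eta.
    apply: (half j i) => //; first by rewrite sqdistC.
    by rewrite addrC.
  have := convex_midpoint cvxE (z i) (z j); rewrite -/w => hw.
  have : `|z i - z j| ^+ 2 / (4 * lambda ^+ 2) <= a * G i.
    rewrite (_ : a * G i = a * (D i + 2 * sg i) + eta); last first.
      by rewrite /G /a; field; rewrite !gt_eqF.
    by lra.
  by rewrite ler_pdivrMr ?mulr_gt0 ?exprn_gt0// [leRHS]mulrC.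
(* All members of a cell share the center [z (rep i)] and the radius [r i], so covering these
   unit-ball vectors covers the near minimizers. *)
pose V i := (r i)^-1 *: (z i - z (rep i)).
have V1 i : `|V i| <= 1.
  rewrite normrZ ger0_norm ?invr_ge0 ?(ltW (r0 i))// ler_pdivrMl// mulr1.
  by apply: zz; rewrite keyrep.
pose e1 := 96 * lambda ^+ 2 * M * S / 2 ^+ n.
pose e2 := 8 * lambda * M * Num.sqrt L%:R / 2 ^+ n.
have [q1 [q1n q1P]] := covering_sup cvxE M_gt0 S_gt0 L_gt0 xsL xsM n V1.
have [q2 q2P] := choice (fun j => covering_weighted cvxE M_gt0 S_gt0 xsM xsS n V1 (z2 j)).
(* Label budget in units of 4^n bits: 4 + 2 + 3 + 5 = 14, within the 16 available at level
   [n.+1]. *)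
pose c' i := (((c i * 2 ^ (2 * 4 ^ n) + k i) * 2 ^ (3 * 4 ^ n) + q1 i) * 2 ^ (5 * 4 ^ n)
  + q2 (rep i) i)%N.
pose D' i := 2 * sg i + (2 * r i * e1 + 2 * r i ^+ 2 * S * e2).
have c'P i j : c' i = c' j -> [/\ key i = key j, q1 i = q1 j & q2 (rep i) i = q2 (rep j) j].
  move=> /(pair_code_inj ((q2P _).1 i) ((q2P _).1 j))[].
  move=> /(pair_code_inj (q1n i) (q1n j))[].
  by move=> /(pair_code_inj (kn i) (kn j))[] cij kij ? ?; rewrite /key cij kij.
have e20 : 0 <= e2 by rewrite divr_ge0 ?mulr_ge0 ?(ltW lambda_gt0) ?(ltW M_gt0) ?(ltW sL) ?(ltW p2).
have e10 : 0 <= e1 by rewrite divr_ge0 ?mulr_ge0 ?(ltW lambda_gt0) ?(ltW M_gt0) ?(ltW S_gt0) ?(ltW p2).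
have zrep i : z i = z (rep i) + r i *: V i.
  by rewrite scalerA divff ?gt_eqF// scale1r addrC subrK.
have r_key i j : key i = key j -> r i = r j.
  by move=> /keyD[Dij _ sij]; rewrite /r /G Dij sij.
exists c', D'; split.
- split.
  + move=> i; apply: leq_trans (pair_code_lt (pair_code_lt (pair_code_lt (cn i) (kn i)) (q1n i)) ((q2P _).1 i)) _.
    by rewrite -!expnD leq_exp2l// -!mulnDl expnS mulnA leq_mul2r orbT.
  + move=> i; have r0' := ltW (r0 i).
    have h1 : 0 <= 2 * r i * e1 by rewrite mulr_ge0// mulr_ge0.
    have h2 : 0 <= 2 * r i ^+ 2 * S * e2.
      by rewrite mulr_ge0// mulr_ge0 ?(ltW S_gt0)// mulr_ge0// exprn_ge0.
    by rewrite /D'; have := sg0 i; lra.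
  + move=> i j /c'P[kij q1ij q2ij]; have [Dij Yij sij] := keyD _ _ kij.
    have rij := r_key _ _ kij; have repij := repE _ _ kij.
    split; first by rewrite /D' sij rij.
    have h : sqdist xs (z i) (z j) <= 2 * r i * e1 + 2 * r i ^+ 2 * S * e2.
      rewrite (zrep i) (zrep j) -rij -repij; apply: (@sqdist_local _ _ _ S) => //.
        by apply: (q2P (rep i)).2; rewrite q2ij repij.
      exact: q1P.
    have := sqdist_triangle xs (Y i) (z i) (Y j).
    have := sqdist_triangle xs (z i) (z j) (Y j).
    have := bsg i; have := bsg j; rewrite -sij /b (sqdistC _ (Y j)) /D'.
    by move: h; lra.
- by move=> i j /c'P[[]].
move=> i; rewrite -/(b i).
have h2 : 2 * r i ^+ 2 * S * e2 = G i / 16.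
  by rewrite r2 /e2 /a BE /scale; field; rewrite !gt_eqF.
have h1 : 2 * r i * e1 <= G i / 16 + B / (L%:R * 2 ^+ n).
  set t := Num.sqrt (a * G i); pose l : R := Num.sqrt L%:R.
  have l0 : 0 < l by exact: sL.
  have t0 : 0 <= t by exact: sqrtr_ge0.
  have GE : G i = t ^+ 2 * B / 2 ^+ n.
    by rewrite /t sqr_sqrtr ?(ltW (mulr_gt0 a0 (G0 i)))// /a; field; rewrite !gt_eqF.
  have LE : L%:R = l ^+ 2 :> R by rewrite sqr_sqrtr.
  have -> : 2 * r i * e1 = 3 / 8 * B / 2 ^+ n * (t / l).
    by rewrite /r /e1 BE /scale -/t -/l; field; rewrite !gt_eqF.
  rewrite GE LE (_ : _ + _ = B / 2 ^+ n * (t ^+ 2 / 16 + (l^-1) ^+ 2)); last first.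
    by field; rewrite !gt_eqF.
  rewrite (_ : _ * (t / l) = B / 2 ^+ n * (3 / 8 * (t * l^-1))); last by ring.
  rewrite ler_wpM2l ?divr_ge0 ?(ltW B_gt0) ?(ltW p2)//.
  (* AM-GM gives t / (2 l) <= t^2 / 16 + 1 / l^2, and 3/8 <= 1/2. *)
  by have := sqr_ge0 (t / 4 - l^-1); rewrite -[X in X <= _ + _]mulr1; nra.
have L0 : 0 < L%:R :> R by rewrite ltr0n.
apply: le_trans (_ : 2 ^+ n.+1 * (2 * sg i + (G i / 8 + B / (L%:R * 2 ^+ n))) <= _).
  by rewrite ler_wpM2l ?exprn_ge0// /D' h2; lra.
have -> : 2 ^+ n.+1 * (2 * sg i + (G i / 8 + B / (L%:R * 2 ^+ n))) =
   9 / 2 * (2 ^+ n * sg i) + 4^-1 * (2 ^+ n * D i) + B * (eta / 4 + 2 / L%:R).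
  by rewrite /G exprS; field; rewrite !gt_eqF.
by have := sgb i; rewrite !mulrDr; lra.
Qed.

End refine.

(** Dependent choice with the invariant [P] carried in a sigma type; it iterates [refine]. *)
Lemma dependent_sequence (T : Type) (P : nat -> T -> Prop) (Q : nat -> T -> T -> Prop) t0 :
  P 0%N t0 -> (forall n t, P n t -> exists t', P n.+1 t' /\ Q n t t') ->
  exists f : nat -> T, f 0%N = t0 /\ forall n, P n (f n) /\ Q n (f n) (f n.+1).
Proof.
move=> P0 step.
pose F := nat_rect (fun n => {t | P n t}) (exist _ t0 P0)
  (fun n t => let s := cid (step n (sval t) (svalP t)) in exist _ (sval s) (svalP s).1).
exists (fun n => sval (F n)); split=> // n; split; first exact: svalP (F n).
exact: (svalP (cid (step n (sval (F n)) (svalP (F n))))).2.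
Qed.

Lemma sum_geometric_le (R : realFieldType) (N k : nat) : (1 < k)%N ->
  \sum_(n < N) (k%:R ^+ n)^-1 <= 2 :> R.
Proof.
move=> k1; have h n : (k%:R ^+ n)^-1 <= 2^-1 ^+ n :> R.
  rewrite exprVn lef_pV2 ?posrE ?exprn_gt0// ?ltr0n ?(ltn_trans _ k1)//.
  by apply: lerXn2r; rewrite ?nnegrE// ler_nat.
apply: le_trans (ler_sum _ (fun (n : 'I_N) _ => h n)) _.
suff -> : \sum_(n < N) 2^-1 ^+ n = 2 - 2 * 2^-1 ^+ N :> R.
  by rewrite gerBl mulr_ge0// exprn_ge0// invr_ge0.
elim: N => [|N IH]; first by rewrite big_ord0 expr0 mulr1 subrr.
by rewrite big_ord_recr /= IH exprS; field.
Qed.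

(** * Iterated refinement *)

Section partition_tree.
Variables (R : realType) (E : normedModType R) (lambda : R).
Hypothesis cvxE : modulus_convexity_power2 E lambda.
Hypothesis lambda_ge1 : 1 <= lambda.
Variables (xs : seq (dual E)) (M S : R) (L : nat).
Hypotheses (M_gt0 : 0 < M) (S_gt0 : 0 < S) (L_gt0 : (0 < L)%N).
Hypothesis xsL : (size xs <= 2 ^ L)%N.
Hypothesis xsM : {in xs, forall x : dual E, `|x| <= M}.
Hypothesis xsS : forall y : E, `|y| <= 1 -> \sum_(x <- xs) x y ^+ 2 <= S ^+ 2.
Variables (I : finType) (Y : I -> E).
Hypothesis Y1 : forall i, `|Y i| <= 1.

Let B := scale lambda M S L.

Lemma MS_le_scale : M * S <= scale lambda M S L.
Proof.
have MS0 : 0 < M * S by exact: mulr_gt0.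
rewrite /scale [leRHS](_ : _ = (2 ^+ 10 * lambda ^+ 3 * Num.sqrt L%:R) * (M * S)); last by ring.
rewrite -[leLHS]mul1r ler_pM2r//.
have h1 : 1 <= lambda ^+ 3 by rewrite exprn_ege1.
have h2 : 1 <= Num.sqrt L%:R :> R by rewrite -[leLHS]sqrtr1 ler_wsqrtr ?ler1n.
have h3 : 1 <= 2 ^+ 10 :> R by rewrite exprn_ege1 ?ler1n.
exact: mulr_ege1 (mulr_ege1 h3 h1) h2.
Qed.

(** Summing the recursion of [refine] over L levels bounds the total T by T / 4 plus 2 B for the
    root, 18 B for the distances to the near minimizers, 9 B for the geometric terms and 9/4 B for
    the terms of order B / L. The quarter is absorbed on the left. *)
Lemma partition_tree : exists c (D : nat -> I -> R),
  [/\ forall n, partition_at xs Y n (c n) (D n), forall i j, c 0%N i = c 0%N j,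
      forall n i j, c n.+1 i = c n.+1 j -> c n i = c n j &
      forall i, \sum_(n < L.+1) 2 ^+ n * D n i <= 45 * scale lambda M S L].
Proof.
have B0 : 0 < B by exact: (scale_gt0 cvxE M_gt0 S_gt0 L_gt0).
have MSB : M * S <= B by exact: MS_le_scale.
have LR : 0 < L%:R :> R by rewrite ltr0n.
have L1 : 1 <= L%:R :> R by rewrite ler1n.
(* The minimization error is paid once per level, so 1 / L keeps its total bounded. *)
pose eta : R := L%:R^-1.
have eta0 : 0 < eta by rewrite invr_gt0.
have eta1 : eta <= 1 by rewrite invf_le1.
have [z zP] := choice (fun i => interpolation xs B0 eta0 (Y1 i)).
pose P n (t : (I -> nat) * (I -> R)) := partition_at xs Y n t.1 t.2.
pose Q n (t t' : (I -> nat) * (I -> R)) :=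
  (forall i j, t'.1 i = t'.1 j -> t.1 i = t.1 j) /\
  forall i, 2 ^+ n.+1 * t'.2 i <= 4^-1 * (2 ^+ n * t.2 i) +
      9 / 2 * (2 ^+ n * sqdist xs (Y i) (z i n)) +
      B * (9 / 2 / 2 ^+ n + eta / 4 + 2 / L%:R).
have [||f [f0 fP]] := @dependent_sequence _ P Q (fun=> 0%N, fun=> 2 * (M * S)).
- split=> //=; first by move=> i; rewrite !mulr_ge0 ?(ltW M_gt0) ?(ltW S_gt0).
  by move=> i j _; split=> //; exact: (sqdist_le M_gt0 S_gt0 xsM xsS).
- move=> n [c D] cD.
  have [i w|c' [D' [h1 h2 h3]]] :=
    @refine R E lambda cvxE xs M S L M_gt0 S_gt0 L_gt0 xsL xsM xsS I Y Y1 n eta (z^~ n) c D eta0 eta1 _ cD.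
    exact: (zP i).1.
  by exists (c', D').
exists (fun n => (f n).1), (fun n => (f n).2); split.
- by move=> n; have [] := fP n.
- by move=> i j; rewrite f0.
- by move=> n; have [_ []] := fP n.
move=> i; set T := \sum_(n < L.+1) _.
pose t n := 2 ^+ n * (f n).2 i.
have tT : T = 2 * (M * S) + \sum_(n < L) t n.+1.
  by rewrite /T big_ord_recl /= f0 expr0 mul1r.
have t0 n : 0 <= t n.
  by have [[_ D0 _] _] := fP n; rewrite /t mulr_ge0 ?exprn_ge0// D0.
have tT' : \sum_(n < L) t n <= T by rewrite /T big_ord_recr /= lerDl; exact: (t0 L).
pose b n := 2 ^+ n * sqdist xs (Y i) (z i n).
have step : \sum_(n < L) t n.+1 <= \sum_(n < L)
    (4^-1 * t n + 9 / 2 * b n + B * (9 / 2) * (2 ^+ n)^-1 + B * (eta / 4 + 2 / L%:R)).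
  apply: ler_sum => n _; have [_ [_ /(_ i) h]] := fP n.
  by apply: le_trans h _; rewrite /t /b; lra.
have bS := (zP i).2 L; rewrite -/(\sum_(n < L) b n) in bS.
have gS := @sum_geometric_le R L 2 isT.
move: step; rewrite !big_split /= -!mulr_sumr sumr_const card_ord -[_ *+ L]mulr_natr => step.
have h1 : B * (9 / 2) * \sum_(n < L) (2 ^+ n)^-1 <= B * (9 / 2) * 2.
  by rewrite ler_wpM2l// mulr_ge0 ?(ltW B0).
have h2 : B * ((eta / 4 + 2 / L%:R) * L%:R) = B * (9 / 4) by rewrite /eta; field; rewrite gt_eqF.
have h3 : 2 * B * (1 + L%:R * eta) = 4 * B by rewrite /eta; field; rewrite gt_eqF.
rewrite h3 in bS; rewrite h2 in step; rewrite -/B.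
by move: step h1 bS tT tT' MSB B0; set u := \sum_(n < L) t n.+1; set v := \sum_(n < L) t n;
  set w := \sum_(n < L) b n; set g := \sum_(n < L) _; clear; lra.
Qed.

End partition_tree.

(** * Chaining *)

Lemma card_le_labels (I : finType) (A : {set I}) (q : I -> nat) (K : nat) :
  (forall i, q i < K)%N -> {in A &, injective q} -> (#|A| <= K)%N.
Proof.
move=> qK qinj; rewrite -[K in leqRHS]card_ord.
rewrite -(@card_in_imset _ _ (fun i => Ordinal (qK i)) A); first exact: max_card.
by move=> i j iA jA [] /qinj; apply.
Qed.

Section representatives.
Variables (I : finType) (c : I -> nat).

Definition representative (i : I) : I := odflt i [pick j | c j == c i].

Lemma label_representative i : c (representative i) = c i.
Proof. by rewrite /representative; case: pickP => [j /eqP|/(_ i)] //; rewrite eqxx. Qed.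

Lemma eq_representative i j : c i = c j -> representative i = representative j.
Proof.
move=> e; rewrite /representative -(@eq_pick _ (fun l => c l == c i)) => [|l]; last by rewrite e.
by case: pickP => // /(_ i); rewrite eqxx.
Qed.

Lemma card_representatives (K : nat) : (forall i, c i < K)%N ->
  (#|[set representative i | i in I]%SET| <= K)%N.
Proof.
move=> cK; apply: (card_le_labels cK) => _ _ /imsetP[i _ ->] /imsetP[j _ ->].
by rewrite !label_representative; exact: eq_representative.
Qed.

End representatives.

Section chaining.
Variables (R : realType) (E : normedModType R) (lambda : R).
Hypothesis cvxE : modulus_convexity_power2 E lambda.
Hypothesis lambda_ge1 : 1 <= lambda.
Variables (xs : seq (dual E)) (M S : R) (L : nat).
Hypotheses (M_gt0 : 0 < M) (S_gt0 : 0 < S) (L_gt0 : (0 < L)%N).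
Hypothesis xsL : (size xs <= 2 ^ L)%N.
Hypothesis xsM : {in xs, forall x : dual E, `|x| <= M}.
Hypothesis xsS : forall y : E, `|y| <= 1 -> \sum_(x <- xs) x y ^+ 2 <= S ^+ 2.
Variables (I : finType) (Y : I -> E).
Hypothesis Y1 : forall i, `|Y i| <= 1.

Definition squares (x : dual E) : I -> R^o := fun i => x (Y i) ^+ 2.

Let ss := [seq squares x | x <- xs].

Let d (i j : I) := sqdist xs (Y i) (Y j).

Let sum_sqr_increment i j : \sum_(v <- ss) (v i - v j) ^+ 2 <= d i j ^+ 2.
Proof.
rewrite sqr_l2 big_map; apply: ler_sum => x _.
rewrite -[X in X <= _]real_normK ?num_real// -[X in _ <= X]real_normK ?num_real//.
by apply: lerXn2r; rewrite ?nnegrE//; exact: ssqr_sqr_le.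
Qed.

(* The summands are the excesses of the normalized increments over a fixed
   multiple of [2 ^ n], bounded by exponentials. *)
Definition excess (r : nat -> I -> I) (n : nat) (w : I -> R^o) : R :=
  \sum_(i in [set r n l | l in I]%SET) \sum_(j in [set r n.+1 l | l in I]%SET)
    (4 ^+ n)^-1 * (expR (- (22 * 4 ^+ n)) *
      (expR (2 ^+ n / d i j * (w i - w j)) + expR (2 ^+ n / d i j * (w j - w i)))).

Lemma excess_ge0 r n w : 0 <= excess r n w.
Proof.
apply: sumr_ge0 => i _; apply: sumr_ge0 => j _.
by rewrite !mulr_ge0 ?invr_ge0 ?exprn_ge0 ?addr_ge0 ?expR_ge0.
Qed.

Lemma expR_expn2 n : (2 ^ n)%:R <= expR n%:R :> R.
Proof.
rewrite -[n%:R in leRHS]mulr1 expRM_natl natrX; apply: lerXn2r; rewrite ?nnegrE ?expR_ge0//.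
by apply: le_trans (expR_ge1Dx _).
Qed.

(** The 22 in [excess] is 20 + 2: at most 2 ^ (20 * 4^n) pairs link levels n and n + 1, and each
    exponential has mean at most e ^ (2 * 4^n). *)
Lemma rad_excess (r : nat -> I -> I) n :
  (forall n, #|[set r n l | l in I]%SET| <= 2 ^ (4 * 4 ^ n))%N ->
  rademacher ss (excess r n) <= 2 * (4 ^+ n)^-1.
Proof.
move=> rn; rewrite rad_sum.
have h i j : rademacher ss (fun w => (4 ^+ n)^-1 * (expR (- (22 * 4 ^+ n)) *
      (expR (2 ^+ n / d i j * (w i - w j)) + expR (2 ^+ n / d i j * (w j - w i))))) <=
    (4 ^+ n)^-1 * (expR (- (22 * 4 ^+ n)) * (2 * expR (2 * 4 ^+ n))).
  rewrite radZ radZ radD ler_wpM2l ?invr_ge0 ?exprn_ge0// ler_wpM2l ?expR_ge0//.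
  have e k l : \sum_(v <- ss) (v k - v l) ^+ 2 <= d i j ^+ 2 ->
      rademacher ss (fun w => expR (2 ^+ n / d i j * (w k - w l))) <= expR (2 * 4 ^+ n).
    move=> kl; apply: le_trans (@rad_expR R _ (fun w : I -> R^o => w k - w l) ss _ _) _.
      by move=> v w; rewrite [(v + w) k]/(v k + w k) [(v + w) l]/(v l + w l) opprD addrACA.
    rewrite ler_expR -mulrA ler_wpM2l//.
    (* For pairs at distance 0 the coefficient 2 ^ n / d is 0 by convention. *)
    have [d0|d0] := eqVneq (d i j) 0; first by rewrite d0 invr0 mulr0 expr0n mul0r exprn_ge0.
    apply: le_trans (_ : (2 ^+ n / d i j) ^+ 2 * d i j ^+ 2 <= _).
      by rewrite ler_wpM2l ?sqr_ge0.
    rewrite exprMn -mulrA -exprMn mulVf// expr1n mulr1 -exprM mulnC exprM.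
    by rewrite le_eqVlt; apply/orP; left; apply/eqP; congr (_ ^+ _); rewrite -natrX.
  have h1 := e i j (sum_sqr_increment i j).
  have h2 : rademacher ss (fun w => expR (2 ^+ n / d i j * (w j - w i))) <= expR (2 * 4 ^+ n).
    by apply: e; rewrite /d sqdistC; exact: sum_sqr_increment.
  by lra.
apply: le_trans (_ : \sum_(i in [set r n l | l in I]%SET) \sum_(j in [set r n.+1 l | l in I]%SET)
   (4 ^+ n)^-1 * (expR (- (22 * 4 ^+ n)) * (2 * expR (2 * 4 ^+ n))) <= _).
  by apply: ler_sum => i _; rewrite rad_sum; apply: ler_sum => j _; exact: h.
rewrite !sumr_const -mulrnA -[leLHS]mulr_natr.
have K : (#|[set r n.+1 l | l in I]%SET| * #|[set r n l | l in I]%SET|)%:R <= expR (20 * 4 ^+ n) :> R.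
  apply: le_trans (_ : (2 ^ (4 * 4 ^ n.+1) * 2 ^ (4 * 4 ^ n))%:R <= _).
    by rewrite ler_nat leq_mul.
  rewrite -expnD; apply: le_trans (expR_expn2 _) _; rewrite ler_expR.
  by rewrite expnS natrD !natrM natrX; lra.
have e : expR (- (22 * 4 ^+ n)) * expR (2 * 4 ^+ n) * expR (20 * 4 ^+ n) = 1 :> R.
  by rewrite -!expRD -[RHS]expR0; congr expR; ring.
apply: le_trans (_ : (4 ^+ n)^-1 * (expR (- (22 * 4 ^+ n)) * (2 * expR (2 * 4 ^+ n))) *
  expR (20 * 4 ^+ n) <= _).
  by rewrite ler_wpM2l// !mulr_ge0 ?invr_ge0 ?exprn_ge0 ?expR_ge0.
rewrite [leLHS](_ : _ = 2 * (4 ^+ n)^-1 *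
  (expR (- (22 * 4 ^+ n)) * expR (2 * 4 ^+ n) * expR (20 * 4 ^+ n))); last by ring.
by rewrite e mulr1.
Qed.

(** The pair visited by the chain is one term of [excess], and 1 + x <= e^x converts that
    exponential into a linear bound valid for all [i] at once. *)
Lemma excess_increment (r : nat -> I -> I) n (w : I -> R^o) i :
  (d (r n i) (r n.+1 i) = 0 -> w (r n i) = w (r n.+1 i)) ->
  `|w (r n.+1 i) - w (r n i)| <=
    2 ^+ n * d (r n i) (r n.+1 i) * (22 + excess r n w).
Proof.
set a := r n i; set b := r n.+1 i => wd.
have [d0|d0] := eqVneq (d a b) 0; first by rewrite wd// d0 subrr normr0 mulr0 mul0r.
have dab : 0 < d a b by rewrite lt_neqAle eq_sym d0 sqdist_ge0.
set u := 2 ^+ n / d a b.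
have p4 : 0 < 4 ^+ n :> R by rewrite exprn_gt0.
have p2 : 0 < 2 ^+ n :> R by rewrite exprn_gt0.
have p42 : 4 ^+ n = 2 ^+ n * 2 ^+ n :> R by rewrite -exprMn; congr (_ ^+ _); rewrite -natrM.
have ex : (4 ^+ n)^-1 * (expR (- (22 * 4 ^+ n)) *
    (expR (u * (w a - w b)) + expR (u * (w b - w a)))) <= excess r n w.
  rewrite /excess (bigD1 a) ?imset_f//= (bigD1 b) ?imset_f//= -/u -addrA lerDl addr_ge0//.
    by apply: sumr_ge0 => j _; rewrite !mulr_ge0 ?invr_ge0 ?exprn_ge0 ?addr_ge0 ?expR_ge0.
  apply: sumr_ge0 => k _; apply: sumr_ge0 => j _.
  by rewrite !mulr_ge0 ?invr_ge0 ?exprn_ge0 ?addr_ge0 ?expR_ge0.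
have : (4 ^+ n)^-1 * (u * `|w b - w a| - 22 * 4 ^+ n) <= excess r n w.
  apply: le_trans ex; rewrite ler_wpM2l ?invr_ge0 ?(ltW p4)//.
  apply: le_trans (_ : expR (- (22 * 4 ^+ n) + u * `|w b - w a|) <= _).
    by apply: le_trans (expR_ge1Dx _); lra.
  rewrite expRD ler_wpM2l ?expR_ge0//.
  have [wba|/ltW wba] := leP 0 (w b - w a).
    by rewrite ger0_norm// lerDr expR_ge0.
  by rewrite ler0_norm// opprB lerDl expR_ge0.
rewrite mulrBr (mulrC 22) mulKf ?gt_eqF// => h.
have -> : `|w b - w a| = 2 ^+ n * d a b * ((4 ^+ n)^-1 * (u * `|w b - w a|)).
  by rewrite p42 /u; field; rewrite !gt_eqF.
by rewrite ler_wpM2l ?mulr_ge0 ?(ltW p2) ?(ltW dab)//; lra.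
Qed.

(** The chain runs through representatives from the common root to level L. The mean of the excesses
    is at most 4 in total, which gives (22 + 4) * 45 B plus M S for the root value. *)
Lemma rad_squares_le :
  rademacher ss (fun w => \big[Num.max/0]_i `|w i|) <= 2 ^+ 11 * scale lambda M S L.
Proof.
have B0 := scale_gt0 cvxE M_gt0 S_gt0 L_gt0.
have MSB := MS_le_scale lambda_ge1 M_gt0 S_gt0 L_gt0.
set B := scale _ _ _ _ in B0 MSB *.
have MS0 : 0 < M * S by exact: mulr_gt0.
have [i0 _|I0] := pickP I; last first.
  rewrite -[leRHS](rad_cst ss); apply: le_rad => w.
  rewrite big_pred0 => [|i]; last by have := I0 i.
  by rewrite mulr_ge0 ?exprn_ge0 ?(ltW B0).
have [c [D [cD c0 cS sumD]]] :=
  partition_tree cvxE lambda_ge1 M_gt0 S_gt0 L_gt0 xsL xsM xsS Y1.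
pose r n := representative (c n).
pose i1 := r 0%N i0.
pose W (w : I -> R^o) : R := (22 + \sum_(n < L) excess r n w) * (45 * B).
have rcard n : (#|[set r n l | l in I]%SET| <= 2 ^ (4 * 4 ^ n))%N.
  by apply: card_representatives; have [] := cD n.
have W0 w : 0 <= W w.
  apply: mulr_ge0; last by rewrite mulr_ge0 ?(ltW B0).
  apply: addr_ge0 => //; by apply: sumr_ge0 => n _; exact: excess_ge0.
apply: le_trans (_ : rademacher ss (fun w : I -> R^o => (w i1 ^+ 2 / (M * S) + M * S) / 2 + W w : R) <= _).
  apply: le_rad_bound => w hw; apply: bigmax_le.
    by rewrite addr_ge0 ?W0// divr_ge0// addr_ge0 ?(ltW MS0)// divr_ge0 ?sqr_ge0 ?(ltW MS0).
  move=> i _.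
  (* At distance 0 all summands agree at [k] and [l], hence so do their signed sums; [le_rad_bound]
     makes this available for [w]. *)
  have hd k l : d k l = 0 -> w k = w l.
    move=> dkl; apply/eqP; rewrite -subr_eq0 -normr_le0.
    apply: le_trans (hw (fun w => w k - w l) _) _.
      by move=> v u; rewrite [(v + u) k]/(v k + u k) [(v + u) l]/(v l + u l) opprD addrACA.
    rewrite big_seq big1// => _ /mapP[x xxs ->]; apply/eqP; rewrite normr_eq0.
    rewrite -normr_le0; apply: le_trans (ssqr_sqr_le _ _) _.
    by rewrite (l2_eq0 dkl xxs) normr0.
  have Dn n j : d (r n j) (r n.+1 j) <= D n j.
    have [_ _ /(_ (r n j) (r n.+1 j))] := cD n.
    have -> : c n (r n j) = c n (r n.+1 j).
      by rewrite label_representative; apply/esym/cS; exact: label_representative.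
    move=> /(_ erefl)[_]; have [_ _ /(_ (r n j) j)] := cD n.
    by rewrite label_representative => /(_ erefl)[-> _].
  have exS n : (n < L)%N -> excess r n w <= \sum_(n < L) excess r n w.
    move=> nL; rewrite (bigD1 (Ordinal nL))//= lerDl; apply: sumr_ge0 => k _.
    exact: excess_ge0.
  have ex0 : 0 <= \sum_(n < L) excess r n w by apply: sumr_ge0 => k _; exact: excess_ge0.
  have D0 n : 0 <= D n i by have [] := cD n.
  have chain N : (N <= L)%N -> `|w i| <= `|w i1| + (22 + \sum_(n < L) excess r n w) *
      \sum_(n < N) 2 ^+ n * D n i + `|w i - w (r N i)|.
    elim: N => [_|N IH NL].
      have -> : i1 = r 0%N i by apply: eq_representative; exact: c0.
      by rewrite big_ord0 mulr0 addr0 -{1}[w i](subrK (w (r 0%N i))) addrC ler_normD.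
    apply: le_trans (IH (ltnW NL)) _; rewrite big_ord_recr /= mulrDr.
    have := ler_normD (w i - w (r N.+1 i)) (w (r N.+1 i) - w (r N i)).
    rewrite addrA subrK.
    have := excess_increment (fun e => hd (r N i) (r N.+1 i) e).
    set q := `|w (r N.+1 i) - _| => h1.
    have : q <= (22 + \sum_(n < L) excess r n w) * (2 ^+ N * D N i).
      apply: le_trans h1 _; rewrite mulrC ler_pM//.
      - by rewrite addr_ge0// excess_ge0.
      - by rewrite mulr_ge0 ?exprn_ge0 ?sqdist_ge0.
      - by rewrite lerD2l exS.
      - by rewrite ler_wpM2l ?exprn_ge0.
    by lra.
  apply: le_trans (chain L (leqnn L)) _.
  (* End of the chain: the l1 norm is at most the square root of the number of coordinates times the
     l2 norm, and the result has the size of the term of level L in the sum. *)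
  have res : `|w i - w (r L i)| <= 2 ^+ L * D L i.
    apply: le_trans (hw (fun w => w i - w (r L i)) _) _.
      by move=> v u; rewrite [(v + u) i]/(v i + u i) [(v + u) (r L i)]/(v (r L i) + u (r L i)) opprD addrACA.
    rewrite big_map; apply: le_trans (_ : \sum_(x <- xs) 1 *
      `|ssqr (x (Y i)) - ssqr (x (Y (r L i)))| <= _).
      by apply: ler_sum => x _; rewrite mul1r; exact: ssqr_sqr_le.
    apply: le_trans (cauchy_schwarz _ _ _) _; apply: ler_pM; rewrite ?l2_ge0//.
      apply: l2_le; first by rewrite exprn_ge0.
      rewrite (eq_bigr (fun=> 1)) => [|x _]; last by rewrite expr1n.
      rewrite big_const_seq count_predT iter_addr_0 -exprM -natrX ler_nat.
      by apply: leq_trans xsL _; rewrite leq_exp2l// leq_pmulr.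
    apply: le_trans (_ : d i (r L i) <= _).
      by apply: le_l2 => x _; rewrite normr_id.
    have [_ _ /(_ i (r L i))] := cD L; rewrite label_representative => /(_ erefl)[_].
    by [].
  have wi1 : `|w i1| <= (w i1 ^+ 2 / (M * S) + M * S) / 2.
    have : 0 <= (`|w i1| - M * S) ^+ 2 / (M * S) by rewrite divr_ge0 ?sqr_ge0 ?(ltW MS0).
    rewrite -[w i1 ^+ 2]real_normK ?num_real//.
    rewrite (_ : _ / _ = `|w i1| ^+ 2 / (M * S) + M * S - 2 * `|w i1|); first by lra.
    by field; rewrite !gt_eqF.
  have : (22 + \sum_(n < L) excess r n w) * \sum_(n < L.+1) 2 ^+ n * D n i <= W w.
    by rewrite ler_wpM2l ?addr_ge0.
  rewrite big_ord_recr /= mulrDr.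
  have : 1 * (2 ^+ L * D L i) <= (22 + \sum_(n < L) excess r n w) * (2 ^+ L * D L i).
    by rewrite ler_wpM2r ?mulr_ge0 ?exprn_ge0//; lra.
  by lra.
rewrite radD radZr radD rad_cst [X in (X + _) / 2]radZr.
have -> : rademacher ss W = (22 + \sum_(n < L) rademacher ss (excess r n)) * (45 * B).
  by rewrite radZr radD rad_cst rad_sum.
have ws : rademacher ss (fun w => w i1 ^+ 2) <= (M * S) ^+ 2.
  rewrite (@rad_sqr R _ (fun w : I -> R^o => w i1))// big_map.
  apply: le_trans (_ : l2 xs (fun x : dual E => ssqr (x (Y i1))) ^+ 2 <= _).
    rewrite sqr_l2; apply: ler_sum => x _.
    by rewrite -[leRHS]real_normK ?num_real// ssqr_norm.
  apply: lerXn2r; rewrite ?nnegrE ?l2_ge0 ?(ltW MS0)//.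
  exact: l2_ssqr_le.
have w1 : rademacher ss (fun w => w i1 ^+ 2) / (M * S) <= M * S.
  by rewrite ler_pdivrMr.
have ex4 : \sum_(n < L) rademacher ss (excess r n) <= 4.
  apply: le_trans (_ : \sum_(n < L) 2 * (4 ^+ n)^-1 <= _).
    by apply: ler_sum => n _; exact: rad_excess.
  by rewrite -mulr_sumr; have := @sum_geometric_le R L 4 isT; lra.
have := ler_wpM2r (_ : 0 <= 45 * B) ex4; rewrite mulr_ge0 ?(ltW B0)// => /(_ isT).
by lra.
Qed.

End chaining.

(** * Symmetrization *)

Section iid.
Variables (R : realType) (J : finType) (p : J -> R).
Hypotheses (p_ge0 : forall j, 0 <= p j) (p_sum1 : \sum_j p j = 1).

(** Expectation over [n] independent draws from the law [p], one draw per recursive step so that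
    symmetrization can be done by induction. *)
Fixpoint iid (n : nat) (G : seq J -> R) : R :=
  if n is n'.+1 then \sum_j p j * iid n' (fun s => G (j :: s)) else G [::].

Lemma le_iid n G H : (forall s, size s = n -> G s <= H s) -> iid n G <= iid n H.
Proof.
elim: n G H => [|n IH] G H GH /=; first exact: GH.
by apply: ler_sum => j _; rewrite ler_wpM2l// IH// => s sn; rewrite GH//= sn.
Qed.

Lemma eq_iid n G H : (forall s, size s = n -> G s = H s) -> iid n G = iid n H.
Proof. by move=> GH; apply/eqP; rewrite eq_le !le_iid// => s sn; rewrite GH. Qed.

Lemma iid_cst n c : iid n (fun=> c) = c.
Proof. by elim: n => //= n ->; rewrite -mulr_suml p_sum1 mul1r. Qed.

Lemma iidD n G H : iid n (fun s => G s + H s) = iid n G + iid n H.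
Proof.
elim: n G H => //= n IH G H; rewrite -big_split /=.
by apply: eq_bigr => j _; rewrite IH mulrDr.
Qed.

Lemma iidZ n a G : iid n (fun s => a * G s) = a * iid n G.
Proof.
elim: n G => //= n IH G; rewrite mulr_sumr.
by apply: eq_bigr => j _; rewrite IH mulrCA.
Qed.

Lemma iid_sum n (K : Type) (r : seq K) (G : K -> seq J -> R) :
  iid n (fun s => \sum_(k <- r) G k s) = \sum_(k <- r) iid n (G k).
Proof.
elim: r => [|k r IH].
  by rewrite big_nil -[RHS](iid_cst n); apply: eq_iid => s _; rewrite big_nil.
by rewrite big_cons -IH -iidD; apply: eq_iid => s _; rewrite big_cons.
Qed.

Lemma iid_ge0 n G : (forall s, size s = n -> 0 <= G s) -> 0 <= iid n G.
Proof. by move=> G0; rewrite -(iid_cst n 0) le_iid. Qed.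

Lemma iid_tuple n G :
  iid n G = \sum_(t : n.-tuple J) (\prod_(i < n) p (tnth t i)) * G t.
Proof.
elim: n G => [|n IH] G /=.
  rewrite (big_pred1 [tuple]) => [|t]; last by apply/esym/eqP; exact: tuple0.
  by rewrite big_ord0 mul1r.
under eq_bigr do rewrite IH mulr_sumr.
rewrite pair_big /= (reindex (fun t : n.+1.-tuple J => (thead t, [tuple of behead t]))) /=.
  apply: eq_bigr => t _; rewrite big_ord_recl mulrA; congr (_ * _ * _).
    by apply: eq_bigr => i _; rewrite [in RHS](tuple_eta t) tnthS.
  by rewrite [in RHS](tuple_eta t).
apply: onW_bij; exists (fun q : J * n.-tuple J => [tuple of q.1 :: q.2]) => [t|[j t]] /=.
  by rewrite [in RHS](tuple_eta t).
by congr pair; apply: val_inj.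
Qed.

(** AM-GM with weights tuned to the two means; the lower bound [e] keeps these means away from 0. *)
Lemma iid_cauchy_schwarz n G H (e : R) : 0 < e ->
  (forall s, size s = n -> e <= G s) -> (forall s, size s = n -> e <= H s) ->
  iid n (fun s => Num.sqrt (G s * H s)) <= Num.sqrt (iid n G * iid n H).
Proof.
move=> e0 eG eH.
have g0 : 0 < iid n G by apply: lt_le_trans e0 _; rewrite -(iid_cst n e) le_iid.
have h0 : 0 < iid n H by apply: lt_le_trans e0 _; rewrite -(iid_cst n e) le_iid.
set a := Num.sqrt (iid n G); set b := Num.sqrt (iid n H).
have a0 : 0 < a by rewrite sqrtr_gt0.
have b0 : 0 < b by rewrite sqrtr_gt0.
rewrite sqrtrM ?(ltW g0)// -/a -/b.
apply: le_trans (_ : iid n (fun s => (b / (2 * a)) * G s + (a / (2 * b)) * H s) <= _).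
  apply: le_iid => s sn; have Gs := eG _ sn; have Hs := eH _ sn.
  have G0 : 0 <= G s by lra.
  have H0 : 0 <= H s by lra.
  rewrite sqrtrM//; set g := Num.sqrt (G s); set h := Num.sqrt (H s).
  have gE : G s = g ^+ 2 by rewrite sqr_sqrtr.
  have hE : H s = h ^+ 2 by rewrite sqr_sqrtr.
  have : 0 <= (b * g - a * h) ^+ 2 / (2 * a * b).
    by rewrite divr_ge0 ?sqr_ge0// mulr_ge0 ?mulr_ge0// ltW.
  rewrite gE hE (_ : (_ - _) ^+ 2 / _ = b / (2 * a) * g ^+ 2 + a / (2 * b) * h ^+ 2 - g * h).
    by lra.
  by field; rewrite !gt_eqF.
rewrite iidD !iidZ.
have -> : iid n G = a ^+ 2 by rewrite sqr_sqrtr// ltW.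
have -> : iid n H = b ^+ 2 by rewrite sqr_sqrtr// ltW.
by rewrite le_eqVlt; apply/orP; left; apply/eqP; field; rewrite !gt_eqF.
Qed.

Section symmetrization.
Variables (V : lmodType R) (F : V -> R) (f : J -> V).
Hypothesis convexF : forall (K : finType) (q : K -> R) (v : K -> V),
  (forall k, 0 <= q k) -> \sum_k q k = 1 ->
  F (\sum_k q k *: v k) <= \sum_k q k * F (v k).

Let mu := \sum_j p j *: f j.

Lemma convex_half v w : F (2^-1 *: (v + w)) <= 2^-1 * (F v + F w).
Proof.
have e1 : \sum_(k : bool) 2^-1 = 1 :> R by rewrite big_bool /=; field.
have := @convexF bool (fun=> 2^-1) (fun b => if b then v else w) (fun=> _) e1.
by rewrite !big_bool /= -scalerDr -mulrDr; apply; rewrite invr_ge0.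
Qed.

(* Jensen against an independent copy [k] of [j], then convexity to split the
   two copies. *)
Lemma symmetrization1 u :
  \sum_j p j * F (u + (f j - mu)) <=
  \sum_j p j * (2^-1 * (F (u + 2 *: f j) + F (u - 2 *: f j))).
Proof.
apply: le_trans (_ : \sum_j p j * (\sum_k p k * (2^-1 * (F (u + 2 *: f j) + F (u - 2 *: f k)))) <= _).
  apply: ler_sum => j _; rewrite ler_wpM2l//.
  rewrite (_ : u + (f j - mu) = \sum_k p k *: (u + (f j - f k))).
    apply: le_trans (convexF _ p_ge0 p_sum1) _.
    apply: ler_sum => k _; rewrite ler_wpM2l//.
    apply: le_trans (convex_half _ _).
    rewrite addrACA scalerDr (_ : u + u = 2 *: u); last by rewrite scaler_nat mulr2n.
    rewrite -scalerBr !scalerA.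
    by rewrite (mulVf (_ : 2 != 0 :> R)) ?pnatr_eq0// !scale1r.
  under eq_bigr do rewrite scalerDr scalerBr.
  rewrite big_split /= -scaler_suml p_sum1 scale1r; congr (_ + _).
  by rewrite sumrB -scaler_suml p_sum1 scale1r.
set a := fun j => F (u + 2 *: f j); set b := fun j => F (u - 2 *: f j).
have e j : \sum_k p k * (2^-1 * (a j + b k)) = 2^-1 * a j + 2^-1 * \sum_k p k * b k.
  transitivity (\sum_k (p k * (2^-1 * a j) + 2^-1 * (p k * b k))).
    by apply: eq_bigr => k _; ring.
  by rewrite big_split /= -mulr_suml p_sum1 mul1r -mulr_sumr.
rewrite (eq_bigr (fun j => p j * (2^-1 * a j) + p j * (2^-1 * \sum_k p k * b k))); last first.
  by move=> j _; rewrite e mulrDr.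
rewrite big_split /= -mulr_suml p_sum1 mul1r mulr_sumr -big_split /=.
by apply: ler_sum => j _; rewrite le_eqVlt; apply/orP; left; apply/eqP; rewrite /a /b; ring.
Qed.

End symmetrization.

(** One draw is symmetrized at a time; the shift [v] absorbs the current term while the induction
    hypothesis treats the others. *)
Lemma symmetrization (V : lmodType R) (F : V -> R) (f : J -> V) n v :
  (forall (K : finType) (q : K -> R) (v : K -> V),
    (forall k, 0 <= q k) -> \sum_k q k = 1 ->
    F (\sum_k q k *: v k) <= \sum_k q k * F (v k)) ->
  iid n (fun s => F (v + \sum_(j <- s) (f j - \sum_j p j *: f j))) <=
  iid n (fun s => rademacher [seq 2 *: f j | j <- s] (fun w => F (v + w))).
Proof.
move=> convexF; elim: n v => [|n IH] v /=; first by rewrite big_nil.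
set mu := \sum_j p j *: f j in IH *.
apply: le_trans (_ : \sum_j p j * iid n (fun s => rademacher [seq 2 *: f j | j <- s]
    (fun w => F (v + w + (f j - mu)))) <= _).
  apply: ler_sum => j _; rewrite ler_wpM2l//.
  apply: le_trans (_ : iid n (fun s => F (v + (f j - mu) + \sum_(j <- s) (f j - mu))) <= _).
    by apply: le_iid => s _; rewrite big_cons addrA.
  apply: le_trans (IH _) _; apply: le_iid => s _; apply: le_rad => w.
  by rewrite addrAC.
have e (G : J -> seq J -> R) : \sum_j p j * iid n (G j) = iid n (fun s => \sum_j p j * G j s).
  by rewrite iid_sum; apply: eq_bigr => j _; rewrite iidZ.
rewrite !e; apply: le_iid => s _.
under eq_bigr do rewrite -radZ.
under [leRHS]eq_bigr do rewrite -radD -!radZ.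
rewrite -!rad_sum; apply: le_rad => w.
apply: le_trans (symmetrization1 f convexF (v + w)) _; apply: ler_sum => j _.
by rewrite addrAC addrA [in X in _ <= X]addrA [v - _ + w]addrAC.
Qed.

End iid.

Lemma le_of_le_sqrt (R : rcfType) (v a s : R) : 0 <= v -> 0 <= a -> 0 <= s ->
  v <= a * Num.sqrt (v + s) -> v <= a ^+ 2 + a * Num.sqrt s.
Proof.
move=> v0 a0 s0 h; rewrite leNgt; apply/negP => h1.
set t := Num.sqrt s in h1; have t0 : 0 <= t by exact: sqrtr_ge0.
have st : s = t ^+ 2 by rewrite sqr_sqrtr.
have h2 : v ^+ 2 <= a ^+ 2 * (v + s).
  have -> : v + s = Num.sqrt (v + s) ^+ 2 by rewrite sqr_sqrtr// addr_ge0.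
  rewrite -exprMn; apply: lerXn2r => //; rewrite nnegrE//.
  by rewrite mulr_ge0// sqrtr_ge0.
have v1 : a ^+ 2 < v by apply: le_lt_trans h1; rewrite lerDl mulr_ge0.
have v2 : a * t < v - a ^+ 2 by lra.
have h3 : v * (v - a ^+ 2) <= (a * t) ^+ 2 by rewrite exprMn -st; nra.
have h4 : 0 <= a * t by rewrite mulr_ge0.
have : (a * t) * (a * t) < v * (v - a ^+ 2).
  apply: ltr_pM => //.
  by apply: le_lt_trans h1; rewrite lerDr sqr_ge0.
by lra.
Qed.

Lemma le_of_le_eps (R : realFieldType) (v u D : R) : 0 <= D ->
  (forall e, 0 < e -> e <= 1 -> v <= u + D * e) -> v <= u.
Proof.
move=> D0 h; apply/ler_addgt0Pr => e e0.
pose t := Num.min 1 (e / (D + 1)).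
have D1 : 0 < D + 1 by rewrite ltr_wpDl.
have t0 : 0 < t by rewrite lt_min ltr01 divr_gt0.
apply: le_trans (h t t0 _) _; first by rewrite ge_min lexx.
rewrite lerD2l; apply: le_trans (_ : D * (e / (D + 1)) <= _).
  by rewrite ler_wpM2l// ge_min lexx orbT.
rewrite mulrA ler_pdivrMr//; nra.
Qed.

Lemma radZ_map (R : realType) (V : lmodType R) (c : R) (s : seq V) (F : V -> R) :
  rademacher [seq c *: v | v <- s] F = rademacher s (fun w => F (c *: w)).
Proof.
elim: s F => [|v s IH] F /=; first by rewrite scaler0.
by rewrite !IH; congr (_ * (_ + _)); apply: eq_rad => w; rewrite scalerDr ?scalerN.
Qed.

(** * Finitely supported laws *)

Section finite_law.
Variables (R : realType) (E : normedModType R) (lambda : R).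
Hypothesis cvxE : modulus_convexity_power2 E lambda.
Hypothesis lambda_ge1 : 1 <= lambda.
Variables (J : finType) (p : J -> R) (x : J -> dual E) (m L : nat).
Hypotheses (p_ge0 : forall j, 0 <= p j) (p_sum1 : \sum_j p j = 1).
Hypotheses (m_gt0 : (0 < m)%N) (L_gt0 : (0 < L)%N) (mL : (m <= 2 ^ L)%N).

Definition deviation (s : seq J) (y : E) : R :=
  m%:R^-1 * \sum_(j <- s) x j y ^+ 2 - \sum_j p j * x j y ^+ 2.

Definition sup_deviation (s : seq J) : R :=
  sup [set `|deviation s y| | y in unit_ball E].

Definition max_normsq (s : seq J) : R := \big[Num.max/0]_(j <- s) `|x j| ^+ 2.

Let sqr_le j y : unit_ball E y -> x j y ^+ 2 <= `|x j| ^+ 2.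
Proof.
move=> y1; rewrite -[X in X <= _]real_normK ?num_real//; apply: lerXn2r; rewrite ?nnegrE//.
exact: dual_norm_ub.
Qed.

Lemma sup_deviation_has_sup s : has_sup [set `|deviation s y| | y in unit_ball E].
Proof.
split; first by exists `|deviation s 0|, 0 => //; rewrite /unit_ball /= normr0.
exists (m%:R^-1 * \sum_(j <- s) `|x j| ^+ 2 + \sum_j p j * `|x j| ^+ 2) => _ [y y1 <-].
rewrite /deviation; apply: le_trans (ler_normB _ _) _; rewrite !ger0_norm.
- rewrite lerD//.
    by rewrite ler_wpM2l ?invr_ge0//; apply: ler_sum => j _; exact: sqr_le.
  by apply: ler_sum => j _; rewrite ler_wpM2l// sqr_le.
- by apply: sumr_ge0 => j _; rewrite mulr_ge0 ?sqr_ge0.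
- by rewrite mulr_ge0 ?invr_ge0// sumr_ge0// => j _; exact: sqr_ge0.
Qed.

Lemma le_sup_deviation s y : unit_ball E y -> `|deviation s y| <= sup_deviation s.
Proof. by move=> y1; apply: sup_ubound; [case: (sup_deviation_has_sup s)|exists y]. Qed.

Lemma sup_deviation_ge0 s : 0 <= sup_deviation s.
Proof.
by apply: le_trans (@le_sup_deviation s 0 _); rewrite // /unit_ball /= normr0.
Qed.

Lemma max_normsq_ge0 s : 0 <= max_normsq s.
Proof.
rewrite /max_normsq; elim/big_rec : _ => // j a _ a0.
by rewrite le_max sqr_ge0.
Qed.

Variable s2 : R.
Hypothesis s2_ub : forall y, unit_ball E y -> \sum_j p j * x j y ^+ 2 <= s2.

Let s2_ge0 : 0 <= s2.
Proof.
apply: le_trans (s2_ub (y := 0) _); last by rewrite /unit_ball /= normr0.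
by apply: sumr_ge0 => j _; rewrite mulr_ge0 ?sqr_ge0.
Qed.

Let C1 : R := 2 ^+ 11 * (2 ^+ 10 * lambda ^+ 3).

Let C1_ge0 : 0 <= C1.
Proof.
have l0 : 0 <= lambda by apply: le_trans lambda_ge1.
by rewrite /C1 mulr_ge0 ?exprn_ge0// mulr_ge0 ?exprn_ge0.
Qed.

(** The sum of squares over a sample is [m] times its mean plus its deviation, so the parameter S of
    the chaining bound is itself controlled by [sup_deviation]. The slack [e] keeps both parameters
    positive. *)
Lemma rad_deviation_le (I : finType) (Y : I -> E) s e :
  (forall i, unit_ball E (Y i)) -> size s = m -> 0 < e ->
  rademacher [seq squares Y (x j) | j <- s] (fun w => \big[Num.max/0]_i `|w i|) <=
  C1 * Num.sqrt L%:R *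
    Num.sqrt ((max_normsq s + e) * (m%:R * (sup_deviation s + s2) + e)).
Proof.
move=> Y1 sm e0.
have M0 : 0 < max_normsq s + e by rewrite ltr_wpDl ?max_normsq_ge0.
have S0 : 0 < m%:R * (sup_deviation s + s2) + e.
  by rewrite ltr_wpDl ?mulr_ge0 ?addr_ge0 ?sup_deviation_ge0.
have := @rad_squares_le R E lambda cvxE lambda_ge1 [seq x j | j <- s]
  (Num.sqrt (max_normsq s + e)) (Num.sqrt (m%:R * (sup_deviation s + s2) + e)) L
  _ _ L_gt0 _ _ _ I Y Y1.
rewrite -map_comp sqrtrM ?(ltW M0)// !sqrtr_gt0 M0 S0 size_map sm mL => /(_ isT isT isT).
rewrite /scale /C1 => h; apply: le_trans (h _ _) _.
- move=> _ /mapP[j js ->]; rewrite -[leLHS]ger0_norm// -sqrtr_sqr ler_wsqrtr//.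
  apply: le_trans (_ : max_normsq s <= _); last by rewrite lerDl ltW.
  exact: (@le_bigmax_seq _ R J s 0 j xpredT (fun j => `|x j| ^+ 2)).
- move=> y y1; rewrite big_map sqr_sqrtr ?(ltW S0)//.
  have mR : 0 < m%:R :> R by rewrite ltr0n.
  have := le_trans (ler_norm _) (@le_sup_deviation s y y1).
  rewrite /deviation; have := s2_ub y1; set u := \sum_j _; set v := \sum_(_ <- _) _.
  move=> us vu; have : v <= m%:R * (sup_deviation s + s2) by rewrite -ler_pdivrMl//; lra.
  by move: e0; lra.
by rewrite le_eqVlt; apply/orP; left; apply/eqP; ring.
Qed.

(** Symmetrization and chaining bound the deviation by a product containing the root of that same
    deviation; Cauchy-Schwarz passes to means and [le_of_le_sqrt] solves the resulting
    inequality. *)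
Lemma finite_law_bound a :
  a = 2 * C1 * Num.sqrt (L%:R / m%:R) * Num.sqrt (iid p m max_normsq) ->
  iid p m sup_deviation <= a ^+ 2 + a * Num.sqrt s2.
Proof.
move=> aE; have mR : 0 < m%:R :> R by rewrite ltr0n.
set M2 := iid p m max_normsq in aE; set v := iid p m sup_deviation.
have M20 : 0 <= M2 by apply: iid_ge0 => // s _; exact: max_normsq_ge0.
have v0 : 0 <= v by apply: iid_ge0 => // s _; exact: sup_deviation_ge0.
have a0 : 0 <= a by rewrite aE mulr_ge0 ?sqrtr_ge0// mulr_ge0 ?sqrtr_ge0// mulr_ge0.
apply: le_of_le_sqrt => //.
pose c := 2 * C1 * Num.sqrt L%:R / m%:R.
have c0 : 0 <= c by rewrite /c divr_ge0 ?(ltW mR)// mulr_ge0 ?sqrtr_ge0// mulr_ge0.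
have -> : a * Num.sqrt (v + s2) = c * Num.sqrt (M2 * (m%:R * (v + s2))).
  have e1 : Num.sqrt (L%:R / m%:R) = Num.sqrt L%:R / Num.sqrt m%:R :> R.
    by rewrite sqrtrM ?ler0n// sqrtrV ?ler0n.
  have e2 : Num.sqrt (M2 * (m%:R * (v + s2))) =
      Num.sqrt M2 * (Num.sqrt m%:R * Num.sqrt (v + s2)).
    by rewrite sqrtrM// sqrtrM ?ler0n.
  have e3 : m%:R = Num.sqrt m%:R ^+ 2 :> R by rewrite sqr_sqrtr// ltW.
  rewrite aE /c e1 e2 [X in _ = _ / X * _]e3; field.
  by rewrite gt_eqF// sqrtr_gt0.
set B2 := m%:R * (v + s2).
have B20 : 0 <= B2 by rewrite mulr_ge0 ?addr_ge0// ltW.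
apply: (@le_of_le_eps _ _ _ (1 + c * Num.sqrt (M2 + B2 + 1))) => [|e e0 e1].
  by apply: addr_ge0 => //; apply: mulr_ge0 => //; exact: sqrtr_ge0.
have e20 : 0 < e ^+ 2 by rewrite exprn_gt0.
(* There are finitely many samples, so one near maximizer for each gives a finite family, indexed by
   the samples themselves, that serves all of them. *)
have Yex (s : m.-tuple J) : exists y, unit_ball E y /\ sup_deviation s - e <= `|deviation s y|.
  have [_ [y y1 <-] /ltW h] := sup_adherent e0 (sup_deviation_has_sup s).
  by exists y.
have [Y YP] := choice Yex.
pose N (w : m.-tuple J -> R^o) : R := \big[Num.max/0]_i `|w i|.
have N_le w i : `|w i| <= N w by apply: (@le_bigmax _ R _ 0 (fun i => `|w i|)).
have N_ge0 w : 0 <= N w by rewrite /N; elim/big_rec : _ => // i b _ b0; rewrite le_max b0 orbT.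
have N_convex (K : finType) (q : K -> R) (u : K -> m.-tuple J -> R^o) :
    (forall k, 0 <= q k) -> \sum_k q k = 1 ->
    N (\sum_k q k *: u k) <= \sum_k q k * N (u k).
  move=> q0 _; apply: bigmax_le => [|i _]; first by apply: sumr_ge0 => k _; rewrite mulr_ge0.
  rewrite fct_sumE; apply: le_trans (ler_norm_sum _ _ _) _; apply: ler_sum => k _.
  by rewrite normrM ger0_norm// ler_wpM2l.
have NZ (b : R) w : 0 <= b -> N (b *: w) <= b * N w.
  move=> b0; apply: bigmax_le => [|i _]; first by rewrite mulr_ge0.
  by rewrite [X in `|X|](_ : _ = b * w i)// normrM ger0_norm// ler_wpM2l.
pose f j : m.-tuple J -> R^o := squares Y (x j).
have step1 : v <= e + m%:R^-1 * iid p m (fun s => N (0 + \sum_(j <- s) (f j - \sum_j p j *: f j))).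
  rewrite -[X in X + _](iid_cst p_sum1 m) -iidZ -iidD; apply: le_iid => // s sm.
  pose t : m.-tuple J := Tuple (introT eqP sm).
  have [y1 hy] := YP t.
  have -> : s = t by [].
  have : `|deviation t (Y t)| <= m%:R^-1 * N (0 + \sum_(j <- t) (f j - \sum_j p j *: f j)).
    rewrite add0r ler_pdivlMl//.
    apply: le_trans (N_le _ t); rewrite -[X in X * _ <= _](ger0_norm (ltW mR)) -normrM.
    rewrite le_eqVlt; apply/orP; left; apply/eqP; congr `|_|.
    rewrite sumrB big_const_seq count_predT iter_addr_0 size_tuple.
    rewrite [RHS](_ : _ = (\sum_(j <- t) f j) t - ((\sum_j p j *: f j) *+ m) t)//.
    rewrite -scaler_nat [X in _ - X](_ : _ = m%:R * (\sum_j p j *: f j) t)// !fct_sumE.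
    by rewrite /deviation mulrBr mulrA divff ?gt_eqF// mul1r.
  by move: hy; lra.
have step2 := @symmetrization R J p p_ge0 p_sum1 _ N f m 0 N_convex.
have step3 : iid p m (fun s => rademacher [seq 2 *: f j | j <- s] (fun w => N (0 + w))) <=
    2 * (C1 * Num.sqrt L%:R) * Num.sqrt ((M2 + e ^+ 2) * (B2 + e ^+ 2)).
  have -> : (M2 + e ^+ 2) * (B2 + e ^+ 2) = iid p m (fun s => max_normsq s + e ^+ 2) *
     iid p m (fun s => m%:R * (sup_deviation s + s2) + e ^+ 2).
    by rewrite !(iidD, iidZ) !iid_cst.
  apply: le_trans (ler_wpM2l _ (iid_cauchy_schwarz p_ge0 p_sum1 e20 _ _)).
  - rewrite -iidZ; apply: le_iid => // s sm.
    rewrite map_comp radZ_map.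
    apply: le_trans (_ : rademacher [seq f j | j <- s] (fun w => 2 * N w) <= _).
      by apply: le_rad => w; rewrite add0r NZ.
    rewrite radZ -mulrA ler_wpM2l//; apply: rad_deviation_le => // i.
    by have [] := YP i.
  - by rewrite mulr_ge0// mulr_ge0 ?sqrtr_ge0.
  - by move=> s _; rewrite lerDr max_normsq_ge0.
  - by move=> s _; rewrite lerDr mulr_ge0 ?addr_ge0 ?sup_deviation_ge0.
have step4 : Num.sqrt ((M2 + e ^+ 2) * (B2 + e ^+ 2)) <=
    Num.sqrt (M2 * B2) + Num.sqrt (M2 + B2 + 1) * e.
  have u0 : 0 <= Num.sqrt (M2 * B2) by exact: sqrtr_ge0.
  have w0 : 0 <= Num.sqrt (M2 + B2 + 1) by exact: sqrtr_ge0.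
  have uw : 0 <= Num.sqrt (M2 * B2) + Num.sqrt (M2 + B2 + 1) * e.
    by rewrite addr_ge0// mulr_ge0// ltW.
  rewrite -[leRHS]ger0_norm// -sqrtr_sqr ler_wsqrtr//.
  have uE : Num.sqrt (M2 * B2) ^+ 2 = M2 * B2 by rewrite sqr_sqrtr// mulr_ge0.
  have wE : Num.sqrt (M2 + B2 + 1) ^+ 2 = M2 + B2 + 1 by rewrite sqr_sqrtr// !addr_ge0.
  rewrite sqrrD exprMn uE wE.
  have : 0 <= Num.sqrt (M2 * B2) * (Num.sqrt (M2 + B2 + 1) * e) *+ 2.
    by rewrite mulrn_wge0// mulr_ge0// mulr_ge0// ltW.
  have : e ^+ 2 * e ^+ 2 <= e ^+ 2 * 1 by rewrite ler_wpM2l ?sqr_ge0// exprn_ile1// ltW.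
  by lra.
have := le_trans step1 (lerD (lexx e) (ler_wpM2l _ (le_trans step2 step3))).
rewrite invr_ge0 ltW// => /(_ isT) h; apply: le_trans h _.
rewrite (_ : m%:R^-1 * _ = c * Num.sqrt ((M2 + e ^+ 2) * (B2 + e ^+ 2))); last first.
  by rewrite /c; field; rewrite gt_eqF.
by have := ler_wpM2l c0 step4; lra.
Qed.

End finite_law.

(** * Measurability in the dual and the type 2 constant *)

Lemma lipschitz_norm_continuous (R : realType) (V : normedModType R) (g : V -> R)
    (k : R) : 0 < k -> (forall f h, `|g f - g h| <= k * `|f - h|) -> continuous g.
Proof.
move=> k0 gk f; apply/cvgrPdist_lt => e e0.
apply/nbhs_normP; exists (e / k) => [|h /=]; first exact: divr_gt0.
by rewrite ltr_pdivlMr// mulrC; apply: le_lt_trans.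
Qed.

Section continuous_dual.
Variables (R : realType) (E : normedModType R).

Lemma lipschitz_measurable_dual (g : dual E -> R) (k : R) : 0 < k ->
  (forall f h, `|g f - g h| <= k * `|f - h|) -> measurable_fun [set: dual E] g.
Proof.
move=> k0 /(lipschitz_norm_continuous k0) cg.
apply: (measurability _ (RGenOInfty.measurableE R)).
move=> _ [_ [x ->] <-]; rewrite setTI; apply: sub_sigma_algebra.
by apply: open_comp; [move=> y _; exact: cg|exact: interval_open].
Qed.

Lemma measurable_dual_dist (v : dual E) :
  measurable_fun [set: dual E] (fun f : dual E => `|f - v|).
Proof.
apply: (@lipschitz_measurable_dual _ 1) => // f h; rewrite mul1r.
by apply: le_trans (ler_dist_dist _ _) _; rewrite opprB addrA subrK.
Qed.

Lemma measurable_dual_norm : measurable_fun [set: dual E] (fun f : dual E => `|f|).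
Proof.
apply: (@lipschitz_measurable_dual _ 1) => // f h; rewrite mul1r.
exact: ler_dist_dist.
Qed.

Lemma measurable_dual_eval (y : E) :
  measurable_fun [set: dual E] (fun f : dual E => f y : R).
Proof.
apply: (@lipschitz_measurable_dual _ (`|y| + 1)) => [|f h]; first by rewrite ltr_wpDl.
rewrite (_ : f y - h y = (f - h) y)//; apply: le_trans (dual_le _ _) _.
by rewrite mulrC ler_wpM2r// lerDl.
Qed.

End continuous_dual.

Section lower_integral.
Local Open Scope ereal_scope.
Context d (T : measurableType d) (R : realType) (mu : {measure set T -> \bar R}).

(* No measurability: the integral of a nonnegative function is defined as a
   lower integral. *)
Lemma ge0_le_lower_integral (f g : T -> \bar R) : (forall x, 0 <= f x) ->
  (forall x, f x <= g x) -> \int[mu]_x f x <= \int[mu]_x g x.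
Proof.
move=> f0 fg; rewrite !ge0_integralTE//; last by move=> x; exact: le_trans (fg x).
apply: le_ereal_sup => _ [h hf <-]; exists h => // x.
exact: le_trans (hf x) (fg x).
Qed.

End lower_integral.

(** * A positive lower bound on type 2 constants *)

Section type2_constant_lower_bound.
Variable R : realType.

Let idT : measurableTypeR R -> R := idfun.

HB.instance Definition _ :=
  @isMeasurableFun.Build _ _ _ _ idT (@measurable_id _ _ setT).

Let gauss : probability (measurableTypeR R) R := normal_prob 0 1.

(** A vanishing moment would concentrate the law at 0, but it is absolutely continuous and gives
    that point mass 0. *)
Lemma gaussian_first_moment_gt0 : (0 < \int[gauss]_w `|w|%:E)%E.
Proof.
rewrite lt_neqAle integral_ge0 ?andbT//.
apply/negP => /eqP/esym h.
have mf : measurable_fun [set: measurableTypeR R] (EFin \o idT).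
  by apply/measurable_EFinP.
have /(ae_eq_integral_abs gauss measurableT mf) [N [mN N0 sub]] :
    (\int[gauss]_w `|(idT w)%:E| = 0)%E by rewrite -[RHS]h.
have N1 : (lebesgue_measure [set 0%R : R] = 0)%E by rewrite lebesgue_measure_set1.
have : (gauss setT <= 0)%E.
  have h1 : gauss [set 0 : measurableTypeR R] = 0%E.
    by apply: (null_content_dominatesP _ _).1 N1 => //; exact: normal_prob_dominates.
  rewrite -[leRHS]adde0 -[X in (_ <= X + _)%E]h1 -[X in (_ <= _ + X)%E]N0.
  apply: le_trans (measureU2 _ _ _) => //.
  apply: le_measure; rewrite ?inE//; first exact: measurableU.
  move=> w _; have [->|w0] := eqVneq w 0; [by left|right; apply: sub => /= /(_ I) []].
  by move/eqP; rewrite (negbTE w0).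
by rewrite probability_setT lee_fin ler10.
Qed.

(** Test the type 2 inequality on a single nonzero vector. *)
Lemma type2_constant_ge : exists2 c0 : R, 0 < c0 &
  forall (F : normedModType R) (x : F), x != 0 -> (c0%:E <= type2_constant F)%E.
Proof.
have m0 := gaussian_first_moment_gt0; set m1 := (\int[_]_w _)%E in m0.
have [c0 c00 c0m] : exists2 c0 : R, 0 < c0 & (c0%:E <= m1)%E.
  case: m1 m0 => [r| |]//; first by rewrite lte_fin => r0; exists r.
  by exists 1 => //; rewrite leey.
exists c0 => // F x x0; apply: le_ereal_inf_tmp => _ [c [c_ge0 cF] <-].
pose g (i : 'I_1) : {RV gauss >-> R} := idT.
have gi : iid_std_gaussian g.
  split=> // J B mB.
  have [->|[j jJ]] := set_0Vmem J.
    rewrite big_set0 (_ : \bigcap_(i in _) _ = setT) ?probability_setT//.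
    by rewrite -subTset => w _ i /=; rewrite inE.
  have -> : J = [set j]%SET by apply/setP => i; rewrite !inE !ord1 -(ord1 j) jJ eqxx.
  have e : [set` [set j]%SET] = [set j].
    by apply/seteqP; split => i /=; rewrite inE => /eqP.
  by rewrite big_set1 e bigcap_set1.
have := cF _ _ gauss 1%N g (fun=> x) gi.
rewrite unlock big_ord1 sqrtr_sqr normr_id.
have -> : (\int[gauss]_w (`|\sum_(i < 1) g i w *: x|%:E) = m1 * `|x|%:E)%E.
  rewrite /m1 -ge0_integralZr//.
  - by apply: eq_integral => w _; rewrite big_ord1 normrZ EFinM.
  - by apply/measurable_EFinP; exact: (measurableT_comp (@normr_measurable R setT) (@measurable_id _ _ setT)).
move=> h; have : (c0%:E * `|x|%:E <= c%:E * `|x|%:E)%E.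
  apply: le_trans (lee_wpmul2r _ c0m) _; first by rewrite lee_fin.
  by rewrite -EFinM.
by rewrite -!EFinM !lee_fin ler_pM2r// normr_gt0.
Qed.

End type2_constant_lower_bound.

(** * Approximation by finitely valued maps *)

Section finite_valued.
Local Open Scope ereal_scope.
Context d (T : measurableType d) (R : realType).

Lemma integral_finite_valued (P : probability T R) (J : finType) (u : T -> J)
    (F : J -> R) :
  (forall j, measurable (u @^-1` [set j])) -> (forall j, 0 <= F j)%R ->
  \int[P]_w (F (u w))%:E = (\sum_j fine (P (u @^-1` [set j])) * F j)%:E.
Proof.
move=> mu F0; transitivity (\int[P]_w (\sum_(j : J) (F j)%:E * (\1_(u @^-1` [set j]) w)%:E)).
  apply: eq_integral => w _; rewrite (bigD1 (u w))//= big1 ?adde0.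
    by rewrite indicE mem_set// mule1.
  by move=> j ju; rewrite indicE memNset ?mule0// => /= /eqP; rewrite eq_sym (negbTE ju).
rewrite ge0_integral_sum//.
- rewrite -sumEFin; apply: eq_bigr => j _.
  rewrite ge0_integralZl//.
  + by rewrite integral_indic// setIT muleC EFinM fineK// fin_num_measure.
  + by apply/measurable_EFinP.
  + by rewrite lee_fin.
- by move=> j; apply: measurable_funeM; apply/measurable_EFinP.
- by move=> j w _; rewrite mule_ge0 ?lee_fin// indicE.
Qed.

Lemma measurable_finite_case (J : finType) (u : T -> J) (F : J -> T -> R) :
  (forall j, measurable (u @^-1` [set j])) ->
  (forall j, measurable_fun setT (F j)) -> measurable_fun setT (fun w => F (u w) w).
Proof.
move=> mu mF.
rewrite (_ : (fun w => _) = (fun w => \sum_j \1_(u @^-1` [set j]) w * F j w)%R).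
  by apply: measurable_sum => j; apply: measurable_funM.
apply/funext => w; rewrite (bigD1 (u w))//= big1 ?addr0.
  by rewrite indicE mem_set// mul1r.
by move=> j ju; rewrite indicE memNset ?mul0r// => /= /eqP; rewrite eq_sym (negbTE ju).
Qed.

Lemma measurable_find (B : nat -> set T) (s : seq nat) (k : nat) :
  (forall i, measurable (B i)) ->
  measurable [set w | find (fun i => `[< B i w >]) s = k].
Proof.
move=> mB; elim: s k => [|i s IH] k /=.
  have [<-|k0] := eqVneq 0%N k; first by rewrite (_ : [set w | _] = setT)//; apply/seteqP.
  by rewrite (_ : [set w | _] = set0)//; apply/seteqP; split => // w /= /eqP; rewrite (negbTE k0).
case: k => [|k].
  rewrite (_ : [set w | _] = B i)//; apply/seteqP; split => w /=.
    by case: asboolP.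
  by move=> Bw; rewrite asboolT.
rewrite (_ : [set w | _] = ~` B i `&` [set w | find (fun i => `[< B i w >]) s = k]).
  by apply: measurableI => //; exact: measurableC.
apply/seteqP; split => w /=; case: asboolP => // Bw.
- by move=> [].
- by case.
- by case=> _ ->.
Qed.

End finite_valued.

Lemma closure_norm (R : realType) (V : normedModType R) (D : set V) x (e : R) :
  closure D x -> 0 < e -> exists2 a, D a & `|x - a| < e.
Proof.
move=> Dx e0; have [|a [Da xa]] := Dx (ball_ Num.norm x e).
  by apply/nbhs_normP; exists e.
by exists a.
Qed.

Section quantization.
Variables (R : realType) (E : normedModType R).
Context d0 (T0 : measurableType d0) (P0 : probability T0 R) (X : {RV P0 >-> dual E}).

(** [q] selects the first of [n] points of a countable set that lies within [de]; the points missed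
    by all of them get the last label. Almost every value is caught eventually, so dominated
    convergence makes the second moment of the missed part small. *)
Lemma quantization (eta : R) : as_separably_valued P0 X ->
  (\int[P0]_w (`|X w| ^+ 2)%:E < +oo)%E -> 0 < eta ->
  exists n (v : 'I_n.+1 -> dual E) (q : dual E -> 'I_n.+1),
    (forall i, measurable (q @^-1` [set i])) /\
    (\int[P0]_w (`|X w - v (q (X w))| ^+ 2)%:E <= eta%:E)%E.
Proof.
move=> [D /countable_injP[f finj] DX] finX eta0.
pose a k : dual E := xget 0 [set x | D x /\ f x = k].
have aP x : D x -> a (f x) = x.
  move=> Dx; apply: xget_unique => // y [Dy fy]; apply: finj => //; exact: mem_set.
pose de := Num.sqrt (eta / 2).
have de0 : 0 < de by rewrite sqrtr_gt0 divr_gt0.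
have de2 : de ^+ 2 = eta / 2 by rewrite sqr_sqrtr// divr_ge0// ltW.
pose B k := [set x : dual E | `|x - a k| < de].
have mB k : measurable (B k).
  rewrite (_ : B k = [set: dual E] `&` ((fun x : dual E => `|x - a k|) @^-1` `]-oo, de[)).
    by apply: (measurable_dual_dist (a k)) => //; exact: measurable_itv.
  by rewrite setTI; apply/seteqP; split => x /=; rewrite in_itv.
pose fi n (x : dual E) := find (fun i => `[< B i x >]) (iota 0 n).
have fin n x : (fi n x < n.+1)%N by rewrite ltnS (leq_trans (find_size _ _))// size_iota.
pose q n (x : dual E) : 'I_n.+1 := Ordinal (fin n x).
(* The last label is represented by 0, so there the error is the full squared norm, as counted by
   [g]. *)
pose v n (i : 'I_n.+1) : dual E := if (i < n)%N then a i else 0.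
have mq n i : measurable (q n @^-1` [set i]).
  rewrite (_ : _ @^-1` _ = [set x | fi n x = i]); first exact: measurable_find.
  apply/seteqP; split => x /= [] //.
    by move=> <-.
  by move=> h; apply: val_inj.
pose g n (x : dual E) := `|x| ^+ 2 * \1_(q n @^-1` [set ord_max]) x.
have g0 n x : 0 <= g n x.
  by apply: mulr_ge0; [exact: sqr_ge0|rewrite indicE].
have vg n x : `|x - v n (q n x)| ^+ 2 <= de ^+ 2 + g n x.
  rewrite /g indicE; case: (ltnP (fi n x) n) => h.
    have Bx : B (fi n x) x.
      have := @nth_find _ 0%N (fun i => `[< B i x >]) (iota 0 n).
      by rewrite has_find size_iota nth_iota// add0n => /(_ h)/asboolP.
    rewrite /v /= h; apply: le_trans (_ : de ^+ 2 <= _).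
      by apply: lerXn2r; rewrite ?nnegrE ?(ltW de0)//; exact: ltW.
    by rewrite lerDl mulr_ge0 ?sqr_ge0.
  have e : q n x = ord_max.
    by apply: val_inj; apply/eqP; rewrite /= eqn_leq h andbT -ltnS.
  rewrite mem_set// mulr1 e /v /= ltnn subr0 lerDr sqr_ge0 //.
have mX : measurable_fun setT (fun w => `|X w| ^+ 2).
  apply: measurable_funX.
  exact: (measurableT_comp (@measurable_dual_norm R E)).
have mg n : measurable_fun setT (fun w => g n (X w)).
  apply: measurable_funM => //.
  have mi : measurable_fun [set: dual E] (\1_(q n @^-1` [set ord_max]) : dual E -> R).
    exact: measurable_indic.
  exact: (measurableT_comp mi).
have int0 : P0.-integrable setT (fun w => (`|X w| ^+ 2)%:E).
  apply/integrableP; split; first exact/measurable_EFinP.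
  apply: le_lt_trans finX; rewrite le_eqVlt; apply/orP; left; apply/eqP.
  by apply: eq_integral => w _; rewrite gee0_abs// lee_fin sqr_ge0.
have cv : {ae P0, forall w, setT w -> ((g n (X w))%:E @[n --> \oo] --> 0)%E}.
  apply: filterS DX => w DXw _; have [b Db bX] := closure_norm DXw de0.
  apply: cvg_near_cst; exists (f b).+1 => // n /= fn.
  rewrite /g indicE memNset ?mulr0// => /(congr1 val) /= h.
  have : has (fun i => `[< B i (X w) >]) (iota 0 n).
    apply/hasP; exists (f b); first by rewrite mem_iota.
    by apply/asboolP; rewrite /B /= aP.
  by rewrite has_find size_iota -/(fi n (X w)) h ltnn.
have bd : {ae P0, forall w n, setT w -> (`|(g n (X w))%:E| <= (`|X w| ^+ 2)%:E)%E}.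
  apply: aeW => w n _; rewrite gee0_abs ?lee_fin// /g indicE.
  by case: (_ \in _); rewrite ?mulr1 ?mulr0 ?sqr_ge0.
have [_ _] := @dominated_convergence _ T0 R P0 setT measurableT
  (fun n w => (g n (X w))%:E) (cst 0%E) (fun w => (`|X w| ^+ 2)%:E)
  (fun n => (measurable_EFinP _ _).2 (mg n)) (measurable_cst _) cv int0 bd.
rewrite integral_cst// mul0e => h.
have [N hN] : exists N, (\int[P0]_w (g N (X w))%:E <= (eta / 2)%:E)%E.
  apply: contrapT => /forallNP nN.
  have := @lime_ge nat \oo _ R (eta / 2)%:E (fun n => \int[P0]_w (g n (X w))%:E)%E.
  rewrite (cvg_lim _ h)// lee_fin => le; have : eta / 2 <= 0.
    by apply: le; [exact: h|apply: nearW => n; rewrite ltW// ltNge; apply/negP/nN]. 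
  by apply/negP; rewrite -ltNge divr_gt0.
exists N, (v N), (q N); split; first exact: mq.
apply: le_trans (_ : \int[P0]_w ((de ^+ 2)%:E + (g N (X w))%:E) <= _)%E.
  apply: ge0_le_lower_integral => w; first by rewrite lee_fin sqr_ge0.
  by rewrite -EFinD lee_fin.
rewrite ge0_integralD//.
- rewrite integral_cst//= probability_setT mule1 de2.
  by rewrite [leRHS](_ : _ = (eta / 2)%:E + (eta / 2)%:E)%E ?leeD2l// -EFinD -splitr.
- by move=> w _; rewrite lee_fin sqr_ge0.
- by move=> w _; rewrite lee_fin.
- by apply/measurable_EFinP.
Qed.

End quantization.

(** * Quantized samples as independent draws from a finite law *)

Section sample.
Local Open Scope ereal_scope.
Variables (R : realType) (E : normedModType R).
Context d0 (T0 : measurableType d0) (P0 : probability T0 R) (X : {RV P0 >-> dual E}).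
Context d (T : measurableType d) (P : probability T R).

Lemma same_law_integral (Y : {RV P >-> dual E}) (h : dual E -> \bar R) :
  same_law (distribution P Y) (distribution P0 X) ->
  measurable_fun setT h -> (forall x, 0 <= h x) ->
  \int[P]_w h (Y w) = \int[P0]_w h (X w).
Proof.
move=> law mh h0.
have := ge0_integral_distribution Y mh h0; rewrite /comp => <-.
have := ge0_integral_distribution X mh h0; rewrite /comp => <-.
by apply: eq_measure_integral => A mA _; exact: law.
Qed.

Variables (m : nat) (Xs : 'I_m -> {RV P >-> dual E}).
Hypothesis indep : mutually_independent Xs.
Hypothesis laws : forall j, same_law (distribution P (Xs j)) (distribution P0 X).
Variables (J : finType) (q : dual E -> J).
Hypothesis mq : forall j, measurable (q @^-1` [set j]).

Definition cell_prob (j : J) : R := fine (P0 (X @^-1` (q @^-1` [set j]))).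

Let mqX j : measurable (X @^-1` (q @^-1` [set j])).
Proof. by rewrite -[X in measurable X]setTI; exact: (measurable_funPT X). Qed.

Let mqXs i j : measurable (Xs i @^-1` (q @^-1` [set j])).
Proof. by rewrite -[X in measurable X]setTI; exact: (measurable_funPT (Xs i)). Qed.

Lemma cell_prob_ge0 j : (0 <= cell_prob j)%R.
Proof. by rewrite fine_ge0. Qed.

Lemma integral_cell_prob (F : J -> R) : (forall j, 0 <= F j)%R ->
  \int[P0]_w (F (q (X w)))%:E = (\sum_j cell_prob j * F j)%:E.
Proof. by move=> F0; rewrite (@integral_finite_valued _ _ _ P0 J (fun w => q (X w)) F). Qed.

Lemma cell_prob_sum1 : (\sum_j cell_prob j = 1)%R.
Proof.
have := @integral_cell_prob (fun=> 1%R) (fun=> ler01).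
rewrite integral_cst//= probability_setT mul1e => e.
have {}e : 1%R = (\sum_j cell_prob j * 1)%R by exact: EFin_inj e.
rewrite [RHS]e; by apply: eq_bigr => j _; rewrite mulr1.
Qed.

Lemma sample_integral (G : seq J -> R) : (forall s, 0 <= G s)%R ->
  \int[P]_w (G [tuple q (Xs i w) | i < m])%:E = (iid cell_prob m G)%:E.
Proof.
move=> G0; pose u w : m.-tuple J := [tuple q (Xs i w) | i < m].
have uE t : u @^-1` [set t] =
    \bigcap_(i in [set` [set: 'I_m]%SET]) Xs i @^-1` (q @^-1` [set tnth t i]).
  apply/seteqP; split => w /=.
    by move=> <- i _ /=; rewrite tnth_mktuple.
  by move=> h; apply: eq_from_tnth => i; rewrite tnth_mktuple h//= inE.
have mu t : measurable (u @^-1` [set t]).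
  rewrite uE; apply: fin_bigcap_measurable => //.
rewrite (@integral_finite_valued _ _ _ P _ u (fun t : m.-tuple J => G t))// iid_tuple.
congr (_%:E); apply: eq_bigr => t _; congr (_ * _)%R.
rewrite uE (indep _ (fun i => mq (tnth t i))).
rewrite (eq_bigr (fun i => (cell_prob (tnth t i))%:E)) => [|i _].
  by rewrite prodEFin /=; apply: eq_bigl => i; rewrite inE.
rewrite /cell_prob fineK ?fin_num_measure//.
exact: (laws i (mq (tnth t i))).
Qed.

End sample.

Lemma sqr_le_split (R : realFieldType) (a b t : R) : 0 < t ->
  (a + b) ^+ 2 <= (1 + t) * a ^+ 2 + (1 + t^-1) * b ^+ 2.
Proof.
move=> t0; have : 0 <= (t * a - b) ^+ 2 / t by rewrite divr_ge0 ?sqr_ge0// ltW.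
rewrite (_ : _ / _ = t * a ^+ 2 + t^-1 * b ^+ 2 - 2 * (a * b)); first by lra.
by field; rewrite gt_eqF.
Qed.

Lemma measurable_bigmax d (T : measurableType d) (R : realType) (I : Type)
    (r : seq I) (F : I -> T -> R) : (forall i, measurable_fun setT (F i)) ->
  measurable_fun setT (fun w => \big[Num.max/0]_(i <- r) F i w).
Proof.
move=> mF; elim: r => [|i r IH].
  by under eq_fun do rewrite big_nil; exact: measurable_cst.
by under eq_fun do rewrite big_cons; exact: measurable_maxr.
Qed.

(** * From finite laws to general laws *)

Section empirical_process.
Local Open Scope ereal_scope.
Variables (R : realType) (E : normedModType R) (lambda : R).
Hypothesis cvxE : modulus_convexity_power2 E lambda.
Hypothesis lambda_ge1 : (1 <= lambda)%R.
Context d0 (T0 : measurableType d0) (P0 : probability T0 R) (X : {RV P0 >-> dual E}).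
Context d (T : measurableType d) (P : probability T R).
Variables (m L : nat) (Xs : 'I_m -> {RV P >-> dual E}).
Hypotheses (m_gt0 : (0 < m)%N) (L_gt0 : (0 < L)%N) (mL : (m <= 2 ^ L)%N).
Hypothesis separable : as_separably_valued P0 X.
Hypothesis indep : mutually_independent Xs.
Hypothesis laws : forall j, same_law (distribution P (Xs j)) (distribution P0 X).
Variables (M2 sigma2 : R).
Hypothesis maxM2 : \int[P]_w (\big[Num.max/0]_(j < m) (`|Xs j w| ^+ 2))%:E <= M2%:E.
Hypothesis varX : forall y, unit_ball E y -> \int[P0]_w (`|X w y| ^+ 2)%:E <= sigma2%:E.

Let norm_sq_measurable : measurable_fun setT (fun x : dual E => (`|x| ^+ 2)%:E).
Proof. by apply/measurable_EFinP; apply: measurable_funX; exact: measurable_dual_norm. Qed.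

Let eval_sq_measurable y : measurable_fun setT (fun x : dual E => (`|x y| ^+ 2)%:E).
Proof.
apply/measurable_EFinP; apply: measurable_funX.
exact: (measurableT_comp (@normr_measurable R setT) (@measurable_dual_eval R E y)).
Qed.

Let rv_measurable d' (T' : measurableType d') (P' : probability T' R)
  (Y : {RV P' >-> dual E}) (h : dual E -> \bar R) :
  measurable_fun setT h -> measurable_fun setT (fun w => h (Y w)).
Proof. by move=> mh; exact: (measurableT_comp mh). Qed.

Lemma norm_sq_le : \int[P0]_w (`|X w| ^+ 2)%:E <= M2%:E.
Proof.
rewrite -(same_law_integral (laws (Ordinal m_gt0)) norm_sq_measurable) => [|x]; last first.
  by rewrite lee_fin sqr_ge0.
apply: le_trans maxM2; apply: ge0_le_lower_integral => w; first by rewrite lee_fin sqr_ge0.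
by rewrite lee_fin; apply: (@le_bigmax _ R _ 0%R (fun j => `|Xs j w| ^+ 2)%R).
Qed.

Lemma M2_ge0 : (0 <= M2)%R.
Proof.
rewrite -lee_fin; apply: le_trans norm_sq_le; apply: integral_ge0 => w _.
by rewrite lee_fin sqr_ge0.
Qed.

Let LHS := \int[P]_w ereal_sup
  [set `|(m%:R^-1 * \sum_(j < m) `|Xs j w y| ^+ 2)%R%:E
         - 'E_P0[fun w0 => (`|X w0 y| ^+ 2)%R]| | y in unit_ball E].

(** [X] is quantized with squared error t^2. Young's inequality with weights t and 1 / t charges at
    most (1 + 1/t) t^2 <= 2 t for it, so every perturbation is O(t). *)
Lemma approximate_deviation_bound (t a : R) : (0 < t)%R -> (t <= 1)%R ->
  a = (2 * (2 ^+ 11 * (2 ^+ 10 * lambda ^+ 3)) * Num.sqrt (L%:R / m%:R) *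
        Num.sqrt (M2 + t * (M2 + 2 * m%:R)))%R ->
  LHS <= (a ^+ 2 + a * Num.sqrt (sigma2 + t * (sigma2 + 2)) + 2 * (t * (M2 + 2)))%:E.
Proof.
move=> t0 t1 aE.
have tV : (t^-1 * t ^+ 2 = t)%R by rewrite expr2 mulKf// gt_eqF.
have t20 : (0 < t ^+ 2)%R by rewrite exprn_gt0.
have tt : (t ^+ 2 <= t)%R by rewrite expr2 ger_pMr.
have ht : ((1 + t^-1) * t ^+ 2 <= 2 * t)%R by rewrite mulrDl tV; lra.
have ht0 : (0 <= (1 + t^-1))%R by rewrite addr_ge0// invr_ge0 ltW.
have [n [v [q [mq gX]]]] :=
  quantization separable (le_lt_trans norm_sq_le (ltry _)) t20.
pose J : finType := 'I_n.+1.
pose p : J -> R := cell_prob X q.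
have p0 : forall j, (0 <= p j)%R by move=> j; exact: cell_prob_ge0.
have p1 : (\sum_j p j = 1)%R by exact: cell_prob_sum1.
pose g (x : dual E) : R := (`|x - v (q x)| ^+ 2)%R.
have g0 x : (0 <= g x)%R by exact: sqr_ge0.
have mg : measurable_fun setT (fun x => (g x)%:E).
  apply/measurable_EFinP.
  apply: (@measurable_finite_case _ (dual E) R J q (fun j x => `|x - v j| ^+ 2)%R mq) => j.
  by apply: measurable_funX; exact: measurable_dual_dist.
(* Bounds the change of the squared evaluation under quantization uniformly over the unit ball, so
   it leaves the supremum and can be integrated. *)
pose h (x : dual E) : R := (t * `|x| ^+ 2 + (1 + t^-1) * g x)%R.
have h0 x : (0 <= h x)%R.
  by rewrite addr_ge0 ?mulr_ge0 ?sqr_ge0// ltW.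
have mh : measurable_fun setT (fun x => (h x)%:E).
  apply/measurable_EFinP; apply: measurable_funD; apply: measurable_funM => //.
  - exact/measurable_EFinP.
  - exact/measurable_EFinP.
have hX : \int[P0]_w (h (X w))%:E <= (t * (M2 + 2))%:E.
  under eq_integral do rewrite /h EFinD (EFinM t) (EFinM (1 + t^-1)).
  rewrite ge0_integralD//.
  - rewrite !ge0_integralZl//.
    + rewrite mulrDr [leRHS]EFinD; apply: leeD.
        by rewrite EFinM lee_wpmul2l ?lee_fin ?(ltW t0)// norm_sq_le.
      apply: le_trans (_ : (1 + t^-1)%:E * (t ^+ 2)%:E <= _).
        by rewrite lee_wpmul2l ?lee_fin.
      by rewrite -EFinM lee_fin (mulrC t 2%R).
    + exact: (rv_measurable X mg).
    + by move=> w _; rewrite lee_fin.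
    + exact: (rv_measurable X norm_sq_measurable).
    + by rewrite lee_fin ltW.
  - by move=> w _; rewrite -EFinM lee_fin mulr_ge0 ?sqr_ge0// ltW.
  - by apply: measurable_funeM; exact: (rv_measurable X norm_sq_measurable).
  - by move=> w _; rewrite -EFinM lee_fin mulr_ge0.
  - by apply: measurable_funeM; exact: (rv_measurable X mg).
have [H HE] : exists H : R, \int[P0]_w (h (X w))%:E = H%:E.
  exists (fine (\int[P0]_w (h (X w))%:E)); rewrite fineK// ge0_fin_numE.
    by apply: le_lt_trans hX (ltry _).
  by apply: integral_ge0 => w _; rewrite lee_fin.
rewrite HE lee_fin in hX.
have diff (x : dual E) (y : E) : unit_ball E y -> (`| `|x y| ^+ 2 - `|v (q x) y| ^+ 2| <= h x)%R.
  move=> y1; rewrite !real_normK ?num_real// subr_sqr normrM.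
  set r := `|x - v (q x)|%R.
  have h1 : (`|x y - v (q x) y| <= r)%R.
    by apply: le_trans (_ : `|(x - v (q x)) y| <= _)%R => //; exact: dual_norm_ub.
  have h2 : (`|x y + v (q x) y| <= 2 * `|x| + r)%R.
    rewrite (_ : x y + v (q x) y = 2 * x y - (x y - v (q x) y))%R; last by ring.
    apply: le_trans (ler_normB _ _) _; rewrite lerD// normrM ger0_norm// ler_wpM2l//.
    exact: dual_norm_ub.
  apply: le_trans (ler_pM _ _ h1 h2) _ => //.
  have : (0 <= (t * `|x| - r) ^+ 2 / t)%R by rewrite divr_ge0 ?sqr_ge0// ltW.
  rewrite (_ : _ / _ = t * `|x| ^+ 2 + t^-1 * r ^+ 2 - 2 * (`|x| * r))%R; last first.
    by field; rewrite gt_eqF.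
  by rewrite /h /g -/r; lra.
pose s y := fine (\int[P0]_w (`|X w y| ^+ 2)%:E).
have sE y : unit_ball E y -> \int[P0]_w (`|X w y| ^+ 2)%:E = (s y)%:E.
  move=> y1; rewrite fineK// ge0_fin_numE; first by apply: le_lt_trans (varX y1) (ltry _).
  by apply: integral_ge0 => w _; rewrite lee_fin sqr_ge0.
have EE y : unit_ball E y -> 'E_P0[fun w0 => (`|X w0 y| ^+ 2)%R] = (s y)%:E.
  by move=> y1; rewrite unlock sE.
have qsum y : \int[P0]_w (`|v (q (X w)) y| ^+ 2)%:E = (\sum_j p j * `|v j y| ^+ 2)%:E.
  by rewrite (@integral_cell_prob _ _ _ _ _ _ J q mq (fun j => `|v j y| ^+ 2)%R) => [|j]; rewrite ?sqr_ge0.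
have mvq y : measurable_fun setT (fun x : dual E => (`|v (q x) y| ^+ 2)%:E).
  apply/measurable_EFinP.
  by apply: (@measurable_finite_case _ (dual E) R J q (fun j x => `|v j y| ^+ 2)%R mq) => j.
have s_close y : unit_ball E y -> (`|s y - \sum_j p j * `|v j y| ^+ 2| <= H)%R.
  move=> y1.
  have le1 : \int[P0]_w (`|X w y| ^+ 2)%:E <=
      \int[P0]_w (`|v (q (X w)) y| ^+ 2)%:E + \int[P0]_w (h (X w))%:E.
    rewrite -ge0_integralD//.
    - apply: ge0_le_lower_integral => w; first by rewrite lee_fin sqr_ge0.
      rewrite -EFinD lee_fin -lerBlDl; apply: le_trans (ler_norm _) _; exact: diff.
    - exact: (rv_measurable X (mvq y)).
    - by move=> w _; rewrite lee_fin.
    - exact: (rv_measurable X mh).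
  have le2 : \int[P0]_w (`|v (q (X w)) y| ^+ 2)%:E <=
      \int[P0]_w (`|X w y| ^+ 2)%:E + \int[P0]_w (h (X w))%:E.
    rewrite -ge0_integralD//.
    - apply: ge0_le_lower_integral => w; first by rewrite lee_fin sqr_ge0.
      rewrite -EFinD lee_fin -lerBlDl; apply: le_trans (ler_norm _) _.
      by rewrite distrC; exact: diff.
    - exact: (rv_measurable X (eval_sq_measurable y)).
    - by move=> w _; rewrite lee_fin.
    - exact: (rv_measurable X mh).
  rewrite qsum HE (sE _ y1) -EFinD !lee_fin in le1 le2.
  by rewrite ler_norml; apply/andP; split; lra.
pose u w : m.-tuple J := [tuple q (Xs i w) | i < m].
have sumu w (F : J -> R) : (\sum_(j <- u w) F j = \sum_(i < m) F (q (Xs i w)))%R.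
  by rewrite big_tuple; apply: eq_bigr => i _; rewrite tnth_mktuple.
have mR : (0 < m%:R :> R)%R by rewrite ltr0n.
have sup_le w : ereal_sup [set `|(m%:R^-1 * \sum_(j < m) `|Xs j w y| ^+ 2)%R%:E
         - 'E_P0[fun w0 => (`|X w0 y| ^+ 2)%R]| | y in unit_ball E] <=
    (sup_deviation p v m (u w))%:E + ((m%:R^-1 * \sum_(i < m) h (Xs i w))%R%:E + H%:E).
  apply: ge_ereal_sup => _ [y y1 <-]; rewrite EE//.
  rewrite -EFinB -!EFinD lee_fin.
  have := @le_sup_deviation R E J p v m p0 (u w) y y1; rewrite /deviation sumu.
  have := s_close _ y1.
  rewrite (eq_bigr (fun j => p j * v j y ^+ 2)%R) => [|j _]; last by rewrite real_normK ?num_real.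
  set A := (\sum_j _)%R; set B := (\sum_(i < m) v _ y ^+ 2)%R; set C := (\sum_(j < m) _)%R => h1 h2.
  have h3 : (`|C - B| <= \sum_(i < m) h (Xs i w))%R.
    rewrite -sumrB; apply: le_trans (ler_norm_sum _ _ _) _; apply: ler_sum => i _.
    by rewrite -[X in (_ - X)%R]real_normK ?num_real//; exact: diff.
  rewrite (_ : m%:R^-1 * C - s y = (m%:R^-1 * B - A) + (m%:R^-1 * (C - B) + (A - s y)))%R; last by ring.
  apply: le_trans (ler_normD _ _) _; rewrite lerD//.
  apply: le_trans (ler_normD _ _) _; rewrite lerD//; last by rewrite distrC.
  have mV : (0 <= m%:R^-1 :> R)%R by rewrite invr_ge0 ltW.
  by rewrite normrM (ger0_norm mV) ler_wpM2l.
have hXs i : \int[P]_w (h (Xs i w))%:E = H%:E.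
  by rewrite -HE; apply: (same_law_integral (laws i) mh) => x; rewrite lee_fin.
have mu (G : seq J -> R) : measurable_fun setT (fun w => (G (u w))%:E).
  apply/measurable_EFinP.
  apply: (@measurable_finite_case _ T R (m.-tuple J) u (fun t _ => G t)) => // tt'.
  rewrite (_ : u @^-1` [set tt'] =
    \bigcap_(i in [set` [set: 'I_m]%SET]) Xs i @^-1` (q @^-1` [set tnth tt' i])).
    apply: fin_bigcap_measurable => // i _.
    by rewrite -[X in measurable X]setTI; exact: (measurable_funPT (Xs i)).
  apply/seteqP; split => w /=.
    by move=> <- i _ /=; rewrite tnth_mktuple.
  by move=> hh; apply: eq_from_tnth => i; rewrite tnth_mktuple hh//= inE.
have sup0 := @sup_deviation_ge0 R E J p v m p0.
have step : LHS <= (iid p m (sup_deviation p v m) + 2 * H)%:E.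
  apply: le_trans (ge0_le_lower_integral _ _ sup_le) _.
    have b0 : unit_ball E (0 : E)%R by rewrite /unit_ball /= normr0.
    by move=> w; apply: le_trans (abse_ge0 _) (ereal_sup_ubound _); exists (0 : E)%R.
  have H0 : (0 <= H)%R by rewrite -lee_fin -HE; apply: integral_ge0 => w _; rewrite lee_fin.
  have hs0 w : (0 <= m%:R^-1 * \sum_(i < m) h (Xs i w))%R.
    by rewrite mulr_ge0 ?invr_ge0 ?(ltW mR)// sumr_ge0.
  have mhs : measurable_fun setT (fun w => (m%:R^-1 * \sum_(i < m) h (Xs i w))%:E).
    apply/measurable_EFinP; apply: measurable_funM => //; apply: measurable_sum => i.
    by apply/measurable_EFinP; exact: (rv_measurable (Xs i) mh).
  rewrite ge0_integralD//.
  - rewrite (@sample_integral _ _ _ _ _ _ _ _ _ _ _ indep laws J q mq _ sup0).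
    rewrite EFinD; apply: leeD => //; rewrite ge0_integralD//.
    + rewrite integral_cst//= probability_setT mule1.
      under eq_integral do rewrite EFinM -sumEFin.
      rewrite ge0_integralZl//.
      * rewrite ge0_integral_sum//.
          rewrite (eq_bigr (fun=> H%:E)) => [|i _]; last exact: hXs.
          rewrite sumEFin sumr_const card_ord -EFinM -EFinD lee_fin -[(H *+ m)%R]mulr_natr.
          by rewrite mulrCA mulVf ?gt_eqF//; lra.
        by move=> i; exact: (rv_measurable (Xs i) mh).
        by move=> i w _; rewrite lee_fin.
      * by apply: emeasurable_sum => i; exact: (rv_measurable (Xs i) mh).
      * by move=> w _; apply: sume_ge0 => i _; rewrite lee_fin.
    + by move=> w _; rewrite lee_fin.
  - by move=> w _; rewrite lee_fin.
  - by move=> w _; rewrite -EFinD lee_fin addr_ge0.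
  - by apply: emeasurable_funD.
apply: le_trans step _; rewrite lee_fin lerD//; last by rewrite ler_pM2l.
have max0 := @max_normsq_ge0 R E J v.
have maxle : (iid p m (max_normsq v) <= M2 + t * (M2 + 2 * m%:R))%R.
  rewrite -lee_fin -(@sample_integral _ _ _ _ _ _ _ _ _ _ _ indep laws J q mq _ max0).
  pose mx w := (\big[Num.max/0]_(j < m) (`|Xs j w| ^+ 2))%R.
  have mx0 w : (0 <= mx w)%R.
    by rewrite /mx; elim/big_rec : _ => // i z _ z0; rewrite le_max sqr_ge0.
  have mmx : measurable_fun setT (fun w => (mx w)%:E).
    apply/measurable_EFinP; apply: measurable_bigmax => i.
    by apply/measurable_EFinP; exact: (rv_measurable (Xs i) norm_sq_measurable).
  have gXs i : \int[P]_w (g (Xs i w))%:E <= (t ^+ 2)%:E.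
    by rewrite (same_law_integral (laws i) mg)// => x; rewrite lee_fin.
  apply: le_trans (_ : \int[P]_w ((1 + t)%:E * (mx w)%:E +
      (1 + t^-1)%:E * \sum_(i < m) (g (Xs i w))%:E) <= _).
    apply: ge0_le_lower_integral => w; first by rewrite lee_fin.
    rewrite sumEFin -!EFinM -EFinD lee_fin.
    have gs0 : (0 <= \sum_(i < m) g (Xs i w))%R by exact: sumr_ge0.
    rewrite /max_normsq big_tuple; apply: bigmax_le => [|i _].
      by rewrite addr_ge0// mulr_ge0// addr_ge0// ltW.
    rewrite tnth_mktuple; apply: le_trans (_ : (`|Xs i w| + `|Xs i w - v (q (Xs i w))|) ^+ 2 <= _)%R.
      apply: lerXn2r; rewrite ?nnegrE ?addr_ge0//.
      by rewrite -[X in (`|X| <= _)%R](subKr (Xs i w)); exact: ler_normB.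
    apply: le_trans (sqr_le_split _ _ t0) _; apply: lerD.
      rewrite ler_wpM2l ?addr_ge0 ?(ltW t0)//.
      exact: (@le_bigmax _ R _ 0%R (fun j => `|Xs j w| ^+ 2)%R).
    rewrite ler_wpM2l//; rewrite (bigD1 i)//= lerDl; exact: sumr_ge0.
  have mgs : measurable_fun setT (fun w => \sum_(i < m) (g (Xs i w))%:E).
    by apply: emeasurable_sum => i; exact: (rv_measurable (Xs i) mg).
  rewrite ge0_integralD//.
  - rewrite !ge0_integralZl//.
    + rewrite ge0_integral_sum//.
        apply: le_trans (_ : (1 + t)%:E * M2%:E + (1 + t^-1)%:E * (t ^+ 2 *+ m)%:E <= _).
          apply: leeD; first by rewrite lee_wpmul2l ?lee_fin ?addr_ge0 ?(ltW t0).
          rewrite lee_wpmul2l ?lee_fin//.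
          have -> : (t ^+ 2 *+ m)%:E = \sum_(i < m) (t ^+ 2)%:E.
            by rewrite sumEFin sumr_const card_ord.
          by apply: lee_sum => i _; exact: gXs.
        rewrite -!EFinM -EFinD lee_fin -[(_ *+ m)%R]mulr_natr mulrA.
        by have := ler_wpM2r (ltW mR) ht; lra.
      by move=> i; exact: (rv_measurable (Xs i) mg).
      by move=> i w _; rewrite lee_fin.
    + by move=> w _; apply: sume_ge0 => i _; rewrite lee_fin.
    + by move=> w _; rewrite lee_fin.
    + by rewrite lee_fin addr_ge0// ltW.
  - by move=> w _; rewrite -EFinM lee_fin mulr_ge0// addr_ge0// ltW.
  - exact: measurable_funeM.
  - by move=> w _; rewrite mule_ge0 ?lee_fin//; apply: sume_ge0 => i _; rewrite lee_fin.
  - exact: measurable_funeM.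
have s2le y : unit_ball E y -> (\sum_j p j * v j y ^+ 2 <= sigma2 + t * (sigma2 + 2))%R.
  move=> y1; rewrite (eq_bigr (fun j => p j * `|v j y| ^+ 2)%R) => [|j _]; last first.
    by rewrite real_normK ?num_real.
  rewrite -lee_fin -qsum.
  apply: le_trans (_ : \int[P0]_w ((1 + t)%:E * (`|X w y| ^+ 2)%:E +
      (1 + t^-1)%:E * (g (X w))%:E) <= _).
    apply: ge0_le_lower_integral => w; first by rewrite lee_fin sqr_ge0.
    rewrite -!EFinM -EFinD lee_fin.
    apply: le_trans (_ : (`|X w y| + `|X w - v (q (X w))|) ^+ 2 <= _)%R; last exact: sqr_le_split.
    apply: lerXn2r; rewrite ?nnegrE ?addr_ge0//.
    rewrite -[X in (`|X| <= _)%R](subKr (X w y)); apply: le_trans (ler_normB _ _) _.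
    rewrite lerD//; apply: le_trans (_ : `|(X w - v (q (X w))) y| <= _)%R => //.
    exact: dual_norm_ub.
  rewrite ge0_integralD//.
  - rewrite !ge0_integralZl//.
    + apply: le_trans (_ : (1 + t)%:E * sigma2%:E + (1 + t^-1)%:E * (t ^+ 2)%:E <= _).
        apply: leeD; last by rewrite lee_wpmul2l ?lee_fin.
        by rewrite lee_wpmul2l ?lee_fin ?addr_ge0 ?(ltW t0)//; exact: varX.
      by rewrite -!EFinM -EFinD lee_fin; lra.
    + exact: (rv_measurable X mg).
    + by move=> w _; rewrite lee_fin.
    + exact: (rv_measurable X (eval_sq_measurable y)).
    + by rewrite lee_fin addr_ge0// ltW.
  - by move=> w _; rewrite -EFinM lee_fin mulr_ge0 ?sqr_ge0// addr_ge0// ltW.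
  - by apply: measurable_funeM; exact: (rv_measurable X (eval_sq_measurable y)).
  - by move=> w _; rewrite -EFinM lee_fin mulr_ge0.
  - by apply: measurable_funeM; exact: (rv_measurable X mg).
have bound := finite_law_bound cvxE lambda_ge1 p0 p1 m_gt0 L_gt0 mL s2le erefl.
apply: le_trans bound _; set b := (_ * _ * Num.sqrt (iid _ _ _))%R.
have K0 : (0 <= 2 * (2 ^+ 11 * (2 ^+ 10 * lambda ^+ 3)) * Num.sqrt (L%:R / m%:R))%R.
  have l0 : (0 <= lambda)%R by apply: le_trans lambda_ge1.
  by rewrite mulr_ge0 ?sqrtr_ge0// mulr_ge0// mulr_ge0 ?exprn_ge0// mulr_ge0 ?exprn_ge0.
have ba : (b <= a)%R by rewrite aE /b ler_wpM2l// ler_wsqrtr.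
have b0 : (0 <= b)%R by rewrite /b mulr_ge0// sqrtr_ge0.
rewrite lerD ?ler_wpM2r ?sqrtr_ge0//.
by apply: lerXn2r; rewrite ?nnegrE// (le_trans b0 ba).
Qed.

End empirical_process.

(** * The deviation bound *)

Section deviation_bound.
Local Open Scope ereal_scope.
Variables (R : realType) (E : normedModType R) (lambda : R).
Hypothesis cvxE : modulus_convexity_power2 E lambda.
Hypothesis lambda_ge1 : (1 <= lambda)%R.
Context d0 (T0 : measurableType d0) (P0 : probability T0 R) (X : {RV P0 >-> dual E}).
Context d (T : measurableType d) (P : probability T R).
Variables (m L : nat) (Xs : 'I_m -> {RV P >-> dual E}).
Hypotheses (m_gt0 : (0 < m)%N) (L_gt0 : (0 < L)%N) (mL : (m <= 2 ^ L)%N).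
Hypothesis separable : as_separably_valued P0 X.
Hypothesis indep : mutually_independent Xs.
Hypothesis laws : forall j, same_law (distribution P (Xs j)) (distribution P0 X).
Variables (M2 sigma2 : R).
Hypothesis maxM2 : \int[P]_w (\big[Num.max/0]_(j < m) (`|Xs j w| ^+ 2))%:E <= M2%:E.
Hypothesis sigma2_ge0 : (0 <= sigma2)%R.
Hypothesis varX : forall y, unit_ball E y -> \int[P0]_w (`|X w y| ^+ 2)%:E <= sigma2%:E.

Lemma deviation_bound (a : R) :
  a = (2 * (2 ^+ 11 * (2 ^+ 10 * lambda ^+ 3)) * Num.sqrt (L%:R / m%:R) * Num.sqrt M2)%R ->
  \int[P]_w ereal_sup
    [set `|(m%:R^-1 * \sum_(j < m) `|Xs j w y| ^+ 2)%R%:E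
           - 'E_P0[fun w0 => (`|X w0 y| ^+ 2)%R]| | y in unit_ball E]
  <= (a ^+ 2 + a * Num.sqrt sigma2)%:E.
Proof.
move=> aE; set I := \int[P]_w _.
have M20 : (0 <= M2)%R := M2_ge0 m_gt0 laws maxM2.
set K : R := (2 * (2 ^+ 11 * (2 ^+ 10 * lambda ^+ 3)) * Num.sqrt (L%:R / m%:R))%R in aE.
have K0 : (0 <= K)%R.
  have l0 : (0 <= lambda)%R by apply: le_trans lambda_ge1.
  by rewrite mulr_ge0 ?sqrtr_ge0// mulr_ge0// mulr_ge0 ?exprn_ge0// mulr_ge0 ?exprn_ge0.
pose c1 := Num.sqrt (M2 + 2 * m%:R); pose c2 := Num.sqrt (sigma2 + 2).
pose u := Num.sqrt M2; pose s := Num.sqrt sigma2.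
have c10 : (0 <= c1)%R by exact: sqrtr_ge0.
have c20 : (0 <= c2)%R by exact: sqrtr_ge0.
have u0 : (0 <= u)%R by exact: sqrtr_ge0.
have s0 : (0 <= s)%R by exact: sqrtr_ge0.
have a0 : (0 <= a)%R by rewrite aE mulr_ge0.
have sqrtD (x y e : R) : (0 <= x)%R -> (0 <= y)%R -> (0 <= e)%R ->
    (Num.sqrt (x + e ^+ 2 * y) <= Num.sqrt x + Num.sqrt y * e)%R.
  move=> x0 y0 e0.
  have sx := sqrtr_ge0 x; have sy := sqrtr_ge0 y.
  rewrite -[leRHS]ger0_norm ?addr_ge0 ?mulr_ge0// -sqrtr_sqr ler_wsqrtr//.
  rewrite sqrrD exprMn !sqr_sqrtr// (mulrC y) lerD2r lerDl.
  by rewrite mulrn_wge0// !mulr_ge0.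
pose k := (K * c1)%R; have k0 : (0 <= k)%R by rewrite mulr_ge0.
pose D := (2 * a * k + k ^+ 2 + a * c2 + k * s + k * c2 + 2 * (M2 + 2))%R.
(* Taking t = e^2 makes the perturbed square roots differ by O(e). *)
have bound e : (0 < e)%R -> (e <= 1)%R -> I <= (a ^+ 2 + a * s + D * e)%:E.
  move=> e0 e1; have t0 : (0 < e ^+ 2)%R by rewrite exprn_gt0.
  have t1 : (e ^+ 2 <= 1)%R by rewrite exprn_ile1// ltW.
  have := approximate_deviation_bound cvxE lambda_ge1 m_gt0 L_gt0 mL separable indep laws
    maxM2 varX t0 t1 erefl.
  move/le_trans; apply; rewrite lee_fin -/K.
  have h1 : (K * Num.sqrt (M2 + e ^+ 2 * (M2 + 2 * m%:R)) <= a + k * e)%R.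
    rewrite aE /k -mulrA -mulrDr ler_wpM2l// sqrtD ?(ltW e0)//.
    by rewrite addr_ge0// mulr_ge0.
  have h2 : (Num.sqrt (sigma2 + e ^+ 2 * (sigma2 + 2)) <= s + c2 * e)%R.
    by rewrite sqrtD ?(ltW e0)// addr_ge0.
  have b0 : (0 <= K * Num.sqrt (M2 + e ^+ 2 * (M2 + 2 * m%:R)))%R.
    by rewrite mulr_ge0 ?sqrtr_ge0.
  have q0 : (0 <= Num.sqrt (sigma2 + e ^+ 2 * (sigma2 + 2)))%R by exact: sqrtr_ge0.
  set b := (K * Num.sqrt _)%R in h1 b0 *; set q := Num.sqrt _ in h2 q0 *.
  clearbody b q.
  have e2 : (e ^+ 2 <= e)%R by rewrite expr2 ger_pMr.
  apply: le_trans (_ : (a + k * e) ^+ 2 + (a + k * e) * (s + c2 * e) + 2 * (e ^+ 2 * (M2 + 2)) <= _)%R.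
    rewrite lerD2r lerD//; first by apply: lerXn2r; rewrite ?nnegrE// (le_trans b0).
    exact: ler_pM.
  have h3 : (k ^+ 2 * e ^+ 2 <= k ^+ 2 * e)%R by apply: ler_wpM2l => //; exact: exprn_ge0.
  have h4 : (k * c2 * e ^+ 2 <= k * c2 * e)%R by apply: ler_wpM2l => //; exact: mulr_ge0.
  have h5 : ((M2 + 2) * e ^+ 2 <= (M2 + 2) * e)%R by apply: ler_wpM2l => //; exact: addr_ge0.
  rewrite /D.
  rewrite [leLHS](_ : _ = a ^+ 2 + a * s + (2 * a * k + a * c2 + k * s) * e +
    (k ^+ 2 * e ^+ 2 + k * c2 * e ^+ 2 + 2 * ((M2 + 2) * e ^+ 2)))%R; last by ring.
  by lra.
have D0 : (0 <= D)%R.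
  rewrite /D; apply: addr_ge0; last by rewrite mulr_ge0// addr_ge0.
  do 4 (apply: addr_ge0; last by [exact: mulr_ge0|exact: exprn_ge0]).
  by rewrite mulr_ge0// mulr_ge0.
case: I bound => [r| |] bound.
- rewrite lee_fin; apply: (le_of_le_eps D0) => e e0 e1.
  by rewrite -lee_fin; exact: bound.
- by have := bound 1%R ltr01 (lexx _).
- by rewrite leNye.
Qed.

End deviation_bound.

Lemma ln2_ge (R : realType) : 2^-1 <= ln 2 :> R.
Proof.
rewrite -[leLHS]expRK ler_ln ?posrE ?expR_gt0//.
rewrite -[expR _]invrK -expRN -[leRHS]invrK lef_pV2 ?posrE ?expR_gt0//.
by apply: le_trans (expR_ge1Dx _); lra.
Qed.

Lemma trunc_log_le_ln (R : realType) (m : nat) : (1 < m)%N ->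
  (trunc_log 2 m).+1%:R <= 4 * ln m%:R :> R.
Proof.
move=> m1; have m0 : (0 < m)%N by apply: ltn_trans m1.
have l2 := ln2_ge R.
have lm : ln 2 <= ln m%:R :> R by rewrite ler_ln ?posrE ?ltr0n// ler_nat.
have : (trunc_log 2 m)%:R * ln 2 <= ln m%:R :> R.
  rewrite mulr_natl -lnXn// ler_ln ?posrE ?exprn_gt0 ?ltr0n//.
  by rewrite -natrX ler_nat trunc_logP.
have : (trunc_log 2 m)%:R * 2^-1 <= (trunc_log 2 m)%:R * ln 2 :> R by rewrite ler_wpM2l.
move=> h1 h2; rewrite -(natr1 (trunc_log 2 m)).
by lra.
Qed.

(** Test the convexity inequality on [y] and [- y]. *)
Lemma convexity_constant_ge1 (R : realType) (E : normedModType R) (lambda : R) (y : E) :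
  modulus_convexity_power2 E lambda -> y != 0 -> 1 <= lambda.
Proof.
move=> [l0 cvxE] y0; have := cvxE y (- y).
rewrite subrr scaler0 normr0 expr0n add0r opprK normrN -mulr2n -[y *+ 2]scaler_nat scalerA.
rewrite mulVf ?pnatr_eq0// scale1r.
have yy : 0 < `|y| ^+ 2 by rewrite exprn_gt0// normr_gt0.
rewrite (_ : 2^-1 * _ = 1 * `|y| ^+ 2); last by field.
rewrite ler_pM2r// invf_le1 ?exprn_gt0// => h.
by rewrite leNgt; apply/negP => l1; move: h; apply/negP; rewrite -ltNge exprn_ilt1// ltW.
Qed.

Local Open Scope ereal_scope.

Theorem theorem2 (R : realType) :
  exists2 C : R, (0 < C)%R &
  forall (E : completeNormedModType R) (lambda : R)
    (d0 : measure_display) (T0 : measurableType d0) (P0 : probability T0 R)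
    (X : {RV P0 >-> dual E})
    (d : measure_display) (T : measurableType d) (P : probability T R)
    (m : nat) (Xs : 'I_m -> {RV P >-> dual E}),
    modulus_convexity_power2 E lambda ->
    as_separably_valued P0 X ->
    (1 < m)%N ->
    mutually_independent Xs ->
    (forall j, same_law (distribution P (Xs j)) (distribution P0 X)) ->
    let A := C%:E * (lambda ^+ 4)%:E * type2_constant (dual E) *
      (Num.sqrt (ln m%:R / m%:R))%:E *
      sqrte 'E_P[fun w => (\big[Num.max/0]_(j < m) (`|Xs j w| ^+ 2))%R] in
    let sigma := sqrte (ereal_sup
      [set 'E_P0[fun w => (`|X w y| ^+ 2)%R] | y in unit_ball E]) in
    \int[P]_w ereal_sup
      [set `|(m%:R^-1 * \sum_(j < m) `|Xs j w y| ^+ 2)%R%:E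
             - 'E_P0[fun w0 => (`|X w0 y| ^+ 2)%R]| | y in unit_ball E]
    <= A ^+ 2 + sigma * A.
Proof.
have [c0 c00 T2_ge] := type2_constant_ge R.
(* 2 * 2^11 * 2^10 comes from [deviation_bound], one more 2 from L <= 4 ln m under the root, and
   [c0] is given back by the type 2 constant. *)
exists (2 ^+ 23 / c0)%R; first by rewrite divr_gt0 ?exprn_gt0.
set C : R := (2 ^+ 23 / c0)%R.
have C0 : (0 < C)%R by rewrite divr_gt0 ?exprn_gt0.
move=> E lambda d0 T0 P0 X d T P m Xs cvxE sepX m1 indep laws.
cbv zeta; set A := (_ * sqrte _); set sigma := sqrte (ereal_sup _).
have l0 : (0 < lambda)%R by case: cvxE.
have m0 : (0 < m)%N by apply: ltn_trans m1.
have mR : (0 < m%:R :> R)%R by rewrite ltr0n.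
have lm : (0 < ln m%:R :> R)%R.
  by apply: lt_le_trans (_ : 0 < ln 2)%R _; [exact: lt_le_trans (ln2_ge R)|
    rewrite ler_ln ?posrE// ler_nat].
set M := 'E_P[_] in A *.
have M0 : 0 <= M.
  rewrite /M; apply: expectation_ge0 => w.
  by elim/big_rec : _ => // i z _ z0; rewrite le_max z0 orbT.
have sigma0 : 0 <= sigma by exact: sqrte_ge0.
have q0 : (0 < Num.sqrt (ln m%:R / m%:R) :> R)%R by rewrite sqrtr_gt0 divr_gt0.
have T2_0 : 0 <= type2_constant (dual E).
  by apply: le_ereal_inf_tmp => _ [c [c_ge0 _] <-]; rewrite lee_fin.
have A0 : 0 <= A.
  rewrite /A; apply: mule_ge0; last exact: sqrte_ge0.
  apply: mule_ge0; last by rewrite lee_fin ltW.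
  apply: mule_ge0 => //; apply: mule_ge0; first by rewrite lee_fin ltW.
  by rewrite lee_fin exprn_ge0// ltW.
have RHS0 : 0 <= A ^+ 2 + sigma * A by rewrite expe2; apply: adde_ge0; exact: mule_ge0.
(* If the dual is trivial, the lower bound on its type 2 constant does not apply, but the left side
   is 0. *)
have [[f f0]|triv] := pselect (exists f : dual E, f != 0%R); last first.
  have all0 (f : dual E) (y : E) : f y = 0%R.
    have [->//|f0] := eqVneq f 0%R.
    by exfalso; apply: triv; exists f.
  apply: le_trans RHS0; rewrite (_ : (fun w => _) = cst 0) ?integral_cst ?mul0e//.
  apply/funext => w; apply/eqP; rewrite eq_le; apply/andP; split.
    apply: ge_ereal_sup => _ [y _ <-].
    rewrite big1 => [|j _]; last by rewrite all0 normr0 expr0n.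
    rewrite (_ : (fun w0 => _) = cst 0%R); last by apply/funext => w0; rewrite all0 normr0 expr0n.
    by rewrite expectation_cst mulr0 subee// abse0.
  apply: le_trans (abse_ge0 _) (ereal_sup_ubound _).
  by exists (0 : E)%R => //; rewrite /unit_ball /= normr0.
have [y y0] : exists y : E, y != 0%R.
  apply: contrapT => /forallNP ny; move/eqP: f0; apply; apply: val_inj; apply/funext => y /=.
  by have -> : y = 0%R by [apply/eqP/negPn/negP/ny]; rewrite dual0E.
have l1 := convexity_constant_ge1 cvxE y0.
have Tc : c0%:E <= type2_constant (dual E) by exact: T2_ge f0.
have T0' : 0 < type2_constant (dual E) by apply: lt_le_trans Tc; rewrite lte_fin.
have [[M2 MM2]|My] : (exists M2 : R, M = M2%:E) \/ M = +oo.
  by case: M M0 {A A0 RHS0} => [r| |]// _; [left; exists r|right].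
- pose V (z : E) := 'E_P0[fun w => (`|X w z| ^+ 2)%R].
  have VE z : V z = \int[P0]_w (`|X w z| ^+ 2)%:E by rewrite /V expectation.unlock.
  have V0 z : 0 <= V z by rewrite VE integral_ge0// => w _; rewrite lee_fin sqr_ge0.
  have maxM2 : \int[P]_w (\big[Num.max/0%R]_(j < m) (`|Xs j w| ^+ 2)%R)%:E <= M2%:E.
    by rewrite -MM2 /M expectation.unlock.
  set S := ereal_sup _ in sigma sigma0 RHS0 *.
  have S_le : S <= M2%:E.
    apply: ge_ereal_sup => _ [z z1 <-]; rewrite -/(V z) VE.
    apply: le_trans (norm_sq_le m0 laws maxM2).
    apply: ge0_le_lower_integral => w; first by rewrite lee_fin sqr_ge0.
    by rewrite lee_fin lerXn2r ?nnegrE//; exact: dual_norm_ub.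
  have S_ge z : unit_ball E z -> V z <= S by move=> z1; apply: ereal_sup_ubound; exists z.
  have S0 : 0 <= S.
    by apply: le_trans (V0 0%R) (S_ge _ _); rewrite /unit_ball /= normr0.
  have [s SE] : exists s : R, S = s%:E.
    by case: S S_le S0 {sigma sigma0 RHS0 S_ge} => [r| |]// _ _; exists r.
  have s0 : (0 <= s)%R by rewrite -lee_fin -SE.
  have sigmaE : sigma = (Num.sqrt s)%:E by rewrite /sigma SE.
  have varX z : unit_ball E z -> \int[P0]_w (`|X w z| ^+ 2)%:E <= s%:E.
    by move=> z1; rewrite -VE -SE S_ge.
  have mL : (m <= 2 ^ (trunc_log 2 m).+1)%N by rewrite ltnW// trunc_log_ltn.
  have := deviation_bound cvxE l1 m0 (ltn0Sn _) mL sepX indep laws maxM2 s0 varX erefl.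
  set a := (_ * _ * _ * _)%R => /le_trans; apply.
  have aA : a%:E <= A.
    have sq : (Num.sqrt ((trunc_log 2 m).+1%:R / m%:R) <= 2 * Num.sqrt (ln m%:R / m%:R) :> R)%R.
      have -> : (2 = Num.sqrt (2 ^+ 2) :> R)%R by rewrite sqrtr_sqr ger0_norm.
      rewrite -sqrtrM ?exprn_ge0// ler_wsqrtr// mulrA ler_pM2r ?invr_gt0//.
      by apply: le_trans (trunc_log_le_ln R m1) _; rewrite expr2 -natrM.
    apply: le_trans (_ : (C * lambda ^+ 4 * c0 * Num.sqrt (ln m%:R / m%:R) * Num.sqrt M2)%:E <= A).
      rewrite lee_fin /a ler_wpM2r ?sqrtr_ge0//.
      apply: le_trans (ler_wpM2l _ sq) _.
        by rewrite mulr_ge0// mulr_ge0 ?exprn_ge0// mulr_ge0 ?exprn_ge0// ltW.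
      rewrite [leLHS]mulrA ler_wpM2r ?sqrtr_ge0// /C.
      rewrite (_ : _ / c0 * _ * c0 = 2 ^+ 23 * lambda ^+ 4)%R; last first.
        by field; rewrite gt_eqF.
      rewrite [leLHS](_ : _ = 2 ^+ 23 * lambda ^+ 3)%R; last by ring.
      by apply: ler_wpM2l; [exact: exprn_ge0|exact: ler_weXn2l].
    rewrite /A MM2 /= (EFinM _ (Num.sqrt M2)) (EFinM _ (Num.sqrt _)) (EFinM _ c0) (EFinM C).
    apply: lee_wpmul2r; first by rewrite lee_fin sqrtr_ge0.
    apply: lee_wpmul2r; first by rewrite lee_fin ltW.
    apply: lee_wpmul2l; last exact: Tc.
    by apply: mule_ge0; rewrite lee_fin ?exprn_ge0// ltW.
  have a0 : (0 <= a)%R.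
    rewrite /a mulr_ge0 ?sqrtr_ge0// mulr_ge0 ?sqrtr_ge0// mulr_ge0// mulr_ge0 ?exprn_ge0//.
    by rewrite mulr_ge0 ?exprn_ge0// ltW.
  rewrite EFinD sigmaE (mulrC a) expr2 (EFinM a) (EFinM _ a) expe2.
  apply: leeD; first by apply: lee_pmul.
  by apply: lee_wpmul2l => //; rewrite lee_fin sqrtr_ge0.
(* With an infinite second moment of the maximum, all other factors of [A] being positive, the right
   side is infinite. *)
- have -> : A = +oo.
    rewrite /A My /= gt0_muley// mule_gt0 ?lte_fin//.
    by rewrite mule_gt0// mule_gt0// lte_fin// exprn_gt0.
  have -> : +oo ^+ 2 = +oo :> \bar R by rewrite expe2 mulyy.
  rewrite addye ?leey//; apply/negP => /eqP h.
  by have := mule_ge0 sigma0 (leey 0); rewrite h.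
Qed.
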